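(* Consider the stochastic $m$-set semi-bandit problem with $d$ base-arms and mean loss vector $\mu$. Assume $a^*=\arg\min_{a\in\mathcal{A}}a^\top\mu$ is unique and let $\Delta_i=\mu_i-\max_{j:a_j^*=1}\mu_j$ and $\Delta=\min_{i:a_i^*=0}\Delta_i$. Then FTPL with perturbation distribution $\mathcal{F}_2$ or $\mathcal{P}_2$ (Fréchet or Pareto with shape $2$), with loss estimation by geometric resampling (GR) or conditional geometric resampling (CGR), and with learning rate $\eta_t=c/\sqrt t$ for a constant $c>0$, satisfies $$\mathcal{R}(T)\le O\Big(\sum_{i:a_i^*=0}\frac{\log T}{\Delta_i}\Big)+O\Big(\frac{m^3d}{\Delta}\Big),$$ where the constants hidden in $O(\cdot)$ depend only on $c$ (not on $m,d,T$ or the loss distribution).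
   Context: **Problem.** $d\in\mathbb{N}$, $m\in[d]=\{1,\dots,d\}$, action set $\mathcal{A}=\{a\in\{0,1\}^d:\|a\|_1=m\}$. At each round $t=1,\dots,T$ a loss vector $\ell_t\in[0,1]^d$ is generated, the learner selects $a_t\in\mathcal{A}$, incurs $\langle \ell_t,a_t\rangle$ and observes only $\ell_{t,i}$ for $i$ with $a_{t,i}=1$. Stochastic setting: $\ell_1,\ell_2,\dots$ are i.i.d. from a fixed unknown distribution on $[0,1]^d$ with mean $\mu$. Pseudo-regret: $\mathcal{R}(T)=\mathbb{E}[\sum_{t=1}^T\langle \ell_t,a_t-a^*\rangle]$. (If $m=d$, the set $\{i:a_i^*=0\}$ is empty; $\Delta$ is then read as $+\infty$.) **Distributions.** Fréchet $\mathcal{F}_\alpha$: CDF $F(x)=e^{-1/x^\alpha}$, $x\ge0$. Pareto $\mathcal{P}_\alpha$: CDF $F(x)=1-x^{-\alpha}$, $x\ge1$. Below $\mathcal{D}_\alpha$ denotes the one chosen, with $\alpha=2$. **FTPL.** $\hat L_1=\mathbf 0$. At round $t$, sample $r_t=(r_{t,1},\dots,r_{t,d})$ with i.i.d. components from $\mathcal{D}_\alpha$, play $a_t=\arg\min_{a\in\mathcal{A}}a^\top(\eta_t\hat L_t-r_t)$ (i.e. the $m$ largest entries of $r_t-\eta_t\hat L_t$). Let $w_{t,i}=\mathbb{P}[a_{t,i}=1\mid\hat L_t]$. Compute estimators $\widehat{w_{t,i}^{-1}}$ of $w_{t,i}^{-1}$ for $i$ with $a_{t,i}=1$, set $\hat\ell_{t,i}=\mathbb{1}[a_{t,i}=1]\,\ell_{t,i}\,\widehat{w_{t,i}^{-1}}$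 and $\hat L_{t+1}=\hat L_t+\hat\ell_t$. **GR.** Draw fresh independent vectors $r'^{(1)},r'^{(2)},\dots$ with i.i.d. components from $\mathcal{D}_\alpha$; $\widehat{w_{t,i}^{-1}}=M_{t,i}$ is the first $s$ such that $i$ is among the indices of the $m$ largest entries of $r'^{(s)}-\eta_t\hat L_t$. **CGR.** Let $\sigma_i$ be the rank of $\hat L_{t,i}$ among $\hat L_{t,1},\dots,\hat L_{t,d}$ in increasing order (ties broken by a fixed rule). Draw fresh independent vectors $r'^{(1)},r'^{(2)},\dots$ with i.i.d. components from $\mathcal{D}_\alpha$. For $i$ with $\sigma_i\le m$: $\widehat{w_{t,i}^{-1}}=M_{t,i}$ is the first $s$ such that $i$ is among the indices of the $m$ largest entries of $r'^{(s)}-\eta_t\hat L_t$. For $i$ with $\sigma_i>m$: at resampling step $s$, with the drawn vector $r'^{(s)}$ and with $\theta^{(s)}$ uniform on $[m]$ (independent), let $i'$ be the index of the $\theta^{(s)}$-th largest value in $\{r'^{(s)}_j:\sigma_j\le\sigma_i\}$ and let $r''^{(s)}$ be $r'^{(s)}$ with entries $i$ and $i'$ swapped; $M_{t,i}$ is the first $s$ such that $i$ is among the indices of the $m$ largest entries of $r''^{(s)}-\eta_t\hat L_t$, and $\widehat{w_{t,i}^{-1}}=(\sigma_i/m)M_{t,i}$. *)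

(* Defs.v *)
From HB Require Import structures.
From mathcomp Require Import all_boot all_order all_algebra fingroup perm finmap.
From mathcomp Require Import all_classical all_reals all_analysis.
Import Order.TTheory GRing.Theory Num.Theory.
Import numFieldNormedType.Exports.

Set Implicit Arguments.
Unset Strict Implicit.
Unset Printing Implicit Defensive.

Local Open Scope classical_set_scope.
Local Open Scope ring_scope.

(* Rounds are indexed by nat, index t standing for round t + 1. *)

Inductive perturbation := Frechet | Pareto.

Definition frechet_cdf (R : realType) (alpha x : R) : R :=
  if 0 < x then expR (- (x `^ alpha)^-1) else 0.

Definition pareto_cdf (R : realType) (alpha x : R) : R :=
  if 1 <= x then 1 - x `^ (- alpha) else 0.

Definition perturbation_cdf (R : realType) (D : perturbation) : R -> R -> R :=
  match D with Frechet => @frechet_cdf R | Pareto => @pareto_cdf R end.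

Section Algorithm.
Variables (R : realType) (d m : nat).
Implicit Types (a : {ffun 'I_d -> bool}) (x L : 'I_d -> R) (i : 'I_d).

(* {ffun 'I_d -> bool} plays the role of {0,1}^d. *)
Definition is_action a : bool := (\sum_i nat_of_bool (a i) == m)%N.

Definition inner x a : R := \sum_i x i * (a i)%:R.

(* The default value is an action as soon as m <= d. *)
Definition argmin_action x : {ffun 'I_d -> bool} :=
  [arg min_(a < [ffun i : 'I_d => (i < m)%N] | is_action a) inner x a]%O.

(* i is among the indices of the m largest entries of x; the entries to which
   this is applied are almost surely pairwise distinct. *)
Definition among_largest x i : bool := (#|[set j | (x i < x j)%R]%SET| < m)%N.

(* Rank, between 1 and d, in increasing order; ties are broken by the priority
   order tie. *)
Definition rank (tie : {perm 'I_d}) L i : nat :=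
  #|[set j | (L j < L i)%R || (L j == L i) && (tie j <= tie i)%N]%SET|.

Inductive resampling := GR | CGR of {perm 'I_d}.

Definition is_cgr (sch : resampling) : bool :=
  if sch is CGR _ then true else false.

(* The index of the (k + 1)-th largest value in {x_j : rank j <= rank i}, when
   there is exactly one such index; this holds almost surely where it is used,
   and i is returned otherwise. *)
Definition kth_largest tie L x i (k : nat) : 'I_d :=
  odflt i [pick i' | (rank tie L i' <= rank tie L i)%N &&
    (#|[set j | (rank tie L j <= rank tie L i)%N && (x i' < x j)%R]%SET| == k)].

(* theta is zero-based, i.e. it ranges over 0, ..., m - 1. *)
Definition resampled_vector (sch : resampling) L i x (theta : nat)
    : 'I_d -> R :=
  match sch with
  | GR => x
  | CGR tie => if (rank tie L i <= m)%N then x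
               else fun j => x (tperm i (kth_largest tie L x i theta) j)
  end.

(* Least s >= 1 such that the s-th trial, p s.-1, succeeds; 0 if none does. *)
Definition first_success (p : pred nat) : nat :=
  match pselect (exists s, p s) with
  | left h => (ex_minn h).+1
  | right _ => 0%N
  end.

Definition trials (sch : resampling) (eta : R) L
    (x : nat -> 'I_d -> R) (theta : nat -> nat) i : nat :=
  first_success (fun s => among_largest
    (fun j => resampled_vector sch L i (x s) (theta s) j - eta * L j) i).

Definition inv_weight (sch : resampling) (eta : R) L
    (x : nat -> 'I_d -> R) (theta : nat -> nat) i : R :=
  let M := (trials sch eta L x theta i)%:R in
  match sch with
  | GR => M
  | CGR tie => if (rank tie L i <= m)%N then M
               else (rank tie L i)%:R / m%:R * M
  end.

(* One realization of the losses and of the learner's internal randomness. *)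
Record realization := Realization {
  loss_of : nat -> 'I_d -> R;
  pert_of : nat -> 'I_d -> R;
  repert_of : nat -> nat -> 'I_d -> R;
  theta_of : nat -> nat -> nat }.

Definition learning_rate (c : R) (t : nat) : R := c / Num.sqrt t.+1%:R.

Definition play (c : R) (w : realization) (t : nat) L : {ffun 'I_d -> bool} :=
  argmin_action (fun i => learning_rate c t * L i - pert_of w t i).

Fixpoint cum_loss_estimate (sch : resampling) (c : R) (w : realization)
    (t : nat) : 'I_d -> R :=
  match t with
  | 0 => fun=> 0
  | s.+1 => let L := cum_loss_estimate sch c w s in
      fun i => L i + (play c w s L i)%:R * loss_of w s i *
        inv_weight sch (learning_rate c s) L (repert_of w s) (theta_of w s) i
  end.

Definition ftpl_action (sch : resampling) (c : R) (w : realization) (t : nat) :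
    {ffun 'I_d -> bool} :=
  play c w t (cum_loss_estimate sch c w t).

Definition path_regret (sch : resampling) (c : R) (w : realization)
    (astar : {ffun 'I_d -> bool}) (T : nat) : R :=
  \sum_(t < T) (inner (loss_of w t) (ftpl_action sch c w t)
                - inner (loss_of w t) astar).

Definition unique_argmin (mu : 'I_d -> R) (astar : {ffun 'I_d -> bool}) : Prop :=
  is_action astar /\
  forall a, is_action a -> a <> astar -> inner mu astar < inner mu a.

Definition gap (mu : 'I_d -> R) (astar : {ffun 'I_d -> bool}) i : R :=
  mu i - sup [set mu j | j in [set j | astar j]].

(* Equal to +oo if astar selects every arm. *)
Definition min_gap (mu : 'I_d -> R) (astar : {ffun 'I_d -> bool}) : \bar R :=
  ereal_inf [set (gap mu astar i)%:E | i in [set i | ~~ astar i]].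

End Algorithm.

Arguments GR {d}.

Section Randomness.
Variables (R : realType) (disp : measure_display) (Omega : measurableType disp).
Variables (P : probability Omega R) (d m : nat).

Definition mutually_independent (I : choiceType) (F : I -> set_system Omega) :
    Prop :=
  forall (J : {fset I}) (A : I -> set Omega),
    (forall i, i \in J -> F i (A i)) ->
    P (\bigcap_(i in [set` J]) A i) = (\prod_(i <- J) P (A i))%E.

Record randomness := Randomness {
  loss : nat -> {RV P >-> d.-tuple R};
  pert : nat -> 'I_d -> {RV P >-> R};
  repert : nat -> nat -> 'I_d -> {RV P >-> R};
  theta : nat -> nat -> {RV P >-> nat} }.

Definition realize (X : randomness) (w : Omega) : realization R d :=
  Realization (fun t => tnth (loss X t w)) (fun t i => pert X t i w)
    (fun t s i => repert X t s i w) (fun t s => theta X t s w).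

Definition generated d' (T : measurableType d') (Y : {RV P >-> T}) :
    set_system Omega := preimage_set_system setT Y measurable.

(* Loss vectors (whose coordinates may be dependent), perturbations,
   resampled perturbations and uniform ranks, in this order. *)
Definition source : Type :=
  (nat + nat * 'I_d + nat * nat * 'I_d + nat * nat)%type.

Definition source_sigma (X : randomness) (k : source) : set_system Omega :=
  match k with
  | inl (inl (inl t)) => generated (loss X t)
  | inl (inl (inr (t, i))) => generated (pert X t i)
  | inl (inr (t, s, i)) => generated (repert X t s i)
  | inr (t, s) => generated (theta X t s)
  end.

(* theta is not used by GR, for which its law is left arbitrary (it may be
   constant, so that it need not carry any randomness). *)
Record stochastic_model (D : perturbation) (sch : resampling d)
    (nu : probability (d.-tuple R) R) (X : randomness) : Prop := {
  model_indep : mutually_independent (source_sigma X);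
  model_loss01 : forall t w i, 0 <= tnth (loss X t w) i <= 1;
  model_loss : forall t A, measurable A -> distribution P (loss X t) A = nu A;
  model_pert : forall t i x,
    cdf (pert X t i) x = (perturbation_cdf D 2 x)%:E;
  model_repert : forall t s i x,
    cdf (repert X t s i) x = (perturbation_cdf D 2 x)%:E;
  model_theta : is_cgr sch -> forall t s k, (k < m)%N ->
    P (theta X t s @^-1` [set k]) = (m%:R^-1)%:E }.

Definition regret (sch : resampling d) (c : R) (X : randomness)
    (astar : {ffun 'I_d -> bool}) (T : nat) : \bar R :=
  'E_P[fun w => path_regret m sch c (realize X w) astar T].

End Randomness.

Definition mean_loss (R : realType) (d : nat) (nu : probability (d.-tuple R) R)
    (i : 'I_d) : R :=
  \int[nu]_x tnth x i.

(* Main.v *)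
(** Write [lam = eta L] and compare the learner with the potential
    [N_b(L) = E max_a <a - astar, b r - L>], where [b] is the inverse learning
    rate.  In a round started at [L], with selection probabilities [p_i], the
    quantity [<mu, p> + E N_b'(L + lhat)] exceeds [N_b(L) + <mu, astar>] by at
    most a penalty, due to the growth of [b], and a stability term, the
    expectation of [\sum_i lhat_i (p_i(L) - p_i(L + lhat_i e_i))].

    For [k] outside [astar] let [g_k = 1 / max(1, lam_k - max_astar lam)].  As
    long as [\sum_k g_k^2 <= 1/2], [p_k] is at least of order [g_k^2], and
    penalty and stability are [O(eta \sum_k g_k + m eta \sum_k g_k^2)].  The
    regret of the round is at least [\sum_k Delta_k p_k].  Hence, using the
    round inequality twice and giving up one copy of the regret, AM-GM leaves
    [O(eta^2 \sum_k 1 / Delta_k)], which sums to the logarithmic term.  (If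
    [\sum_k g_k^2 > 1/2], then [\sum_k p_k] is bounded below, and the regret of
    the round alone absorbs the crude bound mentioned next.)  This requires
    [eta m sqrt(m d) = O(Delta)]; the earlier rounds, [O(m^3 d / Delta^2)] in
    number, are handled by the crude bound [O(eta m sqrt(m d))], which follows
    from a reverse Hoelder inequality for the level that the perturbation of an
    arm must exceed for the arm to be selected.

    The GR estimator is a geometric variable of parameter [p_i].  For CGR, the
    perturbations of the arms of rank at most [sigma_i] being exchangeable, a
    trial succeeds with probability exactly [(sigma_i / m) p_i], so that the
    estimator has again mean [1 / p_i] and geometric moments. *)
Require Import Defs.
From HB Require Import structures.
From mathcomp Require Import all_boot all_order all_algebra fingroup perm finmap.
From mathcomp Require Import all_classical all_reals all_analysis.
From mathcomp Require Import measurable_realfun.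
From mathcomp Require Import ring lra zify.
Import Order.TTheory GRing.Theory Num.Theory.
Import numFieldNormedType.Exports.

Set Implicit Arguments.
Unset Strict Implicit.
Unset Printing Implicit Defensive.

Local Open Scope classical_set_scope.
Local Open Scope ring_scope.

(** * Integration and independence *)

(** No density or derivative is used. The Lipschitz bound [tail_lip], with constant
    [6 * invmax y ^+ 3] beyond [y], stands in for the density, and the selection probability of an
    arm is the mean of the tail at its level. The selection probability is thus of the order of the
    second power of [invmax] at the level, whereas the effect of a loss estimate on it is governed
    by the third power; relating the two is the main difficulty.

    The potential is an extended-real expectation of a nonnegative function, and all inequalities on
    it are additive, so that it never has to be shown finite.

    Rounds and resampling trials are all compared with one reference vector of perturbations, that
    of index [0], since selection probabilities depend on the law only.

    The loss estimates are unbounded. For an arm of [astar] the stability bound grows like the cube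
    of the estimate, so that fourth moments enter, of order [p_i ^- 3]; they are harmless because
    [p_i >= 1 / 2] where this bound is used. *)

Section Expectation.
Context {R : realType} {disp : measure_display} {Om : measurableType disp}.
Variable P : probability Om R.
Implicit Types (b : Om -> bool) (f g : Om -> R).

Definition Ex f : \bar R := (\int[P]_w (f w)%:E)%E.
Definition pr b : R := fine (P [set w | b w]).

Lemma measurable_natb d (T : measurableType d) (b : T -> bool) :
  measurable_fun setT b -> measurable_fun setT (fun w => (b w)%:R : R).
Proof.
move=> mb; rewrite (_ : (fun w => _) = fun w => if b w then 1 else 0).
  exact: measurable_fun_ifT.
by apply/funext => w; case: (b w).
Qed.

Lemma measurable_event d (T : measurableType d) (b : T -> bool) :
  measurable_fun setT b -> measurable [set w | b w].
Proof.
move=> /(_ measurableT [set true]); rewrite setTI => /(_ I).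
by rewrite (_ : _ @^-1` _ = [set w | b w]) //; apply/seteqP; split => w /=.
Qed.

Lemma measurable_eventP d (T : measurableType d) (b : T -> bool) :
  measurable [set w | b w] -> measurable_fun setT b.
Proof.
move=> mb; apply: (@measurable_fun_bool _ _ setT b true) => //.
by rewrite setTI (_ : _ @^-1` _ = [set w | b w]) //; apply/seteqP; split => w /=.
Qed.

Lemma prE b : measurable_fun setT b -> P [set w | b w] = (pr b)%:E.
Proof.
by move=> mb; rewrite /pr fineK // fin_num_measure //; exact: measurable_event.
Qed.

Lemma pr_ge0 b : 0 <= pr b.
Proof. by rewrite /pr fine_ge0. Qed.

Lemma pr_le1 b : measurable_fun setT b -> pr b <= 1.
Proof.
by move=> mb; rewrite -lee_fin -prE // probability_le1 //; exact: measurable_event.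
Qed.

Lemma pr_le b b' : measurable_fun setT b -> measurable_fun setT b' ->
  (forall w, b w -> b' w) -> pr b <= pr b'.
Proof.
move=> mb mb' bb'; rewrite -lee_fin -!prE //.
by apply: le_measure; rewrite ?inE //; exact: measurable_event.
Qed.

Lemma eq_pr b b' : b =1 b' -> pr b = pr b'.
Proof. by move=> /funext ->. Qed.

Lemma pr_true : pr (fun=> true) = 1.
Proof.
rewrite /pr (_ : [set _ | _] = setT) ?probability_setT //.
by apply/seteqP; split.
Qed.

Lemma measurable_bigsum d (T : measurableType d) (I : Type) (s : seq I)
    (Q : pred I) (f : I -> T -> R) : (forall i, measurable_fun setT (f i)) ->
  measurable_fun setT (fun w => \sum_(i <- s | Q i) f i w).
Proof.
move=> mf; under eq_fun do rewrite big_mkcond /=.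
by apply: measurable_sum => i; case: (Q i) => //; exact: measurable_cst.
Qed.

Lemma Ex_ge0 f : (forall w, 0 <= f w) -> (0 <= Ex f)%E.
Proof. by move=> f0; apply: integral_ge0 => w _; rewrite lee_fin. Qed.

Lemma Ex_ae_le f g : measurable_fun setT f -> measurable_fun setT g ->
  (forall w, 0 <= f w) -> (forall w, 0 <= g w) ->
  {ae P, forall w, f w <= g w} -> (Ex f <= Ex g)%E.
Proof.
move=> mf mg f0 g0 fg; apply: ae_ge0_le_integral => //.
- by move=> w _; rewrite lee_fin.
- exact/measurable_EFinP.
- by move=> w _; rewrite lee_fin.
- exact/measurable_EFinP.
- by apply: filterS fg => w fg _; rewrite lee_fin.
Qed.

Lemma Ex_le f g : measurable_fun setT f -> measurable_fun setT g ->
  (forall w, 0 <= f w) -> (forall w, f w <= g w) -> (Ex f <= Ex g)%E.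
Proof.
move=> mf mg f0 fg; apply: Ex_ae_le => //; last exact: aeW.
by move=> w; exact: le_trans (fg w).
Qed.

Lemma eq_Ex f g : f =1 g -> Ex f = Ex g.
Proof. by move=> /funext ->. Qed.

Lemma Ex_cst c : Ex (fun=> c) = c%:E.
Proof. by rewrite /Ex integral_cst //= probability_setT mule1. Qed.

Lemma ExD f g : measurable_fun setT f -> measurable_fun setT g ->
  (forall w, 0 <= f w) -> (forall w, 0 <= g w) ->
  Ex (fun w => f w + g w) = (Ex f + Ex g)%E.
Proof.
move=> mf mg f0 g0; rewrite /Ex -ge0_integralD //.
- by move=> w _; rewrite lee_fin.
- exact/measurable_EFinP.
- by move=> w _; rewrite lee_fin.
- exact/measurable_EFinP.
Qed.

Lemma ExZ c f : measurable_fun setT f -> (forall w, 0 <= f w) -> 0 <= c ->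
  Ex (fun w => c * f w) = (c%:E * Ex f)%E.
Proof.
move=> mf f0 c0; rewrite /Ex -ge0_integralZl_EFin //.
- by move=> w _; rewrite lee_fin.
- exact/measurable_EFinP.
Qed.

Lemma Ex_sum (I : Type) (s : seq I) (Q : pred I) (f : I -> Om -> R) :
  (forall i, measurable_fun setT (f i)) -> (forall i w, 0 <= f i w) ->
  Ex (fun w => \sum_(i <- s | Q i) f i w) = (\sum_(i <- s | Q i) Ex (f i))%E.
Proof.
move=> mf f0; elim: s => [|i s IH].
  by rewrite big_nil; under eq_Ex do rewrite big_nil; rewrite Ex_cst.
rewrite big_cons; under eq_Ex do rewrite big_cons.
case: (Q i) => //; rewrite ExD ?IH //.
- exact: measurable_bigsum.
- by move=> w; exact: sumr_ge0.
Qed.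

Lemma Ex_natb b : measurable_fun setT b -> Ex (fun w => (b w)%:R) = (pr b)%:E.
Proof.
move=> mb; rewrite -prE // -[X in P X]setIT.
rewrite -integral_indic //; last exact: measurable_event.
apply: eq_integral => w _; rewrite indicE; congr (_%:R%:E).
by congr nat_of_bool; apply/idP/idP; rewrite inE.
Qed.

Lemma pr_ae_le b b' : measurable_fun setT b -> measurable_fun setT b' ->
  {ae P, forall w, b w -> b' w} -> pr b <= pr b'.
Proof.
move=> mb mb' bb'; rewrite -lee_fin -!Ex_natb //; apply: Ex_ae_le.
- exact: measurable_natb.
- exact: measurable_natb.
- by [].
- by [].
- by apply: filterS bb' => w; case: (b w) => // /(_ isT) ->.
Qed.

Lemma ae_eq_pr b b' : measurable_fun setT b -> measurable_fun setT b' ->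
  {ae P, forall w, b w = b' w} -> pr b = pr b'.
Proof.
move=> mb mb' bb'; apply/eqP; rewrite eq_le !pr_ae_le //;
by apply: filterS bb' => w ->.
Qed.

Lemma prN b : measurable_fun setT b -> pr (fun w => ~~ b w) = 1 - pr b.
Proof.
move=> mb; apply: EFin_inj; rewrite EFinB -!prE //; last exact: measurable_neg.
rewrite -probability_setC; last exact: measurable_event.
by congr (P _); apply/seteqP; split => w /= /negP.
Qed.

Lemma measurable_exists d (T : measurableType d) (I : finType) (Q : pred I)
    (b : I -> T -> bool) : (forall i, measurable_fun setT (b i)) ->
  measurable_fun setT (fun w => [exists i, Q i && b i w]).
Proof.
move=> mb; apply: measurable_eventP.
rewrite (_ : [set w | _] = \bigcup_(i in [set i | Q i]) [set w | b i w]).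
  apply: fin_bigcup_measurable; first exact: finite_finset.
  by move=> i _; exact: measurable_event.
apply/seteqP; split => w /=.
  by move=> /existsP[i /andP[Qi bi]]; exists i.
by move=> [i Qi bi]; apply/existsP; exists i; rewrite Qi.
Qed.

Lemma measurable_forall d (T : measurableType d) (I : finType) (Q : pred I)
    (b : I -> T -> bool) : (forall i, measurable_fun setT (b i)) ->
  measurable_fun setT (fun w => [forall i, Q i ==> b i w]).
Proof.
move=> mb; rewrite (_ : (fun w => _) = fun w => ~~ [exists i, Q i && ~~ b i w]).
  by apply: measurable_neg; apply: measurable_exists => i; exact: measurable_neg.
apply/funext => w; rewrite negb_exists; apply: eq_forallb => i.
by case: (Q i) => //=; rewrite negbK.
Qed.

Lemma pr_exists (I : finType) (Q : pred I) (b : I -> Om -> bool) :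
  (forall i, measurable_fun setT (b i)) ->
  pr (fun w => [exists i, Q i && b i w]) <= \sum_(i | Q i) pr (b i).
Proof.
move=> mb; rewrite -lee_fin -Ex_natb; last exact: measurable_exists.
rewrite -sumEFin; under eq_bigr do rewrite -Ex_natb //.
rewrite -Ex_sum; last 2 first.
- by move=> i; exact: measurable_natb.
- by [].
apply: Ex_le.
- by apply: measurable_natb; exact: measurable_exists.
- by apply: measurable_bigsum => i; exact: measurable_natb.
- by [].
- move=> w; case: existsP => [[i /andP[Qi bi]]|_]; last exact: sumr_ge0.
  by rewrite (bigD1 i) //= bi lerDl sumr_ge0.
Qed.

Lemma pr_or b b' : measurable_fun setT b -> measurable_fun setT b' ->
  pr (fun w => b w || b' w) <= pr b + pr b'.
Proof.
move=> mb mb'; rewrite -lee_fin EFinD -!Ex_natb //; last exact: measurable_or.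
rewrite -ExD; [|exact: measurable_natb|exact: measurable_natb|by []|by []].
apply: Ex_le => //; last by move=> w; case: (b w); case: (b' w) => /=; lra.
  by apply: measurable_natb; exact: measurable_or.
by apply: measurable_funD; exact: measurable_natb.
Qed.

End Expectation.

Section Independence.
Context {R : realType} {disp : measure_display} {Om : measurableType disp}.
Variable P : probability Om R.

(** The joint law of [(X, Y)] agrees with the product of the two laws on rectangles, hence
    everywhere; Tonelli's theorem then separates the integrations. *)
Lemma integral_indep d1 d2 (T1 : measurableType d1) (T2 : measurableType d2)
    (X : Om -> T1) (Y : Om -> T2) (h : T1 * T2 -> \bar R) :
  measurable_fun setT X -> measurable_fun setT Y ->
  (forall A B, measurable A -> measurable B ->
     P (X @^-1` A `&` Y @^-1` B) = (P (X @^-1` A) * P (Y @^-1` B))%E) ->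
  measurable_fun setT h -> (forall z, (0 <= h z)%E) ->
  (\int[P]_w h (X w, Y w) = \int[P]_w \int[P]_w' h (X w, Y w'))%E.
Proof.
move=> mX mY XY mh h0.
have mXY : measurable_fun setT (fun w => (X w, Y w)).
  exact: measurable_fun_pair.
pose X' : {mfun Om >-> T1} := HB.pack X (isMeasurableFun.Build _ _ _ _ X mX).
pose Y' : {mfun Om >-> T2} := HB.pack Y (isMeasurableFun.Build _ _ _ _ Y mY).
pose Z' : {mfun Om >-> (T1 * T2)%type} :=
  HB.pack (fun w => (X w, Y w)) (isMeasurableFun.Build _ _ _ _ _ mXY).
have -> : (\int[P]_w h (X w, Y w) = \int[distribution P Z']_z h z)%E.
  by rewrite ge0_integral_distribution.
have -> : (\int[distribution P Z']_z h z =
           \int[distribution P X' \x distribution P Y']_z h z)%E.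
  apply/esym/eq_measure_integral => A mA _.
  exact: product_measure_unique.
rewrite fubini_tonelli1 // ge0_integral_distribution //=; last 2 first.
- exact: measurable_fun_fubini_tonelli_F.
- by move=> x; apply: integral_ge0.
apply: eq_integral => w _; rewrite /fubini_F /= ge0_integral_distribution //.
exact: measurableT_comp.
Qed.

End Independence.

(** * Independence of the sigma-algebras generated by disjoint sets of sources *)

Section Grouping.
Context {R : realType} {disp : measure_display} {Om : measurableType disp}.
Variable P : probability Om R.
Variables (I : choiceType) (F : I -> set_system Om).

Definition sources (A : set I) : set_system Om := \bigcup_(k in A) F k.

Hypothesis Fmeas : forall k, F k `<=` measurable.
Hypothesis FT : forall k, F k setT.
Hypothesis FI : forall k, setI_closed (F k).
Hypothesis indF : mutually_independent P F.

(** The union of the [F k] is not stable under intersection. Finite intersections are, and generate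
    the same sigma-algebra, so that measures can be identified on them. *)
Let cylinders (A : set I) : set_system Om :=
  [set X | exists (J : {fset I}) (E : I -> set Om),
    [/\ [set` J] `<=` A, (forall i, i \in J -> F i (E i)) &
        X = \bigcap_(i in [set` J]) E i]].

Let cylinders_setI A : setI_closed (cylinders A).
Proof.
move=> _ _ [J [E [JA FE ->]]] [J' [E' [J'A FE' ->]]].
exists (J `|` J')%fset, (fun i => (if i \in J then E i else setT) `&`
  (if i \in J' then E' i else setT)); split.
- by move=> i /=; rewrite in_fsetU => /orP[/JA|/J'A].
- move=> i _; apply: FI.
    by case: ifPn => [/FE //|_]; exact: FT.
  by case: ifPn => [/FE' //|_]; exact: FT.
- apply/seteqP; split => w /=.
    move=> [Ew E'w] i _; split; case: ifPn => // iJ; [exact: Ew|exact: E'w].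
  move=> Ew; split => i /= iJ.
    by have [|+ _] := Ew i; rewrite /= ?in_fsetU iJ.
  by have [|_ +] := Ew i; rewrite /= ?in_fsetU iJ ?orbT.
Qed.

Let cylinders_measurable A : cylinders A `<=` measurable.
Proof.
move=> _ [J [E [JA FE ->]]].
apply: fin_bigcap_measurable; first exact: finite_fset.
by move=> i iJ; apply: Fmeas; exact: FE.
Qed.

Let sources_cylinders A : <<s sources A >> `<=` <<s cylinders A >>.
Proof.
apply: smallest_sub; first exact: smallest_sigma_algebra.
move=> X [k Ak FX]; apply: sub_sigma_algebra.
exists [fset k]%fset, (fun=> X); split.
- by move=> i /=; rewrite inE => /eqP ->.
- by move=> i /=; rewrite inE => /eqP ->.
- apply/seteqP; split => w /=; first by move=> Xw i _.
  by move=> /(_ k); apply; rewrite /= inE.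
Qed.

Lemma sub_sources_measurable A : <<s sources A >> `<=` measurable.
Proof.
apply: smallest_sub; first exact: sigma_algebra_measurable.
by move=> X [k _]; exact: Fmeas.
Qed.

Let cylinders_sigma_measurable A : <<s cylinders A >> `<=` measurable.
Proof.
apply: smallest_sub; first exact: sigma_algebra_measurable.
exact: cylinders_measurable.
Qed.

(** As [A] and [B] are disjoint, the two finite families glue into one, to which mutual independence
    applies. *)
Let indep_cylinders A B X Y : A `&` B = set0 -> cylinders A X ->
  cylinders B Y -> P (X `&` Y) = (P X * P Y)%E.
Proof.
move=> AB [J [E [JA FE ->]]] [J' [E' [J'B FE' ->]]].
have disj i : i \in J -> i \in J' -> False.
  move=> iJ iJ'; have : (A `&` B) i by split; [exact: JA|exact: J'B].
  by rewrite AB.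
pose E'' i := if i \in J then E i else E' i.
have -> : \bigcap_(i in [set` J]) E i `&` \bigcap_(i in [set` J']) E' i =
    \bigcap_(i in [set` (J `|` J')%fset]) E'' i.
  apply/seteqP; split => w /=.
    move=> [Ew E'w] i /=; rewrite /E'' in_fsetU; case: ifPn => /= iJ.
      by move=> _; exact: Ew.
    by move=> iJ'; exact: E'w.
  move=> Ew; split => i /= iJ.
    by have := Ew i; rewrite /= in_fsetU iJ /E'' iJ; exact.
  have := Ew i; rewrite /= in_fsetU iJ orbT /E''; case: ifPn; last by move=> _; exact.
  by move=> /disj /(_ iJ).
rewrite !indF //; last first.
  by move=> i; rewrite in_fsetU /E''; case: ifPn => [/FE //|_ /= /FE'].
rewrite (perm_big (J ++ J')%SEQ) /=; last first.
  apply: uniq_perm; first exact: fset_uniq.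
    rewrite cat_uniq !fset_uniq andbT /=; apply/hasPn => i iJ'.
    by apply/negP => iJ; exact: disj iJ iJ'.
  by move=> i; rewrite in_fsetU mem_cat.
rewrite big_cat /=; congr (_ * _)%E; apply: eq_big_seq => i iJ.
  by rewrite /E'' iJ.
by rewrite /E''; case: ifPn => // /disj /(_ iJ).
Qed.

(** For fixed [Y], both sides are finite measures in [X], so agreement on the pi-system [G] extends
    to the sigma-algebra it generates. *)
Let indep_extend (G : set_system Om) Y : measurable Y -> setI_closed G ->
  G `<=` measurable -> G setT ->
  (forall X, G X -> P (X `&` Y) = (P X * P Y)%E) ->
  forall X, <<s G >> X -> P (X `&` Y) = (P X * P Y)%E.
Proof.
move=> mY GI Gm GT GP X GX.
have PYfin : P Y \is a fin_num by exact: fin_num_measure.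
have PY0 : (0 <= fine (P Y))%R by rewrite fine_ge0.
pose m1 : {measure set Om -> \bar R} := mrestr P mY.
pose m2 : {measure set Om -> \bar R} := mscale (NngNum PY0) P.
have m2E Z : m2 Z = (P Z * P Y)%E by rewrite /m2 /= /mscale /= fineK // muleC.
rewrite -m2E -[LHS]/(m1 X).
apply: (g_sigma_algebra_measure_unique G Gm (fun=> setT)) => //.
- by rewrite bigcup_const //; exists 0%N.
- by move=> Z GZ; rewrite m2E -GP.
- move=> _; rewrite /m1 /= /mrestr setTI ltey_eq.
  by rewrite fin_num_measure.
Qed.

Let cylindersT A : cylinders A setT.
Proof.
exists fset0, (fun=> setT); split; try by move=> i /=; rewrite inE.
by apply/seteqP; split.
Qed.

Lemma indep_sources A B X Y : A `&` B = set0 -> <<s sources A >> X ->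
  <<s sources B >> Y -> P (X `&` Y) = (P X * P Y)%E.
Proof.
move=> AB /sources_cylinders AX /sources_cylinders BY.
apply: (indep_extend _ (@cylinders_setI A)) AX => //.
- exact: cylinders_sigma_measurable BY.
move=> X' AX'; rewrite setIC muleC.
apply: (indep_extend _ (@cylinders_setI B)) BY => //.
- exact: cylinders_measurable AX'.
move=> Y' BY'; rewrite setIC muleC; exact: indep_cylinders AB AX' BY'.
Qed.

(* [Om] with the sigma-algebra generated by the sources in [A]: measurability of
   [f : srcT A -> T] says that [f] is a function of these sources only. *)
Definition srcT (A : set I) : Type := g_sigma_algebraType (sources A).
HB.instance Definition _ A := Measurable.on (srcT A).

Lemma srcT_measurable d (T : measurableType d) A (f : Om -> T) :
  measurable_fun setT (f : srcT A -> T) -> measurable_fun setT f.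
Proof.
move=> mf _ B mB; apply: (@sub_sources_measurable A).
by have := mf measurableT B mB.
Qed.

Lemma srcTS d (T : measurableType d) A B (f : Om -> T) : A `<=` B ->
  measurable_fun setT (f : srcT A -> T) -> measurable_fun setT (f : srcT B -> T).
Proof.
move=> AB mf _ C mC; have := mf measurableT C mC.
apply: sub_sigma_algebra2.
exact: bigcup_subset.
Qed.

Lemma srcT_gen d (T : measurableType d) A k (f : Om -> T) : A k ->
  (forall C, measurable C -> F k (f @^-1` C)) ->
  measurable_fun setT (f : srcT A -> T).
Proof.
by move=> Ak Ff _ C mC; rewrite setTI; apply: sub_sigma_algebra; exists k => //; exact: Ff.
Qed.

(** [Y] may be the identity of [Om], seen as a map into [srcT B]: in this way a whole round is
    integrated with its starting point frozen. *)
Lemma integral_src d1 d2 (T1 : measurableType d1) (T2 : measurableType d2) A B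
    (X : Om -> T1) (Y : Om -> T2) (h : T1 * T2 -> \bar R) : A `&` B = set0 ->
  measurable_fun setT (X : srcT A -> T1) ->
  measurable_fun setT (Y : srcT B -> T2) ->
  measurable_fun setT h -> (forall z, (0 <= h z)%E) ->
  (\int[P]_w h (X w, Y w) = \int[P]_w \int[P]_w' h (X w, Y w'))%E.
Proof.
move=> AB mX mY mh h0; apply: integral_indep => //.
- exact: srcT_measurable mX.
- exact: srcT_measurable mY.
move=> C D mC mD; apply: (indep_sources AB).
  by have := mX measurableT C mC; rewrite setTI.
by have := mY measurableT D mD; rewrite setTI.
Qed.

Lemma pr_indep A B (b b' : Om -> bool) : A `&` B = set0 ->
  measurable_fun setT (b : srcT A -> bool) ->
  measurable_fun setT (b' : srcT B -> bool) ->
  pr P (fun w => b w && b' w) = pr P b * pr P b'.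
Proof.
move=> AB mb mb'; apply: EFin_inj.
have mb2 := srcT_measurable mb; have mb2' := srcT_measurable mb'.
rewrite EFinM -!prE //; last exact: measurable_and.
rewrite -(indep_sources AB); last 2 first.
- exact: measurable_event mb.
- exact: measurable_event mb'.
by congr (P _); apply/seteqP; split => w /= => [/andP[]|[-> ->]].
Qed.

Lemma Ex_indep A B (f g : Om -> R) : A `&` B = set0 ->
  measurable_fun setT (f : srcT A -> R) ->
  measurable_fun setT (g : srcT B -> R) ->
  (forall w, 0 <= f w) -> (forall w, 0 <= g w) ->
  Ex P (fun w => f w * g w) = (Ex P f * Ex P g)%E.
Proof.
move=> AB mf mg f0 g0.
have -> : Ex P (fun w => f w * g w) =
    Ex P (fun w => `|f w| * `|g w|).
  by apply: eq_Ex => w; rewrite !ger0_norm.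
pose h (z : R * R) : \bar R := (`|z.1| * `|z.2|)%:E.
have mh : measurable_fun setT h.
  apply/measurable_EFinP; apply: measurable_funM;
  exact: measurableT_comp.
rewrite /Ex (@integral_src _ _ _ _ A B f g h) //.
under eq_integral => w _.
  rewrite (_ : (\int[P]_w' h (f w, g w'))%E = (`|f w|%:E * Ex P g)%E); last first.
    rewrite -ExZ //; last exact: srcT_measurable mg.
    by apply: eq_Ex => w'; rewrite /= (ger0_norm (g0 _)).
  rewrite ger0_norm //.
  over.
rewrite ge0_integralZr //.
- apply/measurable_EFinP; exact: srcT_measurable mf.
- by move=> w _; rewrite lee_fin.
- exact: Ex_ge0.
by move=> z; rewrite lee_fin mulr_ge0.
Qed.

End Grouping.

Section FiniteTables.
Context d (T : measurableType d).

(** Reduces the measurability of counts, ranks and argmins to that of finitely many comparisons. *)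
Lemma measurable_table (I : finType) d' (U : measurableType d')
    (b : I -> T -> bool) (G : {ffun I -> bool} -> U) :
  (forall i, measurable_fun setT (b i)) ->
  measurable_fun setT (fun w => G [ffun i => b i w]).
Proof.
move=> mb _ A mA; rewrite setTI.
rewrite (_ : _ @^-1` A = \bigcup_(f in [set f | A (G f)])
    [set w | [forall i, true ==> (b i w == f i)]]).
  apply: fin_bigcup_measurable; first exact: finite_finset.
  move=> f _; apply: measurable_event; apply: measurable_forall => i.
  case: (f i).
    by rewrite (_ : (fun _ => _) = b i) //; apply/funext => w; rewrite eqb_id.
  by under eq_fun do rewrite eqbF_neg; exact: measurable_neg.
apply/seteqP; split => w /=.
  by move=> Aw; exists [ffun i => b i w] => //=; apply/forallP => i; rewrite ffunE.
move=> [f Af /forallP bf]; rewrite (_ : [ffun _ => _] = f) //.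
by apply/ffunP => i; rewrite ffunE; exact: (eqP (bf i)).
Qed.

End FiniteTables.

(** * Laws of real variables and of vectors with independent entries *)

Section Laws.
Context {R : realType} {disp : measure_display} {Om : measurableType disp}.
Variable P : probability Om R.

Lemma generated_measurable d' (U : measurableType d') (Y : {RV P >-> U}) :
  Defs.generated Y `<=` measurable.
Proof. by move=> _ [A mA <-]; exact: (@measurable_funP _ _ _ _ _ Y measurableT). Qed.

Lemma generatedT d' (U : measurableType d') (Y : {RV P >-> U}) :
  Defs.generated Y setT.
Proof. by exists setT => //; rewrite preimage_setT setTI. Qed.

Lemma generatedI d' (U : measurableType d') (Y : {RV P >-> U}) :
  setI_closed (Defs.generated Y).
Proof.
move=> _ _ [A mA <-] [B mB <-]; exists (A `&` B); first exact: measurableI.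
by rewrite !setTI preimage_setI.
Qed.

Lemma generated_preimage d' (U : measurableType d') (Y : {RV P >-> U}) C :
  measurable C -> Defs.generated Y (Y @^-1` C).
Proof. by move=> mC; exists C => //; rewrite setTI. Qed.

Lemma eq_law (Y Z : {RV P >-> R}) : (forall x, cdf Y x = cdf Z x) ->
  forall B, measurable B -> P (Y @^-1` B) = P (Z @^-1` B).
Proof.
move=> YZ B mB.
apply: (@measure_unique _ R R (@RGenOInfty.G R) (fun n => `]- n%:R, +oo[%classic)
   _ _ _ _ (distribution P Y) (distribution P Z)) => //.
- exact: RGenOInfty.measurableE.
- move=> _ _ [x ->] [y ->]; exists (Num.max x y).
  by apply/seteqP; split => z /=; rewrite !in_itv /= !andbT gt_max; [move=> [-> ->]|move=> /andP].
- by move=> i; exists (- i%:R).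
- apply/seteqP; split => // x _; exists (Num.bound `|x|) => //=.
  rewrite in_itv /= andbT ltrNl; apply: le_lt_trans (archi_boundP (normr_ge0 x)).
  by rewrite -normrN ler_norm.
- move=> _ [x ->].
  have -> : `]x, +oo[%classic = ~` (`]-oo, x]%classic : set R).
    by rewrite setCitvl.
  have H (W : {RV P >-> R}) :
      distribution P W (~` `]-oo, x]%classic) = (1 - cdf W x)%E.
    exact: probability_setC.
  by transitivity (1 - cdf Y x)%E; [exact: H|rewrite YZ; exact/esym/H].
- by move=> k; rewrite (le_lt_trans (probability_le1 _ _)) ?ltry.
Qed.

Variables (d : nat).
Implicit Types r : 'I_d -> {RV P >-> R}.

Lemma indep_forall r (p : 'I_d -> R -> bool) :
  mutually_independent P (fun i => Defs.generated (r i)) ->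
  (forall i, measurable_fun setT (p i)) ->
  pr P (fun w => [forall i, p i (r i w)]) = \prod_i pr P (fun w => p i (r i w)).
Proof.
move=> ind mp; apply: EFin_inj.
have mpr i : measurable_fun setT (fun w => p i (r i w)).
  exact: measurableT_comp.
rewrite -prE; last first.
  rewrite (_ : (fun w => _) = fun w => [forall i, true ==> p i (r i w)]) //.
  exact: measurable_forall.
have := ind [fset i | i : 'I_d]%fset (fun i => [set w | p i (r i w)]).
rewrite (_ : \bigcap_(i in _) _ = [set w | [forall i, p i (r i w)]]); last first.
  apply/seteqP; split => w /=.
    by move=> pw; apply/forallP => i; apply: pw => /=; rewrite !inE.
  by move=> /forallP pw i _; exact: pw.
move=> ->; last first.
  move=> i _; apply: (@generated_preimage _ _ (r i) [set x | p i x]).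
  exact: measurable_event.
rewrite (perm_big (index_enum 'I_d)) /=; last first.
  apply: uniq_perm; [exact: fset_uniq|exact: index_enum_uniq|].
  by move=> i; rewrite mem_index_enum !inE.
rewrite (big_morph EFin EFinM (erefl (1%:E))).
by apply: eq_bigr => i _; rewrite prE.
Qed.

(** Serves to pass from one round or trial to another and, with [r'] a permutation of [r], as
    exchangeability. *)
Lemma eq_joint_law r r' :
  mutually_independent P (fun i => Defs.generated (r i)) ->
  mutually_independent P (fun i => Defs.generated (r' i)) ->
  (forall i x, cdf (r i) x = cdf (r' i) x) ->
  forall b : d.-tuple R -> bool, measurable_fun setT b ->
  pr P (fun w => b [tuple r i w | i < d]) = pr P (fun w => b [tuple r' i w | i < d]).
Proof.
move=> ind ind' rr' b mb.
have mtup (q : 'I_d -> {RV P >-> R}) :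
    measurable_fun setT (fun w => [tuple q i w | i < d]).
  apply/measurable_fun_tnthP => i.
  by rewrite (_ : _ \o _ = q i) //; apply/funext => w /=; rewrite tnth_mktuple.
pose X : {RV P >-> d.-tuple R} :=
  HB.pack (fun w => [tuple r i w | i < d]) (isMeasurableFun.Build _ _ _ _ _ (mtup r)).
pose X' : {RV P >-> d.-tuple R} :=
  HB.pack (fun w => [tuple r' i w | i < d]) (isMeasurableFun.Build _ _ _ _ _ (mtup r')).
pose rect (E : 'I_d -> set R) := [set x : d.-tuple R | forall i, E i (tnth x i)].
pose G := [set A | exists E, (forall i, measurable (E i)) /\ A = rect E].
rewrite /pr; congr fine.
apply: (@measure_unique _ R (d.-tuple R) G (fun=> setT)
   _ _ _ _ (distribution P X) (distribution P X') _ _ [set x | b x]) => //.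
(* The sigma-algebra of tuples is generated by the coordinates, hence also by the rectangles, which
   are stable under intersection. *)
- apply/seteqP; split.
    apply: smallest_sub; first exact: smallest_sigma_algebra.
    rewrite -bigcup_seq /= => A [i _ [B mB <-]]; apply: sub_sigma_algebra.
    exists (fun j => if j == i then B else setT); split.
      by move=> j; case: ifP.
    apply/seteqP; split => x /=.
      by move=> [_ Bx] j; case: eqP => // ->.
    by move=> /(_ i); rewrite eqxx.
  apply: smallest_sub; first exact: sigma_algebra_measurable.
  move=> _ [E [mE ->]].
  rewrite (_ : rect E = \bigcap_(i in [set: 'I_d]) ((fun x => tnth x i) @^-1` E i)).
    apply: fin_bigcap_measurable => // i _; rewrite -[X in measurable X]setTI.
    exact: measurable_tnth.
  by apply/seteqP; split => x /= Exi i; [move=> _|]; exact: Exi.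
- move=> _ _ [E [mE ->]] [E' [mE' ->]].
  exists (fun i => E i `&` E' i); split; first by move=> i; exact: measurableI.
  apply/seteqP; split => x /=; first by move=> [xE xE'] i; split.
  by move=> xE; split => i; have [] := xE i.
- by move=> _; exists (fun=> setT); split => //; apply/seteqP; split.
- by rewrite bigcup_const //; exists 0%N.
- move=> _ [E [mE ->]].
  have H (q : 'I_d -> {RV P >-> R}) :
     [set w | rect E [tuple q i w | i < d]] =
     [set w | [forall i, (fun x => `[< E i x >]) (q i w)]].
    apply/seteqP; split => w /=.
      by move=> Ew; apply/forallP => i; apply/asboolP; have := Ew i; rewrite tnth_mktuple.
    by move=> /forallP Ew i; rewrite tnth_mktuple; exact/asboolP.
  have mE2 i : measurable_fun setT (fun x => `[< E i x >]).
    apply: measurable_eventP; rewrite (_ : [set _ | _] = E i) //.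
    by apply/seteqP; split => x /= /asboolP.
  rewrite /= /distribution /pushforward /=.
  rewrite -[LHS]/(P [set w | rect E [tuple r i w | i < d]]) H.
  rewrite -[RHS]/(P [set w | rect E [tuple r' i w | i < d]]) H.
  have mf (q : 'I_d -> {RV P >-> R}) :
     measurable_fun setT (fun w => [forall i, (fun x => `[< E i x >]) (q i w)]).
    rewrite (_ : (fun w => _) = fun w => [forall i, true ==> `[< E i (q i w) >]]) //.
    by apply: measurable_forall => i; exact: (measurableT_comp (mE2 i)).
  rewrite !prE // !(@indep_forall _ (fun i x => `[< E i x >])) //.
  congr EFin; apply: eq_bigr => i _; rewrite /pr; congr fine.
  have HE (q : {RV P >-> R}) : [set w | `[< E i (q w) >]] = q @^-1` (E i).
    by apply/seteqP; split => w /= /asboolP.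
  rewrite !HE; exact: (eq_law (rr' i) (mE i)).
- by move=> k; rewrite (le_lt_trans (probability_le1 _ _)) ?ltry.
- exact: measurable_event.
Qed.

End Laws.

(** * Selection of the largest entries *)

Section Tails.
Context {R : realType}.
Implicit Types (D : perturbation) (x y z : R).

Definition tail D y : R := 1 - perturbation_cdf D 2 y.

(* Up to constant factors, [invmax y ^+ 2] is the tail of both distributions. *)
Definition invmax y : R := (Num.max y 1)^-1.

Lemma invmax_gt0 y : 0 < invmax y.
Proof. by rewrite invr_gt0 lt_max ltr01 orbT. Qed.

Lemma invmax_ge0 y : 0 <= invmax y. Proof. exact: ltW (invmax_gt0 y). Qed.

Lemma invmax_le1 y : invmax y <= 1.
Proof. by rewrite invf_le1 ?le_max ?lexx ?orbT // lt_max ltr01 orbT. Qed.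

Lemma invmax_le x y : x <= y -> invmax y <= invmax x.
Proof.
move=> xy; rewrite lef_pV2 ?posrE ?lt_max ?ltr01 ?orbT //.
by rewrite ge_max !le_max xy lexx !orbT.
Qed.

Lemma invmaxE1 y : 1 <= y -> invmax y = y^-1.
Proof. by move=> y1; rewrite /invmax max_l. Qed.

Lemma invmaxE2 y : y <= 1 -> invmax y = 1.
Proof. by move=> y1; rewrite /invmax max_r ?invr1. Qed.

(** All factors lost to a shift of the argument come from here: [max (x + y) 1] is at most
    [(1 + y) * max x 1]. *)
Lemma invmaxD x y : 0 <= y -> invmax x <= (1 + y) * invmax (x + y).
Proof.
move=> y0; rewrite /invmax.
have mx : 0 < Num.max x 1 by rewrite lt_max ltr01 orbT.
have my : 0 < Num.max (x + y) 1 by rewrite lt_max ltr01 orbT.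
rewrite -ler_pdivrMr ?invr_gt0 // invrK mulrC ler_pdivrMr //.
rewrite ge_max; apply/andP; split.
  case: (leP x 1) => x1; nra.
by case: (leP x 1) => x1; nra.
Qed.

Lemma tail_frechet y : 0 < y -> tail Frechet y = 1 - expR (- y^-1 ^+ 2).
Proof.
move=> y0; rewrite /tail /= /frechet_cdf y0.
by rewrite powR_mulrn ?exprVn // ltW.
Qed.

Lemma tail_pareto y : 1 <= y -> tail Pareto y = y^-1 ^+ 2.
Proof.
move=> y1; rewrite /tail /= /pareto_cdf y1.
by rewrite subKr powRN powR_mulrn ?exprVn //; lra.
Qed.

Lemma tail_nonpos D y : y <= 0 -> tail D y = 1.
Proof.
case: D => y0; rewrite /tail /= /frechet_cdf /pareto_cdf.
  by rewrite ltNge y0 subr0.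
by rewrite (_ : (1 <= y) = false) ?subr0 //; apply/negbTE; rewrite -ltNge; lra.
Qed.

Lemma tail_pareto1 y : y <= 1 -> tail Pareto y = 1.
Proof.
rewrite le_eqVlt => /orP[/eqP ->|y1]; first by rewrite tail_pareto // invr1 expr1n.
by rewrite /tail /= /pareto_cdf leNgt y1 subr0.
Qed.

Lemma tail_le D y : tail D y <= invmax y ^+ 2.
Proof.
case: D; case: (leP 1 y) => y1.
- rewrite tail_frechet; last lra.
  rewrite invmaxE1 //; have := expR_ge1Dx (- y^-1 ^+ 2); lra.
- rewrite (invmaxE2 (ltW y1)) ?expr1n // /tail /= /frechet_cdf.
  by case: ifP => _; [have := expR_gt0 (- (y `^ 2)^-1)|]; lra.
- by rewrite tail_pareto // invmaxE1.
- by rewrite (invmaxE2 (ltW y1)) expr1n tail_pareto1 // ltW.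
Qed.

Lemma tail_ge D y : invmax y ^+ 2 / 2 <= tail D y.
Proof.
(* From [expR z >= 1 + z] and [(1 + z) * (1 - z / 2) >= 1] on the unit interval. *)
have key z : 0 <= z -> z <= 1 -> z / 2 <= 1 - expR (- z).
  move=> z0 z1; have ez := expR_ge1Dx z.
  suff : expR (- z) <= 1 - z / 2 by lra.
  rewrite expRN -[_^-1]mul1r ler_pdivrMr ?expR_gt0 //.
  by apply: le_trans (ler_wpM2l _ ez); nra.
case: D; case: (leP 1 y) => y1.
- rewrite tail_frechet; last lra.
  rewrite invmaxE1 //; apply: key; first exact: sqr_ge0.
  rewrite expr_le1 ?invr_ge0 ?invf_le1 //; lra.
- rewrite (invmaxE2 (ltW y1)) ?expr1n //.
  case: (leP y 0) => y0; first by rewrite tail_nonpos //; lra.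
  rewrite tail_frechet //; apply: le_trans (key 1 _ _) _ => //; try lra.
  rewrite lerB // ler_expR lerN2 exprn_ege1 // invf_ge1 //; lra.
- rewrite tail_pareto // invmaxE1 //; have := sqr_ge0 (y^-1); lra.
- by rewrite (invmaxE2 (ltW y1)) expr1n tail_pareto1; lra.
Qed.

Lemma tail_ge0 D y : 0 <= tail D y.
Proof.
by apply: le_trans (tail_ge D y); rewrite divr_ge0 // sqr_ge0.
Qed.

Lemma tail_le1 D y : tail D y <= 1.
Proof.
by apply: le_trans (tail_le D y) _; rewrite expr_le1 // ?invmax_le1 ?invmax_ge0.
Qed.

Lemma expR_sqr_ge z : 0 <= z -> z <= expR (z ^+ 2) /\ z ^+ 3 <= expR (z ^+ 2).
Proof.
move=> z0; split; first by have := expR_ge1Dx (z ^+ 2); nra.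
have -> : z ^+ 2 = z ^+ 2 / 2 + z ^+ 2 / 2 by lra.
rewrite expRD; have := expR_ge1Dx (z ^+ 2 / 2); set e := expR _ => e1.
have : (1 + z ^+ 2 / 2) ^+ 2 <= e * e.
  by rewrite expr2 ler_pM //; have := sqr_ge0 z; lra.
have : 0 <= (z ^+ 2 / 2 - z) ^+ 2 by exact: sqr_ge0.
have := sqr_ge0 z; nra.
Qed.

Lemma inv_sqr_lip y z : 1 <= y -> y <= z ->
  y^-1 ^+ 2 - z^-1 ^+ 2 <= 6 * y^-1 ^+ 3 * (z - y).
Proof.
move=> y1 yz; have y0 : 0 < y by lra. have z0 : 0 < z by lra.
have yu : y * y^-1 = 1 by rewrite divff // gt_eqF.
have zu : z * z^-1 = 1 by rewrite divff // gt_eqF.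
have yi : 0 < y^-1 by rewrite invr_gt0.
have zi : 0 < z^-1 by rewrite invr_gt0.
have yzi : z^-1 <= y^-1 by rewrite lef_pV2.
have e : y^-1 - z^-1 = (z - y) * (y^-1 * z^-1) by field; rewrite ?gt_eqF.
have -> : y^-1 ^+ 2 - z^-1 ^+ 2 = (z - y) * (y^-1 * z^-1) * (y^-1 + z^-1).
  by rewrite -e; ring.
have -> : 6 * y^-1 ^+ 3 * (z - y) = (z - y) * (6 * y^-1 ^+ 3) by ring.
rewrite -mulrA ler_wpM2l ?subr_ge0 //.
have h1 : y^-1 * z^-1 <= y^-1 ^+ 2 by rewrite expr2 ler_wpM2l // ltW.
have h2 : y^-1 + z^-1 <= 2 * y^-1 by lra.
apply: le_trans (ler_pM _ _ h1 h2) _; first by rewrite mulr_ge0 // ltW.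
  by rewrite addr_ge0 // ltW.
have -> : y^-1 ^+ 2 * (2 * y^-1) = 2 * y^-1 ^+ 3 by ring.
by rewrite ler_wpM2r ?exprn_ge0 //; [lra|lra].
Qed.

(** Replaces a bound on the density, which is of order [y ^- 3] at infinity. Near [0] the Frechet
    density is bounded because the exponential beats the power of [y]. *)
Lemma tail_lip D y z : y <= z -> tail D y - tail D z <= 6 * invmax y ^+ 3 * (z - y).
Proof.
move=> yz.
have rhs0 : 0 <= 6 * invmax y ^+ 3 * (z - y).
  by rewrite mulr_ge0 ?subr_ge0 // mulr_ge0 // exprn_ge0 // invmax_ge0.
case: D.
  case: (leP z 0) => z0; first by rewrite !tail_nonpos ?subrr //; lra.
  rewrite [tail _ z]tail_frechet //.
  have zi : 0 < z^-1 by rewrite invr_gt0.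
  have zu : z * z^-1 = 1 by rewrite divff // gt_eqF.
  have [h1 h3] := expR_sqr_ge (ltW zi).
  have e1 : expR (- z^-1 ^+ 2) * expR (z^-1 ^+ 2) = 1 by rewrite expRN mulVf // gt_eqF ?expR_gt0.
  have ez := expR_gt0 (- z^-1 ^+ 2).
  (* Settles the cases in which [z] is at most [2 * (z - y)], namely [y <= 0] and [z > 2 * y]. *)
  have hz : expR (- z^-1 ^+ 2) <= z by nra.
  case: (leP y 0) => y0.
    by rewrite tail_nonpos // invmaxE2 ?expr1n //; lra.
  rewrite tail_frechet //.
  have yi : 0 < y^-1 by rewrite invr_gt0.
  have yu : y * y^-1 = 1 by rewrite divff // gt_eqF.
  have yzi : z^-1 <= y^-1 by rewrite lef_pV2.
  have ey := expR_gt0 (- y^-1 ^+ 2).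
  have step : expR (- z^-1 ^+ 2) - expR (- y^-1 ^+ 2) <=
      expR (- z^-1 ^+ 2) * (y^-1 ^+ 2 - z^-1 ^+ 2).
    have -> : - y^-1 ^+ 2 = - z^-1 ^+ 2 + (z^-1 ^+ 2 - y^-1 ^+ 2) by ring.
    rewrite expRD; have := expR_ge1Dx (z^-1 ^+ 2 - y^-1 ^+ 2); nra.
  case: (leP 1 y) => y1.
    rewrite invmaxE1 //; apply: le_trans (inv_sqr_lip y1 yz).
    have sq : z^-1 ^+ 2 <= y^-1 ^+ 2 by rewrite ler_sqr ?nnegrE // ltW.
    have ez1 : expR (- z^-1 ^+ 2) <= 1.
      by rewrite -expR0 ler_expR oppr_le0 sqr_ge0.
    nra.
  rewrite (invmaxE2 (ltW y1)) ?expr1n // mulr1.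
  (* Here [y^-1 <= 2 * z^-1], so the difference of inverse squares is at most
     [2 * 3 * z^-1 ^+ 3 * (z - y)], and the exponential absorbs [z^-1 ^+ 3]. *)
  case: (leP z (2 * y)) => zy; last by nra.
  have e : y^-1 - z^-1 = (z - y) * (y^-1 * z^-1) by field; rewrite ?gt_eqF.
  have yz2 : y^-1 <= 2 * z^-1.
    have : y^-1 * z^-1 * z <= y^-1 * z^-1 * (2 * y) by rewrite ler_wpM2l // mulr_ge0 // ltW.
    have -> : y^-1 * z^-1 * z = y^-1 by rewrite -mulrA (mulrC z^-1) zu mulr1.
    have -> : y^-1 * z^-1 * (2 * y) = 2 * z^-1 * (y * y^-1) by ring.
    by rewrite yu mulr1.
  have e3 : expR (- z^-1 ^+ 2) * z^-1 ^+ 3 <= 1.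
    by rewrite -e1 ler_wpM2l // ltW.
  have st2 : y^-1 ^+ 2 - z^-1 ^+ 2 <= (z - y) * (6 * z^-1 ^+ 3).
    have -> : y^-1 ^+ 2 - z^-1 ^+ 2 = (z - y) * (y^-1 * z^-1 * (y^-1 + z^-1)).
      by rewrite mulrA -e; ring.
    rewrite ler_wpM2l ?subr_ge0 //.
    have a1 : y^-1 * z^-1 <= 2 * z^-1 ^+ 2.
      by rewrite expr2 mulrA ler_wpM2r // ltW.
    have a2 : y^-1 + z^-1 <= 3 * z^-1 by lra.
    apply: le_trans (ler_pM _ _ a1 a2) _; first by rewrite mulr_ge0 // ltW.
      by rewrite addr_ge0 // ltW.
    by rewrite le_eqVlt; apply/orP; left; apply/eqP; ring.
  have yz0 : 0 <= z - y by lra.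
  have : expR (- z^-1 ^+ 2) * (y^-1 ^+ 2 - z^-1 ^+ 2) <=
      6 * (z - y) * (expR (- z^-1 ^+ 2) * z^-1 ^+ 3).
    have -> : 6 * (z - y) * (expR (- z^-1 ^+ 2) * z^-1 ^+ 3) =
       expR (- z^-1 ^+ 2) * ((z - y) * (6 * z^-1 ^+ 3)) by ring.
    by rewrite ler_wpM2l // ltW.
  have : 6 * (z - y) * (expR (- z^-1 ^+ 2) * z^-1 ^+ 3) <= 6 * (z - y) * 1.
    by rewrite ler_wpM2l //; lra.
  lra.
case: (leP z 1) => z1; first by rewrite !tail_pareto1 ?subrr //; lra.
have z0 : 0 < z by lra.
case: (leP 1 y) => y1.
  rewrite !tail_pareto ?invmaxE1 //; last lra.
  exact: inv_sqr_lip.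
rewrite tail_pareto1 ?tail_pareto ?invmaxE2 ?expr1n //; try lra.
have := @inv_sqr_lip 1 z (lexx _) (ltW z1); rewrite invr1 !expr1n; lra.
Qed.

Lemma tail_noninc D y z : y <= z -> tail D z <= tail D y.
Proof.
case: D => yz.
  case: (leP y 0) => y0; first by rewrite [tail _ y]tail_nonpos // tail_le1.
  rewrite !tail_frechet //; last lra.
  rewrite lerB // ler_expR lerN2 ler_sqr ?nnegrE ?invr_ge0; try lra.
  by rewrite lef_pV2 ?posrE //; lra.
case: (leP y 1) => y1; first by rewrite [tail _ y]tail_pareto1 // tail_le1.
rewrite !tail_pareto; try lra.
rewrite ler_sqr ?nnegrE ?invr_ge0; try lra.
by rewrite lef_pV2 ?posrE //; lra.
Qed.

End Tails.

(** * Counts of exceedances, order statistics and ranks *)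

Section Selection.
Context {R : realType} {d : nat}.
Implicit Types (v x L : 'I_d -> R) (i j k : 'I_d) (S : {set 'I_d}).
Local Open Scope set_scope.

Definition above S v (z : R) : nat := #|[set j in S | z < v j]|.

Lemma among_largestE m v i : among_largest m v i = (above [set~ i] v (v i) < m)%N.
Proof.
rewrite /among_largest /above; congr (_ < _)%N; apply: eq_card => j.
by rewrite !inE; case: eqVneq => // ->; rewrite ltxx.
Qed.

Lemma above_le S v (y z : R) : y <= z -> (above S v z <= above S v y)%N.
Proof.
move=> yz; apply: subset_leq_card; apply/fintype.subsetP => j; rewrite !inE.
by move=> /andP[-> /= zj]; exact: le_lt_trans zj.
Qed.

Lemma among_largest_mono m v v' i :
  (forall j, v' i < v' j -> v i < v j) -> among_largest m v i -> among_largest m v' i.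
Proof.
move=> vv'; apply: leq_ltn_trans; apply: subset_leq_card.
by apply/fintype.subsetP => j; rewrite !inE; exact: vv'.
Qed.

Lemma above_lt S v i j : j \in S -> v i < v j -> (above S v (v j) < above S v (v i))%N.
Proof.
move=> jS ij; apply: proper_card; apply/properP; split.
  by apply/fintype.subsetP => k; rewrite !inE => /andP[-> /=]; exact: lt_trans.
by exists j; rewrite !inE ?jS ?ij // ltxx andbF.
Qed.

Lemma above_inj S v : {in S &, injective v} ->
  {in S &, injective (fun i => above S v (v i))}.
Proof.
move=> injv i j iS jS eij; apply: injv => //; apply/eqP; rewrite eq_le !leNgt.
by apply/andP; split; apply/negP => ij; [have := above_lt iS ij|have := above_lt jS ij]; rewrite eij ltnn.
Qed.

(** The counts are pairwise distinct, as they decrease strictly with the entry, and lie below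
    [#|S|]; so they exhaust [0, ..., #|S| - 1]. *)
Lemma above_iota S v : {in S &, injective v} ->
  perm_eq [seq above S v (v i) | i <- enum S] (iota 0 #|S|).
Proof.
move=> injv.
have uniq_above : uniq [seq above S v (v i) | i <- enum S].
  rewrite map_inj_in_uniq ?enum_uniq // => i j; rewrite !mem_enum.
  exact: above_inj.
apply: uniq_perm => //; first exact: iota_uniq.
have sub : {subset [seq above S v (v i) | i <- enum S] <= iota 0 #|S|}.
  move=> k /mapP[i]; rewrite mem_enum => iS ->; rewrite mem_iota /=.
  apply: proper_card; apply/properP; split.
    by apply/fintype.subsetP => j; rewrite inE => /andP[].
  by exists i; rewrite // inE ltxx andbF.
by have [] := uniq_min_size uniq_above sub _; rewrite ?size_iota ?size_map -?cardE.
Qed.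

Lemma card_above_lt S v m : {in S &, injective v} -> (m <= #|S|)%N ->
  #|[set i in S | above S v (v i) < m]%N| = m.
Proof.
move=> injv mS.
transitivity (count (fun k : nat => k < m)%N [seq above S v (v i) | i <- enum S]).
  rewrite count_map cardE -size_filter; apply: perm_size.
  apply: uniq_perm; first exact: enum_uniq.
    exact/filter_uniq/enum_uniq.
  by move=> i; rewrite mem_enum mem_filter mem_enum inE andbC.
rewrite (seq.permP (above_iota injv)) -size_filter.
rewrite (_ : [seq _ <- _ | _] = iota 0 m) ?size_iota //.
by rewrite -(subnKC mS) iotaD add0n filter_cat
  (_ : [seq _ <- iota m _ | _] = [::]) ?cats0; [
  apply/all_filterP/allP => k; rewrite mem_iota add0n |
  apply/eqP; rewrite -size_eq0 size_filter -leqn0 leqNgt -has_count;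
  apply/hasPn => k; rewrite mem_iota -leqNgt => /andP[]].
Qed.

Lemma above_ex S v (k : nat) : {in S &, injective v} -> (k < #|S|)%N ->
  exists2 i, i \in S & above S v (v i) = k.
Proof.
move=> injv kS.
have : k \in [seq above S v (v i) | i <- enum S].
  by rewrite (perm_mem (above_iota injv)) mem_iota.
by move=> /mapP[i]; rewrite mem_enum => iS ->; exists i.
Qed.

Lemma card_among_largest m v : (m <= d)%N -> injective v ->
  #|[set i | among_largest m v i]| = m.
Proof.
move=> md injv; rewrite -[RHS](@card_above_lt [set: 'I_d] v).
- apply: eq_card => i; rewrite !inE /among_largest /above /=; congr (_ < _)%N.
  by apply: eq_card => j; rewrite !inE.
- by move=> i j _ _; exact: injv.
- by rewrite cardsT card_ord.
Qed.

Lemma is_actionE m (a : {ffun 'I_d -> bool}) : is_action m a = (#|[set i | a i]| == m).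
Proof.
rewrite /is_action -sum1_card; congr (_ == _).
rewrite [RHS](eq_bigl a) => [|i]; last by rewrite inE.
by rewrite [RHS]big_mkcond /=; apply: eq_bigr => i _; case: (a i).
Qed.

Lemma argmin_actionP m x : (m <= d)%N ->
  is_action m (argmin_action m x) /\
  (forall a, is_action m a -> inner x (argmin_action m x) <= inner x a).
Proof.
move=> md; rewrite /argmin_action.
have h0 : is_action m [ffun i : 'I_d => (i < m)%N].
  rewrite is_actionE; apply/eqP; rewrite -[RHS](card_ord m).
  have winj : injective (widen_ord md) by move=> j k /(congr1 val) /= ?; exact: val_inj.
  rewrite -[RHS](card_imset _ winj); apply: eq_card => i.
  rewrite !inE ffunE; apply/idP/imsetP => [im|[j _ ->]]; last exact: (ltn_ord j).
  by exists (Ordinal im) => //; apply: val_inj.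
by case: (arg_minP (inner x) h0).
Qed.

(** If the minimizer differed from the set of the [m] smallest costs, exchanging the two set
    differences, which have equal size, would lower the total strictly. *)
Lemma argmin_action_top m x i : (m <= d)%N -> injective x ->
  argmin_action m x i = among_largest m (fun j => - x j) i.
Proof.
move=> md injx; set a := argmin_action m x.
have [aA amin] := argmin_actionP x md; rewrite -/a in aA amin.
pose v j := - x j.
have injv : injective v by move=> j k /oppr_inj /injx.
pose A := [set j | among_largest m v j]; pose B := [set j | a j].
have cA : #|A| = m by exact: card_among_largest.
have cB : #|B| = m by apply/eqP; rewrite -is_actionE.
have cD : #|A :\: B| = #|B :\: A|.
  by apply/eqP; rewrite -(eqn_add2l #|A :&: B|) cardsID finset.setIC cardsID cA cB.
suff : A = B by move=> /finset.setP /(_ i); rewrite !inE.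
suff AB : #|A :\: B| = 0%N.
  apply/eqP; rewrite finset.eqEsubset -!finset.setD_eq0 -!cards_eq0 -cD AB //.
apply/eqP/negPn/negP => AB0.
have lt_v j k : j \in A -> k \notin A -> v k < v j.
  rewrite !inE /among_largest -leqNgt => jA kA; rewrite ltNge; apply/negP => jk.
  have : (#|[set l | (v k < v l)%R]| <= #|[set l | (v j < v l)%R]|)%N.
    apply: subset_leq_card; apply/fintype.subsetP => l; rewrite !inE; exact: le_lt_trans.
  by move=> /leq_ltn_trans /(_ jA); rewrite ltnNge kA.
have [j jAB] : exists j, j \in A :\: B by apply/finset.set0Pn; rewrite -cards_eq0.
have [k0 kBA] : exists k, k \in B :\: A by apply/finset.set0Pn; rewrite -cards_eq0 -cD.
(* [t] separates the costs on [A :\: B] from the strictly larger ones on [B :\: A]. *)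
pose t := \big[Num.max/x j]_(l in A :\: B) x l.
have tge l : l \in A :\: B -> x l <= t.
  by move=> lAB; rewrite /t; exact: (bigmax_sup l).
have tlt k : k \in B :\: A -> t < x k.
  rewrite inE => /andP[kA kB]; rewrite /t; apply/bigmax_ltP; split.
    rewrite -ltrN2; apply: lt_v => //; by move: jAB; rewrite inE => /andP[].
  by move=> l; rewrite inE => /andP[lB lA]; rewrite -ltrN2; exact: lt_v.
pose b : {ffun 'I_d -> bool} := [ffun j => j \in A].
have bA : is_action m b.
  by rewrite is_actionE -cA; apply/eqP; apply: eq_card => l; rewrite !inE ffunE inE.
have := amin b bA; apply/negP; rewrite -ltNge.
have innerE (c : {ffun 'I_d -> bool}) (C D : {set 'I_d}) : C = [set l | c l] ->
    inner x c = \sum_(l in C :&: D) x l + \sum_(l in C :\: D) x l.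
  move=> ->; rewrite /inner -big_setID /=.
  rewrite [LHS](bigID c) /= [X in _ + X]big1 ?addr0; last first.
    by move=> l /negbTE ->; rewrite mulr0.
  by apply: eq_big => [l|l ->]; rewrite ?inE // mulr1.
rewrite (innerE b A B); last by apply/finset.setP => l; rewrite !inE ffunE inE.
rewrite (innerE a B A) // finset.setIC ltrD2l.
apply: (@le_lt_trans _ _ (\sum_(l in A :\: B) t)).
  by apply: ler_sum => l; exact: tge.
rewrite sumr_const cD -sumr_const; apply: ltr_sum; last by move=> l; exact: tlt.
by apply/hasP; exists k0; rewrite ?mem_index_enum.
Qed.

(* The [m]-th largest of the entries other than [v i], when [0 < m < d]. *)
Definition threshold m v i : R :=
  get [set z | forall y, (above [set~ i] v y < m)%N = (z <= y)]%classic.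

(** As a function of [y], the count is a nonincreasing right-continuous step function, at least [m]
    far to the left since [m < d], and [0 < m] far to the right. It is below [m] exactly on a closed
    ray, whose end is the least entry satisfying [Q]. *)
Lemma thresholdP m v i y : (0 < m < d)%N ->
  (above [set~ i] v y < m)%N = (threshold m v i <= y).
Proof.
move=> /andP[m0 md]; rewrite /threshold.
suff : ([set z | forall y, (above [set~ i] v y < m)%N = (z <= y)] !=set0)%classic.
  by move=> /getPex /(_ y).
have c : #|[set~ i]| = d.-1 by rewrite cardsC1 card_ord.
pose Q j := (j \in [set~ i]) && (above [set~ i] v (v j) < m)%N.
have step (z : R) : (above [set~ i] v z < m)%N -> exists2 j, Q j & v j <= z.
  move=> zm.
  have [j0 j0P] : exists j, (j \in [set~ i]) && (v j <= z).
    apply/existsP; apply: contraT; rewrite negb_exists => /forallP h.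
    suff : (above [set~ i] v z = d.-1)%N by lia.
    rewrite -c /above; apply: eq_card => j; rewrite !inE.
    by have := h j; rewrite !inE negb_and -ltNge; case: (j == i).
  case: (@arg_maxP _ R _ j0 (fun j => (j \in [set~ i]) && (v j <= z)) v j0P) => j /andP[ji jz] jmax; exists j => //; rewrite /Q ji /=.
  apply: leq_ltn_trans zm; apply: subset_leq_card; apply/fintype.subsetP => k.
  rewrite !inE => /andP[ki jk]; rewrite ki /= ltNge; apply/negP => kz.
  by have := jmax k; rewrite !inE ki kz => /(_ isT) /=; rewrite leNgt jk.
pose big : R := \big[Num.max/v i]_j v j.
have [j0 Qj0 _] : exists2 j, Q j & v j <= big.
  apply: step; rewrite /above (_ : [set _ in _ | _] = finset.set0) ?cards0 //.
  apply/finset.setP => j; rewrite !inE; apply/negbTE/nandP; right; rewrite -leNgt.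
  exact: (bigmax_sup j).
case: (@arg_minP _ R _ j0 Q v Qj0) => j /andP[ji jm] jmin.
exists (v j) => z; apply/idP/idP => [/step[k Qk kz]|jz].
  exact: le_trans (jmin k Qk) kz.
by apply: leq_ltn_trans jm; exact: above_le.
Qed.

Lemma among_largest_threshold m v i : (0 < m < d)%N ->
  among_largest m v i = (threshold m v i <= v i).
Proof. by move=> md; rewrite among_largestE thresholdP. Qed.

Section Rank.
Variables (tie : {perm 'I_d}) (L : 'I_d -> R).

Let le j i := (L j < L i) || (L j == L i) && (tie j <= tie i)%N.

Let le_refl i : le i i. Proof. by rewrite /le eqxx leqnn orbT. Qed.

Let le_trans i j k : le i j -> le j k -> le i k.
Proof.
rewrite /le => /orP[ij|/andP[/eqP -> ij]] /orP[jk|/andP[/eqP <- jk]].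
- by rewrite (lt_trans ij jk).
- by rewrite ij.
- by rewrite jk.
- by rewrite eqxx (leq_trans ij jk) orbT.
Qed.

Let le_total i j : le i j || le j i.
Proof.
rewrite /le; case: (ltgtP (L i) (L j)) => //= _; exact: leq_total.
Qed.

Lemma rank_leE i j : (rank tie L j <= rank tie L i)%N = le j i.
Proof.
apply/idP/idP => [|ji]; last first.
  apply: subset_leq_card; apply/fintype.subsetP => k; rewrite !inE -!/(le _ _).
  by move=> kj; exact: le_trans ji.
apply: contraTT => nji; rewrite -ltnNge; apply: proper_card; apply/properP; split.
  apply/fintype.subsetP => k; rewrite !inE -!/(le _ _) => ki; apply: le_trans ki _.
  by have := le_total i j; rewrite (negbTE nji) orbF.
by exists j; rewrite !inE -!/(le _ _).
Qed.

(** Makes [rank tie L i] the number of candidates for the swapped index of CGR, which is the factor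
    gained in [pr_swapped]. *)
Lemma card_rank_le i : #|[set j | rank tie L j <= rank tie L i]%N| = rank tie L i.
Proof. by apply: eq_card => j; rewrite !inE rank_leE. Qed.

Lemma rank_leW i j : (rank tie L j <= rank tie L i)%N -> L j <= L i.
Proof. by rewrite rank_leE => /orP[/ltW|/andP[/eqP ->]]. Qed.

Lemma rank_gt0 i : (0 < rank tie L i)%N.
Proof. by apply/card_gt0P; exists i; rewrite inE -/(le i i). Qed.

End Rank.

End Selection.

(** * Perturbation analysis *)

Section IidPerturbations.
Context {R : realType} {disp : measure_display} {Om : measurableType disp}.
Variable P : probability Om R.
Variables (d : nat) (D : perturbation) (r : 'I_d -> {RV P >-> R}).
Hypothesis ind : mutually_independent P (fun i => Defs.generated (r i)).
Hypothesis law : forall i x, cdf (r i) x = (perturbation_cdf D 2 x)%:E.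
Implicit Types (i j k : 'I_d) (S A B : set 'I_d) (x y z : R).

Local Notation coord A := (srcT (fun i => Defs.generated (r i)) A).

Lemma measurable_coord i A : A i -> measurable_fun setT (r i : coord A -> R).
Proof.
by move=> Ai; apply: (srcT_gen Ai) => C mC; exact: generated_preimage.
Qed.

Let gm i : Defs.generated (r i) `<=` measurable.
Proof. exact: generated_measurable. Qed.

Let gT i : Defs.generated (r i) setT.
Proof. exact: generatedT. Qed.

Let gI i : setI_closed (Defs.generated (r i)).
Proof. exact: generatedI. Qed.

Lemma measurable_of_coord d' (T : measurableType d') A (f : Om -> T) :
  measurable_fun setT (f : coord A -> T) -> measurable_fun setT f.
Proof. exact: srcT_measurable. Qed.

Lemma pr_coordI A B (b b' : Om -> bool) : A `&` B = set0 ->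
  measurable_fun setT (b : coord A -> bool) ->
  measurable_fun setT (b' : coord B -> bool) ->
  pr P (fun w => b w && b' w) = pr P b * pr P b'.
Proof. exact: pr_indep. Qed.

Lemma Ex_coordM A B (f g : Om -> R) : A `&` B = set0 ->
  measurable_fun setT (f : coord A -> R) ->
  measurable_fun setT (g : coord B -> R) ->
  (forall w, 0 <= f w) -> (forall w, 0 <= g w) ->
  Ex P (fun w => f w * g w) = (Ex P f * Ex P g)%E.
Proof. exact: Ex_indep. Qed.

Lemma pr_pert_le i y : pr P (fun w => r i w <= y) = 1 - tail D y.
Proof.
rewrite /tail subKr; apply: EFin_inj; rewrite -(law i) -prE; last first.
  by apply: measurable_fun_ler => //; exact: measurable_cst.
by congr (P _); apply/seteqP; split => w /=; rewrite in_itv.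
Qed.

Lemma pr_pert_gt i y : pr P (fun w => y < r i w) = tail D y.
Proof.
rewrite -[RHS](subKr 1) -(pr_pert_le i) -prN; last first.
  by apply: measurable_fun_ler => //; exact: measurable_cst.
by apply: eq_pr => w; rewrite ltNge.
Qed.

(** The Lipschitz bound on the tail excludes atoms; the shift [e / 6] compensates its constant
    [6]. *)
Lemma pr_pert_ge i y : pr P (fun w => y <= r i w) = tail D y.
Proof.
have m1 z : measurable_fun setT (fun w => z < r i w).
  by apply: measurable_fun_ltr => //; exact: measurable_cst.
have m2 : measurable_fun setT (fun w => y <= r i w).
  by apply: measurable_fun_ler => //; exact: measurable_cst.
apply/eqP; rewrite eq_le; apply/andP; split; last first.
  by rewrite -(pr_pert_gt i); apply: pr_le => // w /ltW.
apply/ler_addgt0Pr => e e0.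
have h : pr P (fun w => y <= r i w) <= tail D (y - e / 6).
  by rewrite -(pr_pert_gt i); apply: pr_le => // w; apply: lt_le_trans; lra.
have lip : tail D (y - e / 6) - tail D y <= 6 * invmax (y - e / 6) ^+ 3 * (e / 6).
  have := @tail_lip _ D (y - e / 6) y.
  by rewrite (_ : y - (y - e / 6) = e / 6); [apply; lra|lra].
have g1 : invmax (y - e / 6) ^+ 3 <= 1.
  by rewrite exprn_ile1 ?invmax_ge0 ?invmax_le1.
move: lip g1; set g := invmax _ ^+ 3 => lip g1.
have : 6 * g * (e / 6) <= e.
  have -> : 6 * g * (e / 6) = g * e by field.
  by rewrite -[leRHS]mul1r ler_wpM2r // ltW.
lra.
Qed.

Lemma pert_gt0 : {ae P, forall w, forall i, 0 < r i w}.
Proof.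
have mb : measurable_fun setT (fun w => [exists i, true && (r i w <= 0)]).
  apply: measurable_exists => i.
  by apply: measurable_fun_ler => //; exact: measurable_cst.
exists [set w | [exists i, true && (r i w <= 0)]]; split.
- exact: measurable_event.
- rewrite prE //; congr EFin; apply/eqP; rewrite eq_le pr_ge0 andbT.
  apply: le_trans (pr_exists _ _ _) _ => [i|].
    by apply: measurable_fun_ler => //; exact: measurable_cst.
  by rewrite big1 // => i _; rewrite pr_pert_le tail_nonpos // subrr.
- move=> w /= /existsNP[i /negP]; rewrite -leNgt => ri.
  by apply/existsP; exists i.
Qed.

Lemma Ex_prod (s : seq 'I_d) (f : 'I_d -> R -> R) : uniq s ->
  (forall i, measurable_fun setT (f i)) -> (forall i x, 0 <= f i x) ->
  Ex P (fun w => \prod_(i <- s) f i (r i w)) = (\prod_(i <- s) Ex P (fun w => f i (r i w)))%E.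
Proof.
move=> + mf f0; elim: s => [|i s IH].
  by under eq_Ex do rewrite big_nil; rewrite big_nil Ex_cst.
move=> /= /andP[is_ us]; rewrite big_cons -IH //.
under eq_Ex do rewrite big_cons.
apply: (@Ex_coordM [set i] [set` s]).
- apply/seteqP; split => // j /= [-> js]; by rewrite js in is_.
- by apply: (measurableT_comp (mf i)); exact: measurable_coord.
- apply: measurable_prod => j js; apply: (measurableT_comp (mf j)).
  exact: measurable_coord.
- by move=> w.
- by move=> w; rewrite prodr_ge0.
Qed.

(** Above [s = max y 1] the values are cut into dyadic layers; layer [l] contributes at most
    [2 * s^-1 * 2^-1 ^+ l], for a total of [4 * s^-1]. Values below [s] count only if [y <= 1], and
    then for at most [1]. The last indicator makes the integrand nonnegative everywhere, not just
    almost surely. *)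
Lemma Ex_trunc_le i y : (Ex P (fun w => r i w * (y <= r i w)%R%:R * (0 < r i w)%R%:R)%R
  <= (5 * invmax y)%:E)%E.
Proof.
have mgt z : measurable_fun setT (fun w => z < r i w).
  by apply: measurable_fun_ltr => //; exact: measurable_cst.
have mge z : measurable_fun setT (fun w => z <= r i w).
  by apply: measurable_fun_ler => //; exact: measurable_cst.
pose s : R := Num.max y 1.
have s1 : 1 <= s by rewrite le_max lexx orbT.
pose f (l : nat) w : R := 2 ^+ l.+1 * s * (2 ^+ l * s <= r i w)%R%:R.
have mf l : measurable_fun setT (f l).
  by apply: measurable_funM; [exact: measurable_cst|exact: measurable_natb].
have f0 l w : 0 <= f l w by rewrite !mulr_ge0 //; lra.
pose X w : R := r i w * (y <= r i w)%R%:R * (0 < r i w)%R%:R.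
pose y1R : R := (y <= 1)%R%:R.
have pw w : ((X w)%:E <= y1R%:E + \sum_(0 <= l <oo) (f l w)%:E)%E.
  rewrite /X /y1R.
  have ser0 : (0 <= \sum_(0 <= l <oo) (f l w)%:E)%E.
    by apply: nneseries_ge0 => l _ _; rewrite lee_fin.
  case: (leP s (r i w)) => rs; last first.
    case: (leP y (r i w)) => ry; last first.
      by rewrite mulr0 mul0r adde_ge0 // lee_fin.
    have y1 : y <= 1.
      by rewrite leNgt; apply/negP => y1; move: rs; rewrite /s max_l ?ltNge ?ry // ltW.
    rewrite y1; apply: le_trans (leeDl _ ser0); rewrite lee_fin mulr1.
    move: rs; rewrite /s max_r // => r1; case: ltP => r0 /=; lra.
  apply: le_trans (leeDr _ _); last by rewrite lee_fin.
  have [l [l1 l2]] : exists l : nat, 2 ^+ l * s <= r i w /\ r i w <= 2 ^+ l.+1 * s.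
    have : exists l : nat, r i w < 2 ^+ l * s.
      exists (Num.bound (r i w)); apply: lt_le_trans (_ : (Num.bound (r i w))%:R <= _).
        by apply: archi_boundP; lra.
      apply: le_trans (_ : 2 ^+ Num.bound (r i w) <= _); last first.
        by rewrite -[leLHS]mulr1 ler_wpM2l // exprn_ge0.
      by rewrite -natrX ler_nat ltnW // ltn_expl.
    move=> ex; case: (ex_minnP ex) => -[|l]; first by rewrite expr0 mul1r ltNge rs.
    move=> hl hmin; exists l; split; last exact: ltW.
    by rewrite leNgt; apply/negP => /hmin; rewrite ltnn.
  apply: le_trans (_ : ((f l w)%:E <= _)%E).
    have h0 : 0 <= 2 ^+ l.+1 * s by rewrite mulr_ge0 ?exprn_ge0 //; lra.
    rewrite lee_fin /f l1 mulr1.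
    by case: (y <= _); case: (0 < _); rewrite ?mulr1 ?mulr0.
  apply: le_trans (nneseries_lim_ge l.+1 _); last by move=> k _ _; rewrite lee_fin.
  rewrite big_nat_recr //= leeDr // sume_ge0 // => k _; by rewrite lee_fin.
have mser : measurable_fun setT (fun w => (\sum_(0 <= l <oo) (f l w)%:E)%E).
  apply: (@ge0_emeasurable_sum _ _ _ setT (fun l w => (f l w)%:E) xpredT).
    by move=> l w _ _; rewrite lee_fin.
  by move=> l _; exact/measurable_EFinP.
have h1 : (Ex P X <= \int[P]_w (y1R%:E + \sum_(0 <= l <oo) (f l w)%:E))%E.
  apply: ge0_le_integral => //.
  - move=> w _; rewrite lee_fin /X; case: ltP => r0; rewrite ?mulr0 // mulr1.
    by rewrite mulr_ge0 // ltW.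
  - apply/measurable_EFinP; apply: measurable_funM; last exact: measurable_natb.
    by apply: measurable_funM => //; exact: measurable_natb.
  - by apply: emeasurable_funD => //; exact: measurable_cst.
apply: le_trans h1 _.
rewrite ge0_integralD //; last 2 first.
- by move=> w _; rewrite lee_fin.
- by move=> w _; apply: nneseries_ge0 => l _ _; rewrite lee_fin.
rewrite (@integral_nneseries _ _ _ P setT measurableT (fun l w => (f l w)%:E)); last 2 first.
- by move=> l; exact/measurable_EFinP.
- by move=> l w _; rewrite lee_fin.
have sinv : invmax y = s^-1 by [].
have s0 : 0 < s^-1 by rewrite invr_gt0; lra.
have bl l : (Ex P (f l) <= (2 * s^-1 * 2^-1 ^+ l)%:E)%E.
  rewrite /f ExZ; [|exact: measurable_natb|by []|]; last first.
    by rewrite mulr_ge0 ?exprn_ge0 //; lra.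
  rewrite Ex_natb // pr_pert_ge -EFinM lee_fin.
  have ls : 1 <= 2 ^+ l * s.
    have : (1 : R) <= 2 ^+ l by rewrite exprn_ege1 //; lra.
    nra.
  apply: le_trans (ler_wpM2l _ (tail_le D _)) _.
    by rewrite mulr_ge0 ?exprn_ge0 //; lra.
  rewrite invmaxE1 // invfM exprMn exprVn.
  have l0 : (2 : R) ^+ l != 0 by rewrite expf_neq0.
  have sn : s != 0 by rewrite gt_eqF //; lra.
  rewrite le_eqVlt; apply/orP; left; apply/eqP; rewrite exprS; field.
  by rewrite l0 sn.
apply: le_trans (_ : ((s^-1)%:E + (4 * s^-1)%:E <= _)%E); last first.
  by rewrite -EFinD lee_fin sinv; lra.
apply: leeD.
  rewrite integral_cst //= probability_setT mule1 lee_fin /y1R.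
  case: (leP y 1) => y1; last exact: ltW.
  by rewrite /s max_r // invr1.
apply: lime_le.
  by apply: is_cvg_nneseries => l _ _; exact: Ex_ge0.
near=> n.
apply: le_trans (_ : (\sum_(0 <= l < n) (2 * s^-1 * 2^-1 ^+ l)%:E <= _)%E).
  by apply: lee_sum => l _; exact: bl.
rewrite sumEFin lee_fin -mulr_sumr.
have -> : 4 * s^-1 = 2 * s^-1 * 2 by ring.
rewrite ler_wpM2l; [by []| by rewrite mulr_ge0 // ltW|].
suff -> : \sum_(0 <= l < n) (2^-1 : R) ^+ l = 2 - 2 * 2^-1 ^+ n.
  by rewrite lerBlDr lerDl mulr_ge0 // exprn_ge0 // invr_ge0.
elim: (n) => [|k IH]; first by rewrite big_nil expr0; lra.
by rewrite big_nat_recr //= IH exprS; field.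
Unshelve. all: by end_near. Qed.

End IidPerturbations.

Section MeasurableSelection.
Context {R : realType} d' (T : measurableType d') (d m : nat).
Variable x : 'I_d -> T -> R.
Implicit Types i j : 'I_d.

Lemma measurable_fun_le (f : T -> R) :
  (forall y, measurable_fun setT (fun w => f w <= y)) -> measurable_fun setT f.
Proof.
move=> mf; apply: (measurability (@RGenOInfty.G R)).
  exact: RGenOInfty.measurableE.
move=> _ [_ [y ->] <-]; rewrite setTI.
rewrite (_ : _ @^-1` _ = [set w | ~~ (f w <= y)]).
  by apply: measurable_event; exact: measurable_neg.
by apply/seteqP; split => w /=; rewrite in_itv /= andbT ltNge.
Qed.

Lemma measurable_above (S : {set 'I_d}) (y : T -> R) (Q : pred nat) :
  (forall j, j \in S -> measurable_fun setT (x j)) -> measurable_fun setT y ->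
  measurable_fun setT (fun w => Q (above S (x ^~ w) (y w))).
Proof.
move=> mx my.
pose b j w := (j \in S) && (y w < x j w).
have mb j : measurable_fun setT (b j).
  rewrite /b; case: (boolP (j \in S)) => jS /=; last exact: measurable_cst.
  by apply: measurable_fun_ltr => //; exact: mx.
have := measurable_table (fun f : {ffun 'I_d -> bool} => Q #|[set j | f j]%SET|) mb.
congr (measurable_fun _ _); apply/funext => w; congr Q.
by apply: eq_card => j; rewrite !inE ffunE.
Qed.

Lemma measurable_among_largest i : (forall j, measurable_fun setT (x j)) ->
  measurable_fun setT (fun w => among_largest m (x ^~ w) i).
Proof.
move=> mx; under eq_fun do rewrite among_largestE.
by apply: (@measurable_above _ (x i) (fun n => n < m)%N).
Qed.

Lemma measurable_threshold i : (0 < m < d)%N ->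
  (forall j, j != i -> measurable_fun setT (x j)) ->
  measurable_fun setT (fun w => threshold m (x ^~ w) i).
Proof.
move=> md mx; apply: measurable_fun_le => y.
under eq_fun do rewrite -thresholdP //.
apply: (@measurable_above _ (cst y) (fun n => n < m)%N); last exact: measurable_cst.
by move=> j; rewrite !inE; exact: mx.
Qed.

End MeasurableSelection.

Section TailMeasurable.
Context {R : realType}.

Lemma measurable_invmax : measurable_fun setT (@invmax R).
Proof. by apply: nonincreasing_measurable => // y z; exact: invmax_le. Qed.

Lemma measurable_tail D : measurable_fun setT (@tail R D).
Proof. by apply: nonincreasing_measurable => // y z; exact: tail_noninc. Qed.

Lemma prod_1sub_ge (I : Type) (s : seq I) (Q : pred I) (f : I -> R) :
  (forall i, 0 <= f i <= 1) ->
  1 - \sum_(i <- s | Q i) f i <= \prod_(i <- s | Q i) (1 - f i).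
Proof.
move=> f01.
suff /andP[_ //] : (0 <= \prod_(i <- s | Q i) (1 - f i) <= 1) &&
  (1 - \sum_(i <- s | Q i) f i <= \prod_(i <- s | Q i) (1 - f i)).
elim: s => [|i s /andP[/andP[h0 h1] IH]]; first by rewrite !big_nil subr0 ler01 lexx.
by rewrite !big_cons; case: (Q i); have := f01 i; nra.
Qed.

Lemma prod_1sub_le (I : Type) (s : seq I) (Q : pred I) (f : I -> R) :
  (forall i, 0 <= f i <= 1) ->
  \prod_(i <- s | Q i) (1 - f i) <= expR (- \sum_(i <- s | Q i) f i).
Proof.
move=> f01; rewrite -sumrN expR_sum; apply: ler_prod => i _.
by have := f01 i; have := expR_ge1Dx (- f i); lra.
Qed.

End TailMeasurable.

(** * Selection probabilities as mean tails at the level of an arm *)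

Section SelectionProbabilities.
Context {R : realType} {disp : measure_display} {Om : measurableType disp}.
Variable P : probability Om R.
Variables (d : nat) (D : perturbation) (r : 'I_d -> {RV P >-> R}).
Hypothesis ind : mutually_independent P (fun i => Defs.generated (r i)).
Hypothesis law : forall i x, cdf (r i) x = (perturbation_cdf D 2 x)%:E.
Variable m : nat.
Hypothesis md : (0 < m < d)%N.
Implicit Types (i j k : 'I_d) (A : {set 'I_d}) (x y z B : R) (lam : 'I_d -> R).

Local Notation coord A := (srcT (fun i => Defs.generated (r i)) A).

Definition sel lam i w := among_largest m (fun j => r j w - lam j) i.

Definition selp lam i : R := pr P (sel lam i).

(* [i] is selected iff [r i] is at least its level, which is independent of [r i]. *)
Definition level lam i w : R := lam i + threshold m (fun j => r j w - lam j) i.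

Lemma measurable_sel lam i : measurable_fun setT (sel lam i).
Proof.
apply: (@measurable_among_largest _ _ _ _ _ (fun j w => r j w - lam j)) => j.
by apply: measurable_funB => //; try exact: measurable_cst.
Qed.

Lemma measurable_level_coord lam i :
  measurable_fun setT (level lam i : coord [set j | j != i]%classic -> R).
Proof.
apply: (@measurable_funD _ (coord [set j | j != i]%classic) R setT (cst (lam i))).
  exact: measurable_cst.
apply: (@measurable_threshold _ _ (coord [set j | j != i]%classic) d m
  (fun j w => r j w - lam j)) => // j ji.
apply: measurable_funB; last exact: measurable_cst.
exact: measurable_coord.
Qed.

Lemma measurable_level lam i : measurable_fun setT (level lam i).
Proof. exact: measurable_of_coord (@measurable_level_coord lam i). Qed.

Lemma sel_level lam i w : sel lam i w = (level lam i w <= r i w).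
Proof. by rewrite /sel among_largest_threshold // /level lerBrDl. Qed.

Lemma Ex_fin01 (f : Om -> R) : measurable_fun setT f ->
  (forall w, 0 <= f w <= 1) -> Ex P f = (fine (Ex P f))%:E.
Proof.
move=> mf f01; rewrite fineK // ge0_fin_numE; last first.
  by apply: Ex_ge0 => w; have /andP[] := f01 w.
apply: le_lt_trans (ltry 1); rewrite -[leRHS](Ex_cst P).
by apply: Ex_le => // w; have /andP[] := f01 w.
Qed.

(** Given the other arms, [Y] is a constant and only [r i] is random. *)
Lemma pr_le_indep i (Y : Om -> R) :
  measurable_fun setT (Y : coord [set j | j != i]%classic -> R) ->
  (pr P (fun w => Y w <= r i w))%:E = Ex P (fun w => tail D (Y w)).
Proof.
move=> mY; have mY' := measurable_of_coord mY.
rewrite -Ex_natb; last by apply: measurable_fun_ler.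
pose h (z : R * R) : \bar R := ((z.1 <= z.2)%R%:R)%:E.
have mh : measurable_fun setT h.
  by apply/measurable_EFinP; apply: measurable_natb; exact: measurable_fun_ler.
have H := @integral_src _ _ _ P _ (fun i => Defs.generated (r i)) _ _ _ ind _ _ R R
  [set j | j != i]%classic [set i] Y (r i) h.
rewrite /Ex -[LHS]/((\int[P]_w h (Y w, r i w))%E) H //.
- apply: eq_integral => w _.
  rewrite -[LHS]/(Ex P (fun w' => (Y w <= r i w')%R%:R)) Ex_natb ?(pr_pert_ge law) //.
  by apply: measurable_fun_ler => //; try exact: measurable_cst.
- by move=> j; exact: generated_measurable.
- by move=> j; exact: generatedT.
- by move=> j; exact: generatedI.
- by apply/seteqP; split => // j /= [ji ij]; rewrite ij eqxx in ji.
- exact: measurable_coord.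
- by move=> z; rewrite lee_fin.
Qed.

Lemma selpE lam i : (selp lam i)%:E = Ex P (fun w => tail D (level lam i w)).
Proof.
rewrite -(@pr_le_indep i); last exact: measurable_level_coord.
by rewrite /selp; congr EFin; apply: eq_pr => w; exact: sel_level.
Qed.

Lemma threshold_ext v v' i : (forall j, j != i -> v j = v' j) ->
  threshold m v i = threshold m v' i :> R.
Proof.
move=> vv'; suff h u u' : (forall j, j != i -> u j = u' j) ->
    threshold m u i <= threshold m u' i :> R.
  by apply/eqP; rewrite eq_le !h // => j ji; rewrite vv'.
move=> uu'; rewrite -thresholdP //.
have : threshold m u' i <= threshold m u' i by [].
rewrite -thresholdP //; apply: leq_ltn_trans; apply: subset_leq_card.
by apply/fintype.subsetP => j; rewrite !inE => /andP[ji]; rewrite uu' // ji.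
Qed.

(** The threshold of [i] involves the other arms only, so moving [lam i] translates the level. *)
Lemma selp_shiftE lam lam' i x :
  lam' i = lam i + x -> (forall j, j != i -> lam' j = lam j) ->
  (selp lam' i)%:E = Ex P (fun w => tail D (level lam i w + x)).
Proof.
move=> li lj; rewrite selpE; apply: eq_Ex => w; congr tail.
rewrite /level li (@threshold_ext _ (fun j => r j w - lam j)); first by ring.
by move=> j /lj ->.
Qed.

Lemma Ex_invmax2_le lam i :
  (Ex P (fun w => invmax (level lam i w) ^+ 2)%R <= (2 * selp lam i)%:E)%E.
Proof.
rewrite EFinM selpE -ExZ //; last 2 first.
- by apply: (measurableT_comp (measurable_tail D)); exact: measurable_level.
- by move=> w; exact: tail_ge0.
apply: Ex_le.
- apply: measurable_funX; apply: (measurableT_comp measurable_invmax).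
  exact: measurable_level.
- apply: measurable_funM; first exact: measurable_cst.
  by apply: (measurableT_comp (measurable_tail D)); exact: measurable_level.
- by move=> w; rewrite exprn_ge0 // invmax_ge0.
- by move=> w; have := tail_ge D (level lam i w); lra.
Qed.

Lemma selp_diff_le lam lam' i x : 0 <= x ->
  lam' i = lam i + x -> (forall j, j != i -> lam' j = lam j) ->
  ((selp lam i)%:E <= (selp lam' i)%:E +
    (6 * x)%:E * Ex P (fun w => invmax (level lam i w) ^+ 3)%R)%E.
Proof.
move=> x0 li lj; rewrite (selp_shiftE li lj) selpE.
have ml := measurable_level lam i.
have mg : measurable_fun setT (fun w => invmax (level lam i w) ^+ 3).
  by apply: measurable_funX; exact: (measurableT_comp measurable_invmax).
have mt : measurable_fun setT (fun w => tail D (level lam i w + x)).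
  exact: (measurableT_comp (measurable_tail D) (measurable_funD _ _)).
have g0 w : 0 <= invmax (level lam i w) ^+ 3 by rewrite exprn_ge0 // invmax_ge0.
rewrite -ExZ //; last by rewrite mulr_ge0.
rewrite -ExD //; last 3 first.
- by apply: measurable_funM => //; try exact: measurable_cst.
- by move=> w; exact: tail_ge0.
- by move=> w; rewrite mulr_ge0 // mulr_ge0.
apply: Ex_le.
- exact: (measurableT_comp (measurable_tail D)).
- by apply: measurable_funD => //; apply: measurable_funM => //; try exact: measurable_cst.
- by move=> w; exact: tail_ge0.
- move=> w; have := @tail_lip _ D (level lam i w) (level lam i w + x).
  rewrite (_ : level lam i w + x - level lam i w = x); last by ring.
  by move=> /(_ _); rewrite lerDl => /(_ x0); lra.
Qed.

(** The [m] arms of [A] all score above [- B], hence so does the [m]-th largest score among the arms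
    other than [k]. *)
Lemma level_ge lam A k B w : (forall j, 0 < r j w) -> #|A| = m -> k \notin A ->
  (forall j, j \in A -> lam j <= B) -> lam k - B <= level lam k w.
Proof.
move=> r0 cA kA lB; rewrite /level lerD2l leNgt; apply/negP.
set t := threshold _ _ _ => tB.
have : t <= t by [].
rewrite -thresholdP // -cA ltnNge => /negP; apply.
apply: subset_leq_card; apply/fintype.subsetP => j jA; rewrite !inE.
rewrite (_ : j != k) /=; last by apply: contraNneq kA => <-.
by have := r0 j; have := lB j jA; move: tB; lra.
Qed.

Lemma sel_pert_ge lam A k B w : (forall j, 0 < r j w) -> #|A| = m -> k \notin A ->
  (forall j, j \in A -> lam j <= B) -> sel lam k w -> lam k - B <= r k w.
Proof.
move=> r0 cA kA lB; rewrite sel_level; apply: le_trans; exact: level_ge kA lB.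
Qed.

(** One factor [invmax] is bounded through [level_ge], the remaining square by twice the selection
    probability. *)
Lemma Ex_invmax3_out lam A k B : #|A| = m -> k \notin A ->
  (forall j, j \in A -> lam j <= B) ->
  (Ex P (fun w => invmax (level lam k w) ^+ 3)%R <=
    (2 * invmax (lam k - B) * selp lam k)%:E)%E.
Proof.
move=> cA kA lB.
have ml := measurable_level lam k.
have mg n : measurable_fun setT (fun w => invmax (level lam k w) ^+ n).
  by apply: measurable_funX; exact: (measurableT_comp measurable_invmax).
have g0 n w : 0 <= invmax (level lam k w) ^+ n by rewrite exprn_ge0 // invmax_ge0.
apply: le_trans (_ : (Ex P (fun w => (invmax (lam k - B) * invmax (level lam k w) ^+ 2)%R) <= _)%E).
  apply: Ex_ae_le => //.
  - by apply: measurable_funM => //; try exact: measurable_cst.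
  - by move=> w; rewrite mulr_ge0 ?invmax_ge0.
  - apply: filterS (pert_gt0 law) => w r0; rewrite exprS ler_wpM2r //.
    by apply: invmax_le; exact: level_ge lB.
rewrite ExZ ?invmax_ge0 //.
have -> : 2 * invmax (lam k - B) * selp lam k = invmax (lam k - B) * (2 * selp lam k).
  by ring.
by rewrite EFinM lee_wpmul2l ?lee_fin ?invmax_ge0 // Ex_invmax2_le.
Qed.

Lemma sel_in lam A i B w : (forall j, 0 < r j w) -> #|A| = m -> i \in A ->
  (forall j, j \in A -> lam j <= B) ->
  (forall k, k \notin A -> r k w <= lam k - B) -> sel lam i w.
Proof.
move=> r0 cA iA lB rk; rewrite /sel /among_largest -cA.
apply: proper_card; apply/properP; split; last by exists i; rewrite // inE ltxx.
apply/fintype.subsetP => j; rewrite inE; apply: contraTT => jA.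
by rewrite -leNgt; have := rk j jA; have := r0 i; have := lB i iA; lra.
Qed.

Lemma selp_in_ge lam A i B : #|A| = m -> i \in A ->
  (forall j, j \in A -> lam j <= B) ->
  1 - \sum_(k | k \notin A) invmax (lam k - B) ^+ 2 <= selp lam i.
Proof.
move=> cA iA lB.
have mgt k : measurable_fun setT (fun w => lam k - B < r k w).
  by apply: measurable_fun_ltr => //; try exact: measurable_cst.
have mex : measurable_fun setT (fun w => [exists k, (k \notin A) && (lam k - B < r k w)]).
  exact: measurable_exists.
apply: le_trans (_ : pr P (fun w => ~~ [exists k, (k \notin A) && (lam k - B < r k w)]) <= _).
  rewrite prN // lerB //; apply: le_trans (pr_exists _ _ _) _ => //.
  by apply: ler_sum => k _; rewrite (pr_pert_gt law) tail_le.
apply: pr_ae_le; [exact: measurable_neg|exact: measurable_sel|].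
apply: filterS (pert_gt0 law) => w r0; rewrite negb_exists => /forallP h.
apply: (sel_in r0 cA iA lB) => k kA.
by have := h k; rewrite kA /= -leNgt.
Qed.

(** The level of an arm of [A] may be nonpositive, where [invmax] does not decay; but there the tail
    is constantly [1]. The difference thus comes only from [level + x > 0], which forces an arm [k]
    outside [A] to exceed [lam k - B - x], and [invmaxD] trades this shift for [(1 + x) ^+ 2]. *)
Lemma selp_in_diff lam lam' A i B x : 0 <= x ->
  lam' i = lam i + x -> (forall j, j != i -> lam' j = lam j) ->
  #|A| = m -> i \in A -> (forall j, j \in A -> lam j <= B) ->
  selp lam i - selp lam' i <=
    6 * x * ((1 + x) ^+ 2 * \sum_(k | k \notin A) invmax (lam k - B) ^+ 2).
Proof.
move=> x0 li lj cA iA lB.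
have ml := measurable_level lam i.
pose b w := 0 < level lam i w + x.
have mb : measurable_fun setT b.
  apply: measurable_fun_ltr; first exact: measurable_cst.
  by apply: measurable_funD => //; try exact: measurable_cst.
have mt : measurable_fun setT (fun w => tail D (level lam i w + x)).
  exact: (measurableT_comp (measurable_tail D) (measurable_funD _ _)).
have step1 : selp lam i - selp lam' i <= 6 * x * pr P b.
  rewrite lerBlDr -lee_fin EFinD EFinM -(Ex_natb P mb) (selp_shiftE li lj) selpE addeC.
  rewrite -ExZ //; [|exact: measurable_natb|by rewrite mulr_ge0].
  rewrite -ExD //; last 3 first.
  - by apply: measurable_funM; [exact: measurable_cst|exact: measurable_natb].
  - by move=> w; exact: tail_ge0.
  - by move=> w; rewrite mulr_ge0 // mulr_ge0.
  apply: Ex_le.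
  - exact: (measurableT_comp (measurable_tail D)).
  - apply: measurable_funD => //; apply: measurable_funM; first exact: measurable_cst.
    exact: measurable_natb.
  - by move=> w; exact: tail_ge0.
  - move=> w; rewrite /b; set y := level lam i w.
    case: ltP => yx /=; last first.
      by rewrite mulr0 addr0 !tail_nonpos //; lra.
    have /= := @tail_lip _ D y (y + x).
    rewrite (_ : y + x - y = x); last by ring.
    rewrite lerDl => /(_ x0).
    have g1 : invmax y ^+ 3 <= 1 by rewrite exprn_ile1 ?invmax_ge0 ?invmax_le1.
    have : 6 * invmax y ^+ 3 * x <= 6 * 1 * x.
      by rewrite ler_wpM2r // ler_wpM2l.
    lra.
apply: le_trans step1 _; rewrite ler_wpM2l ?mulr_ge0 //.
have mgt k : measurable_fun setT (fun w => lam k - B - x < r k w).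
  by apply: measurable_fun_ltr => //; try exact: measurable_cst.
apply: le_trans (_ : pr P (fun w => [exists k, (k \notin A) && (lam k - B - x < r k w)]) <= _).
  apply: pr_le => //; first exact: measurable_exists.
  move=> w; rewrite /b /level => lx.
  have : ~~ (threshold m (fun j => r j w - lam j) i <= - lam i - x) by rewrite -ltNge; lra.
  rewrite -thresholdP // -leqNgt => mab; apply/existsP.
  (* At least [m] arms other than [i] score above [- lam i - x], but [A :\ i] has only [m - 1]
     elements. *)
  have : ~~ ([set j in [set~ i] | (- lam i - x < r j w - lam j)%R]%SET \subset A :\ i).
    apply/negP => /subset_leq_card; rewrite -ltnS -[X in (_ < X)%N -> _]add1n.
    rewrite (_ : 1 + #|A :\ i| = m)%N; first by rewrite ltnNge mab.
    by rewrite -cA (cardsD1 i A) iA.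
  move=> /fintype.subsetPn[k]; rewrite !inE => /andP[ki ck]; rewrite ki /= => kA.
  exists k; rewrite kA /=; have := lB i iA; lra.
apply: le_trans (pr_exists _ _ _) _ => //; rewrite mulr_sumr.
apply: ler_sum => k _; rewrite (pr_pert_gt law); apply: le_trans (tail_le _ _) _.
rewrite -exprMn lerXn2r ?nnegrE ?invmax_ge0 ?mulr_ge0 ?invmax_ge0 //; first by lra.
by have := @invmaxD _ (lam k - B - x) x x0; rewrite subrK.
Qed.

(** * Lower bounds for the arms outside a given action *)

Section LowerBounds.
Variables (lam : 'I_d -> R) (A : {set 'I_d}) (j0 : 'I_d).
Hypotheses (cA : #|A| = m) (j0A : j0 \in A).
Hypothesis lamB : forall j, j \in A -> lam j <= lam j0.

Let y k := lam k - lam j0.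
Let p k := tail D (y k + 2).

Let p01 k : 0 <= p k <= 1.
Proof. by rewrite tail_ge0 tail_le1. Qed.

Let p_ge k : invmax (y k) ^+ 2 / 18 <= p k.
Proof.
apply: le_trans (tail_ge D _).
have := @invmaxD _ (y k) 2 (ler0n _ _); have := invmax_ge0 (y k); nra.
Qed.

Let F2 : 3 / 4 <= 1 - tail D (2 : R).
Proof. by have := @tail_le R D 2; rewrite invmaxE1 ?ler1n // exprVn; lra. Qed.

Let mle z : measurable_fun setT (fun x => x <= z).
Proof. by apply: measurable_fun_ler => //; try exact: measurable_cst. Qed.

Let mlt z : measurable_fun setT (fun x => z < x).
Proof. by apply: measurable_fun_ltr => //; try exact: measurable_cst. Qed.

Let j0notin k : k \notin A -> k != j0.
Proof. by apply: contraNneq => ->. Qed.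

(** Let [r j0 <= 2], [r k > y k + 2], and let the other outside arms satisfy [r j <= y j]. Then only
    the [m - 1] arms of [A] other than [j0] can beat [k]. These independent requirements have
    probabilities at least [3 / 4], [invmax (y k) ^+ 2 / 18] (the shift by [2] costs [3 ^ 2], the
    tail a factor [2]) and [1 / 2], whence [48]. *)
Lemma selp_out_ge k : \sum_(k | k \notin A) invmax (y k) ^+ 2 <= 1 / 2 ->
  k \notin A -> invmax (y k) ^+ 2 / 48 <= selp lam k.
Proof.
move=> G kA.
pose q j := if j == j0 then (fun x => x <= 2) else
  if j == k then (fun x => y k + 2 < x) else
  if j \notin A then (fun x => x <= y j) else (fun x => true).
have mq j : measurable_fun setT (q j).
  by rewrite /q; case: ifP => _ //; case: ifP => _ //; case: ifP => _ //.
apply: le_trans (_ : pr P (fun w => [forall j, q j (r j w)]) <= _); last first.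
  apply: pr_le.
  - rewrite (_ : (fun w => _) = fun w => [forall j, true ==> q j (r j w)]) //.
    by apply: measurable_forall => j; exact: measurableT_comp.
  - exact: measurable_sel.
  move=> w /forallP qw; rewrite /sel /among_largest -cA.
  have := qw j0; rewrite /q eqxx => h0.
  have := qw k; rewrite /q (negbTE (j0notin kA)) eqxx => hk.
  apply: proper_card; apply/properP; split; last first.
    by exists j0 => //; rewrite inE -leNgt; move: h0 hk; rewrite /y; lra.
  apply/fintype.subsetP => j; rewrite inE; apply: contraTT => jA; rewrite -leNgt.
  have [->//|jk] := eqVneq j k.
  have := qw j; rewrite /q (negbTE (j0notin jA)) (negbTE jk) jA => hj.
  by move: h0 hk hj; rewrite /y; lra.
rewrite (indep_forall ind mq) (bigD1 j0) //= (bigD1 k) /=; last exact: j0notin.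
have -> : pr P (fun w => q j0 (r j0 w)) = 1 - tail D 2.
  by rewrite -(pr_pert_le law j0); apply: eq_pr => w; rewrite /q eqxx.
have -> : pr P (fun w => q k (r k w)) = p k.
  rewrite /p -(pr_pert_gt law k); apply: eq_pr => w.
  by rewrite /q (negbTE (j0notin kA)) eqxx.
set Pi := \prod_(_ | _) _.
have Pige : 1 / 2 <= Pi.
  apply: le_trans (_ : \prod_(j | (j != j0) && (j != k))
     (1 - (if j \notin A then tail D (y j) else 0)) <= _).
    apply: le_trans (prod_1sub_ge _ _ _) => [|j]; last first.
      by case: ifP; rewrite ?tail_ge0 ?tail_le1 ?lexx ?ler01.
    suff : \sum_(j | (j != j0) && (j != k)) (if j \notin A then tail D (y j) else 0) <=
        \sum_(k | k \notin A) invmax (y k) ^+ 2 by lra.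
    rewrite -big_mkcondr /=.
    apply: le_trans (_ : \sum_(j | (j != j0) && (j != k) && (j \notin A)) invmax (y j) ^+ 2 <= _).
      by apply: ler_sum => j _; exact: tail_le.
    rewrite [leRHS](bigID (fun j => (j != j0) && (j != k))) /=.
    rewrite (eq_bigl (fun j => (j \notin A) && ((j != j0) && (j != k)))); last first.
      by move=> j; rewrite andbC.
    by rewrite lerDl sumr_ge0 // => j _; rewrite exprn_ge0 // invmax_ge0.
  apply: ler_prod => j /andP[jj0 jk]; apply/andP; split.
    by case: ifP; rewrite ?subr_ge0 ?tail_le1 // subr0 ler01.
  rewrite /q (negbTE jj0) (negbTE jk); case: ifP => jA.
    by rewrite (pr_pert_le law).
  by rewrite pr_true subr0.
have := p_ge k; have := p01 k; move: F2 Pige.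
set F := tail D 2; set pk := p k; set g := invmax _ ^+ 2 => h1 h2 h3 h4.
have : 3 / 4 * (pk * (1 / 2)) <= (1 - F) * (pk * Pi).
  apply: ler_pM => //; first by rewrite mulr_ge0 //; lra.
  by rewrite ler_wpM2l //; lra.
lra.
Qed.

(** When [r j0 <= 2], either all outside arms satisfy [r k <= y k + 2], or the best outside arm
    beats [j0] and is selected. As the tails at [y k + 2] sum to at least [1 / 36], the first
    alternative keeps at most a fraction [36 / 37] of the probability, which is at least [3 / 4];
    and [3 / 4 / 37 >= 1 / 50]. *)
Lemma sum_selp_out_ge : 1 / 2 <= \sum_(k | k \notin A) invmax (y k) ^+ 2 ->
  1 / 50 <= \sum_(k | k \notin A) selp lam k.
Proof.
move=> G.
pose q j := if j == j0 then (fun x => x <= 2) else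
  if j \notin A then (fun x => x <= y j + 2) else (fun x => true).
have mq j : measurable_fun setT (q j).
  by rewrite /q; case: ifP => _ //; case: ifP => _ //.
have mall : measurable_fun setT (fun w => [forall j, q j (r j w)]).
  rewrite (_ : (fun w => _) = fun w => [forall j, true ==> q j (r j w)]) //.
  by apply: measurable_forall => j; exact: measurableT_comp.
have mex : measurable_fun setT (fun w => [exists k, (k \notin A) && sel lam k w]).
  by apply: measurable_exists => k; exact: measurable_sel.
have mr0 : measurable_fun setT (fun w => r j0 w <= 2).
  by apply: (measurableT_comp (mle 2)).
have cover : pr P (fun w => r j0 w <= 2) <=
    pr P (fun w => [forall j, q j (r j w)]) + pr P (fun w => [exists k, (k \notin A) && sel lam k w]).
  apply: le_trans _ (pr_or P mall mex); apply: pr_le => //; first exact: measurable_or.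
  move=> w r0; case: (boolP [forall j, q j (r j w)]) => //=.
  rewrite negb_forall => /existsP[k]; rewrite /q.
  case: eqVneq => [->|kj0]; first by rewrite r0.
  case: ifP => // kA; rewrite -ltNge => hk; apply/existsP.
  have := @arg_maxP _ R _ k (fun k => k \notin A) (fun k => r k w - lam k) kA.
  case=> k' k'A kmax; exists k'; rewrite k'A /= /sel /among_largest -cA.
  have hk' : r j0 w - lam j0 < r k' w - lam k'.
    by apply: lt_le_trans (kmax k kA); move: hk r0; rewrite /y; lra.
  apply: proper_card; apply/properP; split; last first.
    by exists j0 => //; rewrite inE -leNgt ltW.
  apply/fintype.subsetP => j; rewrite inE; apply: contraTT => jA; rewrite -leNgt.
  exact: kmax.
have : pr P (fun w => [forall j, q j (r j w)]) <= (1 - tail D 2) * (36 / 37).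
  rewrite (indep_forall ind mq) (bigD1 j0) //=.
  have -> : pr P (fun w => q j0 (r j0 w)) = 1 - tail D 2.
    by rewrite -(pr_pert_le law j0); apply: eq_pr => w; rewrite /q eqxx.
  rewrite ler_wpM2l //; first by move: F2; lra.
  apply: le_trans (_ : \prod_(j | j != j0) (1 - (if j \notin A then p j else 0)) <= _).
    apply: ler_prod => j jj0; rewrite pr_ge0 /= /q (negbTE jj0).
    case: ifP => jA; first by rewrite (pr_pert_le law).
    by rewrite pr_true subr0.
  apply: le_trans (prod_1sub_le _ _ _) _ => [j|].
    by case: ifP => _; rewrite ?p01 ?lexx ?ler01.
  set s := \sum_(_ | _) _.
  have hs : 1 / 36 <= s.
    rewrite /s -big_mkcondr /=.
    apply: le_trans (_ : \sum_(k | k \notin A) p k <= _).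
      apply: le_trans (_ : \sum_(k | k \notin A) (invmax (y k) ^+ 2 / 18) <= _).
        by rewrite -mulr_suml; lra.
      by apply: ler_sum => k _; exact: p_ge.
    rewrite [leRHS](eq_bigl (fun k => k \notin A)) // => k.
    by case: (boolP (k \notin A)) => kA; rewrite ?andbF ?andbT // j0notin.
  have es : expR (- s) * (1 + s) <= 1.
    rewrite -[leRHS](_ : expR (- s) * expR s = 1).
      by rewrite ler_wpM2l ?expR_ge0 // expR_ge1Dx.
    by rewrite expRN mulVf // gt_eqF // expR_gt0.
  have := expR_gt0 (- s); nra.
move: cover; rewrite (pr_pert_le law) => cover h.
have : pr P (fun w => [exists k, (k \notin A) && sel lam k w]) <= \sum_(k | k \notin A) selp lam k.
  by apply: pr_exists => k; exact: measurable_sel.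
move: F2; lra.
Qed.

End LowerBounds.

End SelectionProbabilities.

(** * Third against second moments of [invmax] at the level *)

Section ReverseHolder.
Context {R : realType} {disp : measure_display} {Om : measurableType disp}.
Variable P : probability Om R.
Variables (d : nat) (D : perturbation) (r : 'I_d -> {RV P >-> R}).
Hypothesis ind : mutually_independent P (fun i => Defs.generated (r i)).
Hypothesis law : forall i x, cdf (r i) x = (perturbation_cdf D 2 x)%:E.
Variable m : nat.
Hypothesis md : (0 < m < d)%N.
Implicit Types (i j k : 'I_d) (S A : {set 'I_d}) (x y z s : R).

Local Notation coord A := (srcT (fun i => Defs.generated (r i)) A).

(* Markov's inequality for [2 ^ (- N)], where [N] counts the exceedances. *)
Lemma pr_above_lt S s :
  pr P (fun w => (above S (fun j => r j w) s < m)%N) <=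
    2 ^+ m * (1 - tail D s / 2) ^+ #|S|.
Proof.
pose f (i : 'I_d) x : R := 2^-1 + 2^-1 * (x <= s)%R%:R.
have mf i : measurable_fun setT (f i).
  apply: measurable_funD => //; apply: measurable_funM => //.
  by apply: measurable_natb; apply: measurable_fun_ler.
have f0 i x : 0 <= f i x by rewrite addr_ge0 // mulr_ge0.
have mb : measurable_fun setT (fun w => (above S (fun j => r j w) s < m)%N).
  by apply: (@measurable_above _ _ _ _ (fun j w => r j w) S (cst s) (fun n => n < m)%N).
rewrite -lee_fin -(Ex_natb P mb).
have mp : measurable_fun setT (fun w => \prod_(j <- enum S) f j (r j w)).
  by apply: measurable_prod => j _; exact: (measurableT_comp (mf j)).
apply: le_trans (_ : (Ex P (fun w => (2 ^+ m * \prod_(j <- enum S) f j (r j w))%R) <= _)%E).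
  apply: Ex_le => //.
  - exact: measurable_natb.
  - exact: measurable_funM.
  move=> w; case: ltnP => /= ab; last by rewrite mulr_ge0 ?exprn_ge0 // prodr_ge0.
  have -> : \prod_(j <- enum S) f j (r j w) =
      2^-1 ^+ above S (fun j => r j w) s.
    rewrite big_enum /= (bigID (fun j => s < r j w)) /= [X in _ * X]big1 ?mulr1; last first.
      by move=> j /andP[_]; rewrite -leNgt /f => ->; rewrite mulr1; lra.
    rewrite -prodr_const; apply: eq_big => [j|j /andP[_ sj]]; first by rewrite inE.
    by rewrite /f leNgt sj mulr0 addr0.
  rewrite exprVn -expfB // exprn_ege1 //; lra.
rewrite ExZ ?exprn_ge0 //; last by move=> w; rewrite prodr_ge0.
rewrite (Ex_prod ind) ?enum_uniq // EFinM lee_wpmul2l ?lee_fin ?exprn_ge0 //.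
have Ef j : Ex P (fun w => f j (r j w)) = (1 - tail D s / 2)%:E.
  have ms : measurable_fun setT (fun w => r j w <= s) by apply: measurable_fun_ler.
  have mn := @measurable_natb R _ _ _ ms.
  rewrite ExD; [|by []|exact: measurable_funM|by move=> w; rewrite invr_ge0|]; last first.
    by move=> w; rewrite mulr_ge0 // invr_ge0.
  rewrite Ex_cst ExZ // Ex_natb // (pr_pert_le law) -EFinM -EFinD; congr EFin; lra.
rewrite (eq_bigr (fun=> (1 - tail D s / 2)%:E)); last by move=> j _; exact: Ef.
rewrite -(big_morph EFin EFinM (erefl 1%:E)) lee_fin big_const_seq count_predT.
by rewrite -cardE iter_mulr_1.
Qed.

(** For [u > 2 * m], half of the exponent absorbs [2 ^+ m] and the other half yields the inverse
    square. Otherwise the right-hand side is at least [1], which is enough to bound a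
    probability. *)
Lemma two_pow_expR_le (u : R) : 0 < u -> expR (- u) * 2 ^+ m <= 16 * m%:R ^+ 2 / u ^+ 2
  \/ 1 <= 16 * m%:R ^+ 2 / u ^+ 2.
Proof.
move=> u0; have u20 : 0 < u ^+ 2 by rewrite exprn_gt0.
have m0 : 0 <= (m%:R : R) by [].
case: (leP u (2 * m%:R)) => um; [right|left].
  rewrite ler_pdivlMr // mul1r; nra.
have h2 : (2 : R) ^+ m <= expR m%:R.
  rewrite -[X in expR X]mulr1 expRM_natl.
  by rewrite lerXn2r ?nnegrE ?expR_ge0 //; have := @expR_ge1Dx R 1; lra.
apply: le_trans (_ : expR (- (u / 2)) <= _).
  apply: le_trans (ler_wpM2l (expR_ge0 _) h2) _.
  by rewrite -expRD ler_expR; lra.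
have h : (1 + u / 4) ^+ 2 * expR (- (u / 2)) <= 1.
  have -> : expR (- (u / 2)) = expR (- (u / 4)) ^+ 2.
    by rewrite expr2 -expRD; congr expR; lra.
  rewrite -exprMn expr_le1 //; last by rewrite mulr_ge0 ?expR_ge0 //; lra.
  have e1 : expR (u / 4) * expR (- (u / 4)) = 1 by rewrite expRN mulfV // gt_eqF ?expR_gt0.
  by rewrite -[X in _ <= X]e1 ler_wpM2r ?expR_ge0 // expR_ge1Dx.
have m1 : 1 <= (m%:R : R) by rewrite ler1n; case/andP: md.
have := expR_gt0 (- (u / 2)); set e := expR _ in h * => e0.
rewrite ler_pdivlMr //; nra.
Qed.

(* Let [S1] be the set of the [j] with [0 <= lam i - lam j < s].  When the level is
   at most [s], fewer than [m] of the [r j], [j \in S1], exceed [s], which is very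
   unlikely if [S1] is large, and fewer than [m] of the other arms pass [s - lam i].
   The latter event, intersected with [s + s0 < r i] and [r j <= s0] on [S1],
   already forces the selection of [i]. *)
Lemma pr_level_le lam i s (n := #|[set j | (j != i) && (lam j <= lam i)%R]%SET|) :
  (2 * m <= n)%N -> 1 <= s -> s ^+ 2 <= 2 * n%:R ->
  pr P (fun w => level r m lam i w <= s) <=
    2 ^+ 15 * m%:R ^+ 2 * s ^+ 4 / n%:R * selp r m lam i.
Proof.
move=> mn s1 sn; have m0 : (0 < m)%N by case/andP: md.
have n0 : 0 < (n%:R : R) by rewrite ltr0n; lia.
have mle z j : measurable_fun setT (fun w => r j w <= z) by apply: measurable_fun_ler.
have mlt z j : measurable_fun setT (fun w => z < r j w) by apply: measurable_fun_ltr.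
pose del j := lam i - lam j.
pose S := [set j | (j != i) && (lam j <= lam i)%R]%SET.
pose S1 := [set j in S | del j < s]%SET.
pose O := [set j | (j != i) && (j \notin S1)]%SET.
pose v w j := r j w - lam j.
pose evK w := (above O (v w) (s - lam i) < m)%N.
pose evB w := (above S1 (fun j => r j w) s < m)%N.
(* Large enough for all of [S1] to stay below [s0] with probability [1 / 2], small enough for [r i]
   to exceed [s + s0 <= 2 * s0] with probability of order [1 / n]. *)
pose s0 : R := Num.sqrt (2 * n%:R).
have s02 : s0 ^+ 2 = 2 * n%:R by rewrite sqr_sqrtr // mulr_ge0.
have s0s : s <= s0 by rewrite -(ger0_norm (le_trans ler01 s1)) -sqrtr_sqr ler_wsqrtr.
pose evA w := [forall j, (j \in S1) ==> (r j w <= s0)].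
pose evI w := s + s0 < r i w.
have disjOS1 : [set` O] `&` [set` S1] = set0.
  by apply/seteqP; split => // j /= [+ jS1]; rewrite inE jS1 andbF.
have mlev : measurable_fun setT (fun w => level r m lam i w <= s).
  by apply: measurable_fun_ler => //; exact: measurable_level.
have mK : measurable_fun setT (evK : coord [set` O] -> bool).
  apply: (@measurable_above _ _ (coord [set` O]) _ (fun j w => r j w - lam j) O
    (cst (s - lam i)) (fun n => n < m)%N) => // j jO.
  by apply: measurable_funB => //; exact: measurable_coord.
have mB : measurable_fun setT (evB : coord [set` S1] -> bool).
  apply: (@measurable_above _ _ (coord [set` S1]) _ (fun j w => r j w) S1
    (cst s) (fun n => n < m)%N) => // j jO.
  exact: measurable_coord.
have mA : measurable_fun setT (evA : coord [set` S1] -> bool).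
  rewrite /evA (_ : (fun w => _) = fun w => [forall j, true ==> ((j \in S1) ==> (r j w <= s0))]) //.
  apply: measurable_forall => j; case: (boolP (j \in S1)) => //= jS1.
  by apply: measurable_fun_ler => //; exact: measurable_coord.
have mI : measurable_fun setT (evI : coord [set i] -> bool).
  by apply: measurable_fun_ltr => //; exact: measurable_coord.
have mK' := measurable_of_coord mK. have mB' := measurable_of_coord mB.
have mA' := measurable_of_coord mA. have mI' := measurable_of_coord mI.
have lev_ab w : level r m lam i w <= s -> (above [set~ i]%SET (v w) (s - lam i) < m)%N.
  by rewrite (thresholdP _ _ _ md) /level => h; rewrite lerBrDl.
(* With [m] arms ahead of [i] by at least [s], the level exceeds [s] almost surely. *)
case: (leqP m #|S :\: S1|) => cSS.
  suff : pr P (fun w => level r m lam i w <= s) <= pr P (fun=> false).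
    have -> : pr P (fun=> false) = 0.
      by rewrite /pr (_ : [set _ | false] = set0) ?measure0 //; apply/seteqP; split.
    move=> h; apply: le_trans h _; rewrite !mulr_ge0 ?invr_ge0 ?exprn_ge0 ?pr_ge0 //; lra.
  apply: pr_ae_le => //; apply: filterS (pert_gt0 law) => w r0 /lev_ab.
  rewrite ltnNge => /negP h; exfalso; apply: h; apply: leq_trans cSS _.
  apply: subset_leq_card; apply/fintype.subsetP => j; rewrite !inE => /andP[+ /andP[ji jl]].
  rewrite ji jl /= -leNgt /del /v => h; have := r0 j; lra.
(* The two events concern disjoint sets of arms. On [S1], where [lam j <= lam i], an [r j] above [s]
   implies a score above [s - lam i]. *)
have le1 : pr P (fun w => level r m lam i w <= s) <= pr P evK * pr P evB.
  rewrite -(pr_coordI ind disjOS1 mK mB).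
  apply: pr_ae_le => //; first exact: measurable_and.
  apply: filterS (pert_gt0 law) => w r0 /lev_ab h; apply/andP; split.
    apply: leq_ltn_trans h; apply: subset_leq_card; apply/fintype.subsetP => j.
    rewrite !inE. by move=> /andP[/andP[-> _] ->].
  apply: leq_ltn_trans h; apply: subset_leq_card; apply/fintype.subsetP => j.
  rewrite !inE => /andP[/andP[/andP[-> jl] _] sj] /=; rewrite /v; lra.
have cS1 : n%:R / 2 <= (#|S1|%:R : R).
  have : (#|S1| + #|S :\: S1| = n)%N.
    rewrite -[RHS](cardsID S1 S); congr (_ + _)%N; apply: eq_card => j.
    by rewrite !inE; case: (j != i); case: (lam j <= lam i); case: (del j < s).
  move=> e; rewrite ler_pdivrMr // -natrM ler_nat; lia.
have Bbound : pr P evB <= 16 * m%:R ^+ 2 / (n%:R / (8 * s ^+ 2)) ^+ 2.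
  have u0 : 0 < n%:R / (8 * s ^+ 2) by rewrite divr_gt0 // mulr_gt0 // exprn_gt0 //; lra.
  case: (two_pow_expR_le u0) => [|h]; last exact: le_trans (pr_le1 P mB') h.
  apply: le_trans; rewrite mulrC; apply: le_trans (pr_above_lt _ _) _.
  rewrite ler_wpM2l ?exprn_ge0 //.
  have t1 := tail_ge0 D s. have t2 := tail_le1 D s.
  apply: le_trans (_ : expR (- (tail D s / 2)) ^+ #|S1| <= _).
    rewrite lerXn2r ?nnegrE ?expR_ge0 //; first lra.
    by have := expR_ge1Dx (- (tail D s / 2)); lra.
  rewrite -expRM_natl ler_expR mulrN lerN2.
  have : s ^- 2 / 4 <= tail D s / 2.
    by have := tail_ge D s; rewrite invmaxE1 // exprVn; lra.
  have : 0 < s ^- 2 by rewrite invr_gt0 exprn_gt0 //; lra.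
  have -> : n%:R / (8 * s ^+ 2) = n%:R / 2 * (s ^- 2 / 4).
    by field; rewrite gt_eqF //; lra.
  move=> a1 a2; apply: ler_pM => //; lra.
have Kbound : pr P evK <= 32 * n%:R * selp r m lam i.
  have lb : pr P evK * (pr P evA * pr P evI) <= selp r m lam i.
    have dSi : [set` S1] `&` [set i] = set0.
      by apply/seteqP; split => // j /= [jS1 ji]; rewrite ji !inE eqxx in jS1.
    have dOSi : [set` O] `&` ([set` S1] `|` [set i]) = set0.
      apply/seteqP; split => // j /= [jO [jS1|ji]]; first by rewrite inE jS1 andbF in jO.
      by rewrite ji !inE eqxx in jO.
    have mAI : measurable_fun setT ((fun w => evA w && evI w) : coord ([set` S1] `|` [set i]) -> bool).
      apply: measurable_and.
        by apply: (srcTS (@subsetUl _ _ _)) mA.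
      by apply: (srcTS (@subsetUr _ _ _)) mI.
    rewrite -(pr_coordI ind dSi mA mI) -(pr_coordI ind dOSi mK mAI).
    apply: pr_le; [|exact: measurable_sel|].
      by apply: measurable_and => //; exact: measurable_and.
    move=> w /andP[kK /andP[/forallP kA kI]].
    rewrite /sel among_largestE; apply: leq_ltn_trans kK.
    apply: subset_leq_card; apply/fintype.subsetP => j.
    rewrite !inE => /andP[ji rj]; rewrite ji /=; move: kI; rewrite /evI => kI.
    case: (boolP ((lam j <= lam i) && (del j < s))) => [/andP[jl jd]|nj].
      have := kA j; rewrite !inE ji jl jd /= => rjs; move: jd; rewrite /del; lra.
    rewrite /= /v; have : 0 <= s0 by exact: sqrtr_ge0. lra.
  have lA : 1 / 2 <= pr P evA.
    rewrite (_ : evA = fun w => ~~ [exists j, (j \in S1) && (s0 < r j w)]); last first.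
      apply/funext => w; rewrite negb_exists; apply: eq_forallb => j.
      by rewrite negb_and -leNgt implybE.
    rewrite prN; last exact: measurable_exists.
    suff : pr P (fun w => [exists j, (j \in S1) && (s0 < r j w)]) <= 1 / 2 by lra.
    apply: le_trans (pr_exists _ _ _) _ => //.
    apply: le_trans (_ : \sum_(j in S1) (2 * n%:R)^-1 <= _).
      apply: ler_sum => j _; rewrite (pr_pert_gt law); apply: le_trans (tail_le _ _) _.
      by rewrite invmaxE1 ?exprVn ?s02 //; lra.
    rewrite sumr_const -[leLHS]mulr_natl ler_pdivrMr ?mulr_gt0 //.
    have : (#|S1| <= n)%N by apply: subset_leq_card; apply/fintype.subsetP => j; rewrite !inE => /andP[].
    rewrite -(ler_nat R); lra.
  have lI : 1 / (16 * n%:R) <= pr P evI.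
    rewrite (pr_pert_gt law); apply: le_trans (tail_ge _ _).
    have s00 : 0 < s0 by lra.
    rewrite invmaxE1; last lra.
    have : (s + s0) ^+ 2 <= 8 * n%:R by nra.
    have h0 : 0 < (s + s0) ^+ 2 by rewrite exprn_gt0 //; lra.
    move=> h1; rewrite exprVn -invfM mul1r lef_pV2 ?posrE ?mulr_gt0 //; lra.
  have k0 := pr_ge0 P evK.
  have : pr P evK * (1 / 2 * (1 / (16 * n%:R))) <= selp r m lam i.
    apply: le_trans lb; rewrite ler_wpM2l //; exact: ler_pM.
  have -> : 1 / 2 * (1 / (16 * n%:R)) = (32 * n%:R)^-1 :> R by field; rewrite gt_eqF.
  by rewrite ler_pdivrMr ?mulr_gt0 // mulrC.
(* [32 * n] times [16 * 64 * m ^ 2 * s ^ 4 / n ^ 2] gives the constant [2 ^ 15]. *)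
apply: le_trans le1 _; apply: le_trans (ler_pM (pr_ge0 _ _) (pr_ge0 _ _) Kbound Bbound) _.
rewrite le_eqVlt; apply/orP; left; apply/eqP; field.
by rewrite !gt_eqF //; lra.
Qed.

(** If [l] is least with [y <= 2 ^+ l] and [l <= N], the term of index [l] alone suffices; beyond
    [2 ^+ N], one factor [invmax] is at most [2^-1 ^+ N]. *)
Lemma invmax3_dyadic (N : nat) y : invmax y ^+ 3 <=
  2^-1 ^+ N * invmax y ^+ 2 + \sum_(l < N.+1) 8 * 8^-1 ^+ l * (y <= 2 ^+ l)%R%:R.
Proof.
have g0 := invmax_ge0 y. have g1 := invmax_le1 y.
have sum0 : 0 <= \sum_(l < N.+1) 8 * 8^-1 ^+ l * (y <= 2 ^+ l)%R%:R :> R.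
  by apply: sumr_ge0 => l _; rewrite mulr_ge0 // mulr_ge0 // exprn_ge0 // invr_ge0.
case: (leP y (2 ^+ N)) => yN; last first.
  have y1 : 1 <= y by apply: le_trans (ltW yN); rewrite exprn_ege1 //; lra.
  suff : invmax y ^+ 3 <= 2^-1 ^+ N * invmax y ^+ 2 by lra.
  rewrite exprS ler_wpM2r ?exprn_ge0 // invmaxE1 // exprVn lef_pV2 ?posrE ?exprn_gt0 //; lra.
have ex : exists l : nat, y <= 2 ^+ l by exists N.
case: (ex_minnP ex) => l yl lmin.
have lN : (l < N.+1)%N by rewrite ltnS; exact: lmin.
rewrite (bigD1 (Ordinal lN)) //= yl mulr1.
have rest0 : 0 <= \sum_(j < N.+1 | j != Ordinal lN) 8 * 8^-1 ^+ j * (y <= 2 ^+ j)%R%:R :> R.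
  by apply: sumr_ge0 => j _; rewrite mulr_ge0 // mulr_ge0 // exprn_ge0 // invr_ge0.
have p0 : 0 <= 2^-1 ^+ N * invmax y ^+ 2 by rewrite mulr_ge0 // exprn_ge0 // invr_ge0.
suff : invmax y ^+ 3 <= 8 * 8^-1 ^+ l by lra.
case: l yl lmin lN {rest0} => [|l] yl lmin lN.
  rewrite expr0 mulr1; have : invmax y ^+ 3 <= 1 by rewrite exprn_ile1.
  lra.
have yl' : 2 ^+ l < y by rewrite ltNge; apply/negP => /lmin; rewrite ltnn.
have l1 : 1 <= (2 : R) ^+ l by rewrite exprn_ege1 //; lra.
have -> : 8 * 8^-1 ^+ l.+1 = ((2 : R) ^+ l)^-1 ^+ 3.
  rewrite exprS mulrA mulfV ?mul1r // -exprVn exprAC; congr (_ ^+ _); lra.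
apply: lerXn2r; rewrite ?nnegrE //.
by rewrite invmaxE1 ?lef_pV2 ?posrE ?exprn_gt0 //; lra.
Qed.

(** As [n] arms are at least as good as [i], its level should be of order [sqrt (n / m)] or more;
    [pr_level_le] says that smaller levels are rare relative to [selp]. The cutoff [2 ^ N] is of
    that order, and the bounds on the dyadic terms grow geometrically up to it. If [n < 2 * m], the
    coefficient on the right is at least [2], and bounding one factor [invmax] by [1] is enough. *)
Lemma Ex_invmax3_le lam i (n := #|[set j | (j != i) && (lam j <= lam i)%R]%SET|) :
  (Ex P (fun w => invmax (level r m lam i w) ^+ 3)%R <=
    (2 ^+ 21 * (m%:R * Num.sqrt m%:R) / Num.sqrt n.+1%:R * selp r m lam i)%:E)%E.
Proof.
have ml : measurable_fun setT (level r m lam i) by exact: measurable_level.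
have mg (k : nat) : measurable_fun setT (fun w => invmax (level r m lam i w) ^+ k).
  by apply: measurable_funX; exact: (measurableT_comp measurable_invmax).
have g0 (k : nat) w : 0 <= invmax (level r m lam i w) ^+ k by rewrite exprn_ge0 // invmax_ge0.
have m1 : 1 <= (m%:R : R) by rewrite ler1n; case/andP: md.
have sm1 : 1 <= Num.sqrt (m%:R : R) by rewrite -[leLHS]sqrtr1 ler_wsqrtr.
have sm2 : Num.sqrt (m%:R : R) ^+ 2 = m%:R by rewrite sqr_sqrtr //; lra.
have sp : 0 < Num.sqrt (n.+1%:R : R) by rewrite sqrtr_gt0.
have p0 : 0 <= selp r m lam i by exact: pr_ge0.
case: (leqP (2 * m) n) => mn; last first.
  apply: le_trans (_ : (Ex P (fun w => invmax (level r m lam i w) ^+ 2)%R <= _)%E).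
    apply: (Ex_le P (mg 3%N) (mg 2%N) (g0 3%N)) => w; rewrite exprS -[leRHS]mul1r ler_wpM2r //.
    exact: invmax_le1.
  apply: le_trans (Ex_invmax2_le ind law md lam i) _.
  rewrite lee_fin ler_wpM2r // ler_pdivlMr //.
  have : Num.sqrt (n.+1%:R : R) <= 2 * Num.sqrt m%:R.
    rewrite -[leRHS]ger0_norm; last by rewrite mulr_ge0 // sqrtr_ge0.
    rewrite -sqrtr_sqr ler_wsqrtr // exprMn sm2.
    have : (n.+1 <= 2 * m)%N by [].
    rewrite -(ler_nat R) natrM; lra.
  nra.
have ex : exists l : nat, (n < 4 ^ l.+1 * m)%N.
  exists n; apply: leq_trans (_ : 4 ^ n.+1 <= _)%N; last by rewrite leq_pmulr //; case/andP: md.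
  by apply: ltn_trans (ltn_expl n.+1 _).
case: (ex_minnP ex) => N Nlt Nmin.
have Nle : (4 ^ N * m <= n)%N.
  case: N Nlt Nmin => [|N] Nlt Nmin; first by rewrite mul1n; lia.
  by rewrite leqNgt; apply/negP => /Nmin; rewrite ltnn.
pose q : R := 2 ^+ N.
have q1 : 1 <= q by rewrite exprn_ege1 //; lra.
have q4 (k : nat) : (4 : R) ^+ k = (2 ^+ k) ^+ 2.
  by rewrite -exprM mulnC exprM; congr (_ ^+ _); lra.
have nq : q ^+ 2 * m%:R <= n%:R by rewrite -q4 -natrX -natrM ler_nat.
have qn : n.+1%:R <= 4 * (q ^+ 2 * m%:R).
  have : (n.+1 <= 4 * (4 ^ N * m))%N by rewrite mulnA -expnS.
  by rewrite -(ler_nat R) !natrM natrX q4.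
have n0 : 0 < (n%:R : R) by nra.
have mind l : measurable_fun setT (fun w => (level r m lam i w <= 2 ^+ l)%R%:R : R).
  by apply: measurable_natb; apply: measurable_fun_ler.
have c0 l : 0 <= (8 : R) * 8^-1 ^+ l by rewrite mulr_ge0 // exprn_ge0 // invr_ge0.
have mt l : measurable_fun setT (fun w => 8 * 8^-1 ^+ l * (level r m lam i w <= 2 ^+ l)%R%:R : R).
  exact: measurable_funM.
have msum : measurable_fun setT (fun w => \sum_(l < N.+1) 8 * 8^-1 ^+ l * (level r m lam i w <= 2 ^+ l)%R%:R : R).
  by apply: (@measurable_bigsum R _ Om _ _ xpredT) => l.
have mfst : measurable_fun setT (fun w => 2^-1 ^+ N * invmax (level r m lam i w) ^+ 2).
  exact: measurable_funM.
have hp0 : 0 <= (2^-1 : R) ^+ N by rewrite exprn_ge0 // invr_ge0.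
apply: le_trans (_ : (Ex P (fun w => (2^-1 ^+ N * invmax (level r m lam i w) ^+ 2 +
  \sum_(l < N.+1) 8 * 8^-1 ^+ l * (level r m lam i w <= 2 ^+ l)%R%:R)%R) <= _)%E).
  apply: Ex_le => //; first exact: measurable_funD.
  by move=> w; exact: invmax3_dyadic.
rewrite ExD //; [|by move=> w; rewrite mulr_ge0|by move=> w; rewrite sumr_ge0 // => l _; rewrite mulr_ge0].
rewrite ExZ //.
rewrite (@Ex_sum R _ Om P 'I_N.+1 _ xpredT
  (fun l w => 8 * 8^-1 ^+ l * (level r m lam i w <= 2 ^+ l)%R%:R)) //.
have bl (l : 'I_N.+1) : (Ex P (fun w => (8 * 8^-1 ^+ l * (level r m lam i w <= 2 ^+ l)%R%:R)%R) <=
    (2 ^+ 18 * m%:R ^+ 2 / n%:R * selp r m lam i * 2 ^+ l)%:E)%E.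
  rewrite ExZ // Ex_natb; last by apply: measurable_fun_ler.
  rewrite -EFinM lee_fin.
  have l1 : 1 <= (2 : R) ^+ l by rewrite exprn_ege1 //; lra.
  have l2 : (2 : R) ^+ l <= q by rewrite ler_eXn2l //; [rewrite -ltnS|lra].
  have l3 : (2 ^+ l) ^+ 2 <= 2 * (n%:R : R) by nra.
  apply: le_trans (ler_wpM2l (c0 l) (pr_level_le mn l1 l3)) _.
  have -> : (8 : R)^-1 ^+ l = ((2 ^+ l) ^+ 3)^-1.
    by rewrite exprVn -exprM mulnC exprM; congr ((_ ^+ _)^-1); lra.
  rewrite le_eqVlt; apply/orP; left; apply/eqP; field.
  by rewrite !gt_eqF //; lra.
have sumq : \sum_(l < N.+1) (2 : R) ^+ l <= 2 * q.
  suff -> : \sum_(l < N.+1) (2 : R) ^+ l = 2 * q - 1 by lra.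
  rewrite /q; elim: (N) => [|k IH]; first by rewrite big_ord1 expr0; lra.
  by rewrite big_ord_recr /= IH exprS; ring.
apply: le_trans (_ : ((2^-1 ^+ N * (2 * selp r m lam i))%:E +
    \sum_(l < N.+1) (2 ^+ 18 * m%:R ^+ 2 / n%:R * selp r m lam i * 2 ^+ l)%:E <= _)%E).
  apply: leeD; first by rewrite EFinM lee_wpmul2l ?lee_fin // (Ex_invmax2_le ind law md).
  by apply: lee_sum => l _; exact: bl.
rewrite sumEFin -EFinD lee_fin -mulr_sumr.
have qV : (2^-1 : R) ^+ N = q^-1 by rewrite exprVn.
rewrite qV; set p := selp _ _ _ _ in p0 *.
have h1 : 2 ^+ 18 * m%:R ^+ 2 / n%:R * p * (\sum_(l < N.+1) 2 ^+ l) <=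
    2 ^+ 19 * m%:R / q * p.
  apply: le_trans (_ : 2 ^+ 18 * m%:R ^+ 2 / n%:R * p * (2 * q) <= _).
    rewrite ler_wpM2l // mulr_ge0 // divr_ge0 ?(ltW n0) // mulr_ge0 ?exprn_ge0 //; lra.
  have -> : 2 ^+ 18 * m%:R ^+ 2 / n%:R * p * (2 * q) =
     2 ^+ 19 * (m%:R ^+ 2 * q / n%:R) * p by field; rewrite gt_eqF.
  rewrite ler_wpM2r // -[leRHS]mulrA ler_wpM2l ?exprn_ge0 // ler_pdivrMr //.
  rewrite [leRHS]mulrAC ler_pdivlMr; last lra.
  have mR0 : 0 <= (m%:R : R) by [].
  have := ler_wpM2l mR0 nq; nra.
apply: le_trans (_ : 2 ^+ 20 * m%:R / q * p <= _).
  have : q^-1 * (2 * p) <= 2 ^+ 19 * m%:R / q * p.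
    have -> : q^-1 * (2 * p) = 2 * (q^-1 * p) by ring.
    have -> : 2 ^+ 19 * m%:R / q * p = 2 ^+ 19 * m%:R * (q^-1 * p) by ring.
    have : 0 <= q^-1 * p by rewrite mulr_ge0 // invr_ge0; lra.
    nra.
  have -> : 2 ^+ 20 * m%:R / q * p = 2 ^+ 19 * m%:R / q * p + 2 ^+ 19 * m%:R / q * p by ring.
  lra.
rewrite ler_wpM2r // ler_pdivrMr; last lra.
have sq : Num.sqrt (n.+1%:R : R) <= 2 * q * Num.sqrt m%:R.
  rewrite -[leRHS]ger0_norm; last by rewrite mulr_ge0 ?sqrtr_ge0 //; lra.
  by rewrite -sqrtr_sqr ler_wsqrtr // exprMn sm2 exprMn; lra.
rewrite [leRHS]mulrAC ler_pdivlMr //.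
have : m%:R * Num.sqrt n.+1%:R <= m%:R * (2 * q * Num.sqrt m%:R) :> R.
  by rewrite ler_wpM2l //; lra.
lra.
Qed.

End ReverseHolder.

(** * The potential *)

Section MeasurableArgmin.
Context {R : realType} d' (T : measurableType d') (d m : nat).
Variable x : 'I_d -> T -> R.
Hypothesis mx : forall j, measurable_fun setT (x j).

Lemma measurable_inner (a : {ffun 'I_d -> bool}) :
  measurable_fun setT (fun w => inner (x ^~ w) a).
Proof.
by apply: (@measurable_bigsum R _ T _ _ xpredT) => i; exact: measurable_funM.
Qed.

Lemma measurable_argmin_action i :
  measurable_fun setT (fun w => argmin_action m (x ^~ w) i).
Proof.
pose b (p : {ffun 'I_d -> bool} * {ffun 'I_d -> bool}) w :=
  inner (x ^~ w) p.1 <= inner (x ^~ w) p.2.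
have mb p : measurable_fun setT (b p).
  by apply: measurable_fun_ler; exact: measurable_inner.
have := measurable_table (fun f : {ffun {ffun 'I_d -> bool} * {ffun 'I_d -> bool} -> bool} =>
  odflt [ffun i : 'I_d => (i < m)%N]
   [pick a | is_action m a && [forall (a' | is_action m a'), f (a, a')]] i) mb.
congr (measurable_fun _ _); apply/funext => w; congr (fun_of_fin _ i).
rewrite /argmin_action /Order.arg_min /extremum; congr odflt.
apply: eq_pick => a /=; congr (_ && _); apply: eq_forallb => a'.
by rewrite ffunE.
Qed.

End MeasurableArgmin.

Section Potential.
Context {R : realType} {d m : nat}.
Variable astar : {ffun 'I_d -> bool}.
Implicit Types (u x L : 'I_d -> R).

Definition top u : {ffun 'I_d -> bool} := argmin_action m (fun i => - u i).

Definition gain u : R := inner u (top u) - inner u astar.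

Hypothesis md : (m <= d)%N.
Hypothesis astarA : is_action m astar.

Lemma innerN u a : inner (fun i => - u i) a = - inner u a.
Proof. by rewrite /inner -sumrN; apply: eq_bigr => i _; rewrite mulNr. Qed.

Lemma innerD u x a : inner (fun i => u i + x i) a = inner u a + inner x a.
Proof. by rewrite /inner -big_split /=; apply: eq_bigr => i _; rewrite mulrDl. Qed.

Lemma innerZ (c : R) u a : inner (fun i => c * u i) a = c * inner u a.
Proof. by rewrite /inner mulr_sumr; apply: eq_bigr => i _; rewrite mulrA. Qed.

Lemma eq_inner u x a : u =1 x -> inner u a = inner x a.
Proof. by move=> /funext ->. Qed.

Lemma topA u : is_action m (top u).
Proof. by have [] := argmin_actionP (fun i => - u i) md. Qed.

Lemma top_max u a : is_action m a -> inner u a <= inner u (top u).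
Proof.
move=> aA; have [_ h] := argmin_actionP (fun i => - u i) md.
by have := h a aA; rewrite !innerN lerN2.
Qed.

Lemma gain_ge u a : is_action m a -> inner u a - inner u astar <= gain u.
Proof. by move=> aA; rewrite lerB // top_max. Qed.

Lemma gain_ge0 u : 0 <= gain u.
Proof. by rewrite subr_ge0 top_max. Qed.

Lemma gain0 : gain (fun=> 0) = 0.
Proof. by rewrite /gain /inner !big1 ?subrr // => i _; rewrite mul0r. Qed.

Lemma top_among u i : injective u -> top u i = among_largest m u i.
Proof.
move=> inju; rewrite /top argmin_action_top //; last by move=> j k /oppr_inj /inju.
by congr among_largest; apply/funext => j; rewrite opprK.
Qed.

Lemma among_largest_scale (b : R) u i : 0 < b ->
  among_largest m (fun j => b * u j) i = among_largest m u i.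
Proof.
move=> b0; rewrite /among_largest; congr (_ < _)%N; apply: eq_card => j.
by rewrite !inE ltr_pM2l.
Qed.

Lemma measurable_gain d' (T : measurableType d') (x : 'I_d -> T -> R) :
  (forall j, measurable_fun setT (x j)) ->
  measurable_fun setT (fun w => gain (x ^~ w)).
Proof.
move=> mx; apply: measurable_funB; last exact: measurable_inner.
apply: (@measurable_bigsum R _ T _ _ xpredT) => i; apply: measurable_funM => //.
apply: measurable_natb.
apply: (@measurable_argmin_action _ _ T d m (fun j w => - x j w)) => j.
exact: measurableT_comp.
Qed.

End Potential.

Section PotentialBounds.
Context {R : realType} {disp : measure_display} {Om : measurableType disp}.
Variable P : probability Om R.
Variables (d : nat) (D : perturbation) (r : 'I_d -> {RV P >-> R}).
Hypothesis ind : mutually_independent P (fun i => Defs.generated (r i)).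
Hypothesis law : forall i x, cdf (r i) x = (perturbation_cdf D 2 x)%:E.
Variable m : nat.
Hypothesis md : (0 < m < d)%N.
Variable astar : {ffun 'I_d -> bool}.
Hypothesis astarA : is_action m astar.
Implicit Types (i j k : 'I_d) (y z s b : R) (lam x L : 'I_d -> R).

Local Notation coord A := (srcT (fun i => Defs.generated (r i)) A).

(** By the Lipschitz tail, the probabilities that [r i] reaches [Y] and [Y + e / 6] differ by at
    most [e], and a tie satisfies the first condition but not the second. *)
Lemma pr_pert_eq i (Y : Om -> R) :
  measurable_fun setT (Y : coord [set j | j != i]%classic -> R) ->
  pr P (fun w => Y w == r i w) = 0.
Proof.
move=> mY; have mY' := measurable_of_coord mY.
apply/eqP; rewrite eq_le pr_ge0 andbT; apply/ler_addgt0Pr => e e0; rewrite add0r.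
pose Z w := Y w + e / 6.
have mZ : measurable_fun setT (Z : coord [set j | j != i]%classic -> R).
  exact: measurable_funD.
have mZ' := measurable_of_coord mZ.
have m1 : measurable_fun setT (fun w => Z w <= r i w) by apply: measurable_fun_ler.
have m2 : measurable_fun setT (fun w => Y w <= r i w) by apply: measurable_fun_ler.
have m3 : measurable_fun setT (fun w => Y w == r i w) by apply: measurable_fun_eqr.
have mt1 : measurable_fun setT (fun w => tail D (Y w)) by exact: (measurableT_comp (measurable_tail D)).
have mt2 : measurable_fun setT (fun w => tail D (Z w)) by exact: (measurableT_comp (measurable_tail D)).
have h1 : pr P (fun w => Y w <= r i w) <= pr P (fun w => Z w <= r i w) + e.
  rewrite -lee_fin EFinD !(@pr_le_indep _ _ _ _ _ _ _ ind law i) // -(Ex_cst P e).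
  rewrite -ExD //; last 2 first.
  - by move=> w; exact: tail_ge0.
  - by move=> w; exact: ltW.
  apply: Ex_le => //.
  - exact: measurable_funD.
  - by move=> w; exact: tail_ge0.
  move=> w; have := @tail_lip _ D (Y w) (Z w).
  rewrite (_ : Z w - Y w = e / 6); last by rewrite /Z; ring.
  have : invmax (Y w) ^+ 3 <= 1 by rewrite exprn_ile1 ?invmax_ge0 ?invmax_le1.
  rewrite /Z; move=> g1 /(_ _); rewrite lerDl => /(_ _).
  have -> : 0 <= e / 6 by lra.
  move=> /(_ isT); set g := invmax _ ^+ 3 in g1 *.
  have : 6 * g * (e / 6) <= e by nra.
  lra.
have h2 : pr P (fun w => Z w <= r i w) + pr P (fun w => Y w == r i w) <= pr P (fun w => Y w <= r i w).
  rewrite -lee_fin EFinD -!Ex_natb // -ExD; [|exact: measurable_natb|exact: measurable_natb|by []|by []].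
  apply: Ex_le.
  - by apply: measurable_funD; exact: measurable_natb.
  - exact: measurable_natb.
  - by move=> w; rewrite addr_ge0.
  - move=> w; rewrite /Z; case: eqP => [->|_]; last first.
      rewrite addr0 ler_nat; case: (leP (Y w + e / 6) (r i w)) => //= h.
      by rewrite (_ : (Y w <= r i w) = true) //; lra.
    by rewrite lexx (_ : (_ <= r i w) = false) ?add0r //; apply/negbTE; rewrite -ltNge; lra.
lra.
Qed.

Lemma pert_injective lam : {ae P, forall w, injective (fun i => r i w - lam i)}.
Proof.
pose b (p : 'I_d * 'I_d) w := r p.2 w - lam p.2 + lam p.1 == r p.1 w.
have mb p : measurable_fun setT (b p).
  apply: measurable_fun_eqr => //; apply: measurable_funD => //.
  exact: measurable_funB.
have mall : measurable_fun setT (fun w => [exists p : 'I_d * 'I_d, (p.2 != p.1) && b p w]).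
  exact: (measurable_exists (fun p : 'I_d * 'I_d => p.2 != p.1)).
exists [set w | [exists p : 'I_d * 'I_d, (p.2 != p.1) && b p w]]; split.
- exact: measurable_event.
- rewrite prE //; congr EFin; apply/eqP; rewrite eq_le pr_ge0 andbT.
  apply: le_trans (pr_exists _ (fun p : 'I_d * 'I_d => p.2 != p.1) mb) _.
  rewrite big1 // => -[i j] /= ji; apply: pr_pert_eq.
  apply: measurable_funD => //; apply: measurable_funB => //; exact: measurable_coord.
- move=> w /= ninj; apply/existsP; apply: contrapT => nex; apply: ninj => i j eij.
  apply/eqP/negPn/negP => ij; apply: nex; exists (i, j); rewrite /b /= eq_sym ij /=.
  by apply/eqP; move: eij => /=; lra.
Qed.

(* [b] is the inverse of the learning rate. *)
Definition pot b L : \bar R := Ex P (fun w => gain astar (m := m) (fun i => b * r i w - L i)).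

Let md' : (m <= d)%N. Proof. by case/andP: md => _ /ltnW. Qed.

Lemma measurable_gain_pert b L :
  measurable_fun setT (fun w => gain astar (m := m) (fun i => b * r i w - L i)).
Proof.
apply: (@measurable_gain R d m astar _ Om (fun i w => b * r i w - L i)) => j.
by apply: measurable_funB => //; exact: measurable_funM.
Qed.

Lemma pot_ge0 b L : (0 <= pot b L)%E.
Proof. by apply: Ex_ge0 => w; exact: gain_ge0. Qed.

Lemma pot0 : pot 0 (fun=> 0) = 0%E.
Proof.
rewrite /pot (_ : (fun w => _) = fun=> 0) ?Ex_cst //; apply/funext => w.
rewrite -[RHS](@gain0 R d m astar); congr gain; apply/funext => i.
by rewrite mul0r subr0.
Qed.

Let A := [set i | astar i]%SET.

Let cA : #|A| = m.
Proof. by apply/eqP; rewrite -is_actionE. Qed.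

Lemma top_pert b L w i : 0 < b -> injective (fun i => r i w - L i / b) ->
  top (m := m) (fun i => b * r i w - L i) i = sel r m (fun j => L j / b) i w.
Proof.
move=> b0 inj.
have -> : (fun i => b * r i w - L i) = (fun i => b * (r i w - L i / b)).
  by apply/funext => j; field; rewrite gt_eqF.
rewrite top_among //; first by rewrite among_largest_scale.
by move=> j k /(mulfI _) h; apply: inj; apply: h; rewrite gt_eqF.
Qed.

(** The maximizer for [b'] is admissible for [b]. The difference of its two values is [b' - b] times
    the excess of its perturbation over that of [astar], which [pen] dominates. *)
Lemma pot_step b b' L (pen : Om -> R) (e : R) : 0 <= b <= b' -> 0 < b' ->
  measurable_fun setT pen -> (forall w, 0 <= pen w) -> (Ex P pen <= e%:E)%E ->
  {ae P, forall w, inner (r ^~ w) (top (m := m) (fun i => b' * r i w - L i)) -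
     inner (r ^~ w) astar <= pen w} ->
  (pot b' L <= pot b L + ((b' - b) * e)%:E)%E.
Proof.
move=> /andP[b0 bb'] b'0 mpen pen0 Ee hpen.
apply: le_trans (_ : (Ex P (fun w => (gain astar (m := m) (fun i => b * r i w - L i) +
   (b' - b) * pen w)%R) <= _)%E).
  apply: Ex_ae_le.
  - exact: measurable_gain_pert.
  - by apply: measurable_funD; [exact: measurable_gain_pert|exact: measurable_funM].
  - by move=> w; exact: gain_ge0.
  - by move=> w; rewrite addr_ge0 ?gain_ge0 // mulr_ge0 // subr_ge0.
  apply: filterS hpen => w hw; rewrite {1}/gain.
  set a := top _ in hw *.
  have h := gain_ge astar md' (fun i => b * r i w - L i) (topA md' (fun i => b' * r i w - L i)).
  have eD c : inner (fun i => b' * r i w - L i) c =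
      inner (fun i => b * r i w - L i) c + (b' - b) * inner (r ^~ w) c.
    by rewrite -innerZ -innerD; apply: eq_inner => i; ring.
  rewrite !eD; apply: le_trans (_ : (inner (fun i => b * r i w - L i) a -
    inner (fun i => b * r i w - L i) astar) + (b' - b) * (inner (r ^~ w) a - inner (r ^~ w) astar) <= _).
    by rewrite le_eqVlt; apply/orP; left; apply/eqP; ring.
  by apply: lerD => //; rewrite ler_wpM2l // subr_ge0.
rewrite ExD //; last 4 first.
- exact: measurable_gain_pert.
- exact: measurable_funM.
- by move=> w; exact: gain_ge0.
- by move=> w; rewrite mulr_ge0 // subr_ge0.
by rewrite ExZ ?subr_ge0 // leeD2l // EFinM lee_wpmul2l // lee_fin subr_ge0.
Qed.

Let trunc i y w := r i w * (y <= r i w)%R%:R * (0 < r i w)%R%:R.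

Let mtrunc i y : measurable_fun setT (trunc i y).
Proof.
apply: measurable_funM; first apply: measurable_funM => //.
  by apply: measurable_natb; exact: measurable_fun_ler.
by apply: measurable_natb; exact: measurable_fun_ltr.
Qed.

Let trunc_ge0 i y w : 0 <= trunc i y w.
Proof.
rewrite /trunc; case: ltP => r0; rewrite ?mulr0 // mulr1.
by rewrite mulr_ge0 // ltW.
Qed.

(** Arms of [astar] contribute nonpositively. Another arm enters only if its perturbation is at
    least [L k / b' - B], whence the truncated mean of [Ex_trunc_le]. *)
Lemma pot_step_gap b b' L B : 0 <= b <= b' -> 0 < b' ->
  (forall j, astar j -> L j / b' <= B) ->
  (pot b' L <= pot b L +
    ((b' - b) * \sum_(k | ~~ astar k) 5 * invmax (L k / b' - B))%:E)%E.
Proof.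
move=> bb b'0 LB.
have lB j : j \in A -> L j / b' <= B by rewrite inE; exact: LB.
apply: (@pot_step _ _ _ (fun w => \sum_(k | ~~ astar k) trunc k (L k / b' - B) w)) => //.
- by apply: (@measurable_bigsum R _ Om _ _ (fun k => ~~ astar k)) => k.
- by move=> w; apply: sumr_ge0.
- rewrite Ex_sum // -sumEFin; apply: lee_sum => k _; exact: Ex_trunc_le.
have H := pert_injective (fun i => L i / b').
apply: filterS2 (pert_gt0 law) H => w r0 inj.
rewrite /inner -sumrB [leRHS]big_mkcond /=; apply: ler_sum => i _.
have := r0 i; case: (boolP (astar i)) => /= ai ri.
  by case: (top _ _) => /=; lra.
rewrite mulr0 subr0 top_pert //; case: (boolP (sel _ _ _ _ _)) => /= si; last by rewrite mulr0.
rewrite mulr1 /trunc ri mulr1.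
have iA : i \notin A by rewrite inE.
by rewrite (sel_pert_ge md r0 cA iA lB si) mulr1.
Qed.

(** A selected perturbation is at most [s] plus its truncation at [s]; the former is summed over the
    [m] selected arms, the latter over all [d]. *)
Lemma pot_step_crude b b' L s : 0 <= b <= b' -> 0 < b' -> 1 <= s ->
  (pot b' L <= pot b L + ((b' - b) * (m%:R * s + 5 * d%:R / s))%:E)%E.
Proof.
move=> bb b'0 s1.
apply: (@pot_step _ _ _ (fun w => m%:R * s + \sum_k trunc k s w)) => //.
- apply: measurable_funD => //.
  by apply: (@measurable_bigsum R _ Om _ _ xpredT) => k.
- move=> w; rewrite addr_ge0 ?sumr_ge0 // mulr_ge0 //; lra.
- rewrite ExD //; last 3 first.
  + by apply: (@measurable_bigsum R _ Om _ _ xpredT) => k.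
  + by move=> w; rewrite mulr_ge0 //; lra.
  + by move=> w; exact: sumr_ge0.
  rewrite Ex_cst EFinD leeD2l // Ex_sum //.
  apply: le_trans (_ : (\sum_(i < d) (5 * invmax s)%:E <= _)%E).
    by apply: lee_sum => k _; exact: Ex_trunc_le.
  by rewrite sumEFin lee_fin sumr_const card_ord invmaxE1 // -[leLHS]mulr_natl; lra.
apply: filterS (pert_gt0 law) => w r0.
have ctop : \sum_i ((top (m := m) (fun i => b' * r i w - L i) i)%:R : R) = m%:R.
  have := topA md' (fun i => b' * r i w - L i); rewrite /is_action => /eqP h.
  by rewrite -[in RHS]h natr_sum.
rewrite -ctop mulr_suml -big_split /= /inner -sumrB; apply: ler_sum => i _.
have ri := r0 i; have ti := trunc_ge0 i s w.
have : 0 <= r i w * (astar i)%:R by rewrite mulr_ge0 // ltW.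
case: (top _ _) => /=; rewrite ?mulr0 ?mulr1 ?mul1r ?mul0r; last lra.
suff : r i w <= s + trunc i s w by lra.
rewrite /trunc ri mulr1; case: (leP s (r i w)) => /=; rewrite ?mulr1 ?mulr0; lra.
Qed.

(** The maximizer for [L + x] is admissible for [L]. An arm selected when only its own loss is
    increased stays selected when the other losses increase too, so the probabilities on the left
    need only shift coordinate [i]. *)
Lemma pot_loss b L x : 0 < b -> (forall i, 0 <= x i) ->
  (pot b (fun i => (L i + x i)%R) +
    (\sum_i x i * selp r m (fun j => L j / b + (if j == i then x i / b else 0)) i)%:E <=
   pot b L + (\sum_(i | astar i) x i)%:E)%E.
Proof.
move=> b0 x0.
pose lam' i j := L j / b + (if j == i then x i / b else 0).
have msel i : measurable_fun setT (sel r m (lam' i) i) by exact: measurable_sel.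
have mx i : measurable_fun setT (fun w => x i * (sel r m (lam' i) i w)%:R : R).
  by apply: measurable_funM => //; exact: measurable_natb.
have -> : (\sum_i x i * selp r m (lam' i) i)%:E =
    Ex P (fun w => \sum_i x i * (sel r m (lam' i) i w)%:R).
  rewrite Ex_sum //; last by move=> i w; rewrite mulr_ge0.
  rewrite -sumEFin; apply: eq_bigr => i _; rewrite ExZ ?Ex_natb //.
  exact: measurable_natb.
rewrite -(Ex_cst P (\sum_(i | astar i) x i)) -!ExD; last 8 first.
- exact: measurable_gain_pert.
- exact: measurable_cst.
- by move=> w; exact: gain_ge0.
- by move=> w; exact: sumr_ge0.
- exact: measurable_gain_pert.
- exact: (@measurable_bigsum R _ Om _ _ xpredT).
- by move=> w; exact: gain_ge0.
- by move=> w; apply: sumr_ge0 => i _; rewrite mulr_ge0.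
apply: Ex_ae_le.
- apply: measurable_funD; first exact: measurable_gain_pert.
  exact: (@measurable_bigsum R _ Om _ _ xpredT).
- by apply: measurable_funD; first exact: measurable_gain_pert.
- move=> w; rewrite addr_ge0 ?gain_ge0 // sumr_ge0 // => i _; by rewrite mulr_ge0.
- by move=> w; rewrite addr_ge0 ?gain_ge0 // sumr_ge0.
apply: filterS (pert_injective (fun i => (L i + x i) / b)) => w inj.
set u := fun i => b * r i w - (L i + x i).
have h := gain_ge astar md' (fun i => b * r i w - L i) (topA md' u).
have uE c : inner u c = inner (fun i => b * r i w - L i) c - inner x c.
  by rewrite -innerN -innerD; apply: eq_inner => i; rewrite /u; ring.
have -> : \sum_(i | astar i) x i = inner x astar.
  rewrite /inner big_mkcond /=; apply: eq_bigr => i _.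
  by case: (astar i); rewrite ?mulr1 ?mulr0.
rewrite {1}/gain !uE.
suff : \sum_i x i * (sel r m (lam' i) i w)%:R <= inner x (top (m := m) u) by lra.
rewrite /inner; apply: ler_sum => i _; rewrite ler_wpM2l // ler_nat.
suff : sel r m (lam' i) i w -> top (m := m) u i.
  by case: (sel _ _ _ _ _) => // ->.
rewrite (@top_pert b (fun i => L i + x i)) // /sel.
apply: among_largest_mono => j; rewrite /lam' eqxx.
have xj : 0 <= x j / b by rewrite divr_ge0 // ltW.
by case: eqP => [->|_]; rewrite !mulrDl; lra.
Qed.

End PotentialBounds.

(** * Resampling *)

Section SeriesBound.
Context {R : realType} {disp : measure_display} {Om : measurableType disp}.
Variable P : probability Om R.

Lemma Ex_le_series (f : Om -> R) (g : nat -> Om -> R) (c : R) :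
  measurable_fun setT f -> (forall n, measurable_fun setT (g n)) ->
  (forall w, 0 <= f w) -> (forall n w, 0 <= g n w) ->
  (forall w, exists N, f w <= \sum_(n < N) g n w) ->
  (forall N, (\sum_(n < N) Ex P (g n) <= c%:E)%E) ->
  (Ex P f <= c%:E)%E.
Proof.
move=> mf mg f0 g0 fg gc.
have mser : measurable_fun setT (fun w => (\sum_(0 <= l <oo) (g l w)%:E)%E).
  apply: (@ge0_emeasurable_sum _ _ _ setT (fun l w => (g l w)%:E) xpredT).
    by move=> l w _ _; rewrite lee_fin.
  by move=> l _; exact/measurable_EFinP.
apply: le_trans (_ : (\int[P]_w \sum_(0 <= l <oo) (g l w)%:E <= _)%E).
  apply: ge0_le_integral => //.
  - by move=> w _; rewrite lee_fin.
  - exact/measurable_EFinP.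
  move=> w _; have [N hN] := fg w.
  apply: le_trans (nneseries_lim_ge N _); last by move=> k _ _; rewrite lee_fin.
  by rewrite big_mkord sumEFin lee_fin.
rewrite (@integral_nneseries _ _ _ P setT measurableT (fun l w => (g l w)%:E)); last 2 first.
- by move=> l; exact/measurable_EFinP.
- by move=> l w _; rewrite lee_fin.
apply: lime_le.
  by apply: is_cvg_nneseries => l _ _; exact: Ex_ge0.
by near=> n; rewrite big_mkord; exact: gc.
Unshelve. all: by end_near. Qed.

End SeriesBound.

(** * Moments of a waiting time with geometric failure probabilities *)

Section Geometric.
Context {R : realType} {disp : measure_display} {Om : measurableType disp}.
Variable P : probability Om R.
Variables (E : nat -> Om -> bool) (p : R).
Hypothesis mE : forall s, measurable_fun setT (E s).
Hypothesis p01 : 0 < p <= 1.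

Definition fails n w := [forall s : 'I_n, ~~ E s w].

Hypothesis pr_fails : forall n, pr P (fails n) = (1 - p) ^+ n.

Definition first_trial w := first_success (fun s => E s w).

Lemma first_successP (b : pred nat) n :
  (first_success b == n.+1) = b n && [forall s : 'I_n, ~~ b s].
Proof.
rewrite /first_success; case: pselect => [h|nh]; last first.
  by apply/esym/negbTE/negP => /andP[bn _]; apply: nh; exists n.
case: ex_minnP => k bk kmin; rewrite eqSS; apply/eqP/andP.
  move=> <-; split=> //; apply/forallP => s; apply/negP => /kmin.
  by rewrite leqNgt ltn_ord.
move=> [bn /forallP hn]; apply/eqP; rewrite eqn_leq kmin //= leqNgt.
by apply/negP => kn; have := hn (Ordinal kn); rewrite bk.
Qed.

Lemma fails_first w n : (n < first_trial w)%N -> fails n w.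
Proof.
rewrite /first_trial; case e : (first_success _) => [|k] //; rewrite ltnS => nk.
move/eqP: e; rewrite first_successP => /andP[_ /forallP h].
apply/forallP => s; exact: h (Ordinal (leq_trans (ltn_ord s) nk)).
Qed.

Lemma first_fails w n : (exists s, E s w) -> fails n w -> (n < first_trial w)%N.
Proof.
rewrite /first_trial /first_success; case: pselect => // h _ /forallP hn.
case: ex_minnP => k bk _; rewrite ltnS leqNgt; apply/negP => kn.
by have := hn (Ordinal kn); rewrite bk.
Qed.

Lemma measurable_fails n : measurable_fun setT (fails n).
Proof.
rewrite (_ : fails n = fun w => [forall s : 'I_n, true ==> ~~ E s w]) //.
by apply: measurable_forall => s; exact: measurable_neg.
Qed.

Lemma geom_sum N : \sum_(n < N) (1 - p) ^+ n = (1 - (1 - p) ^+ N) / p.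
Proof.
have p0 : 0 < p by case/andP: p01.
elim: N => [|N IH]; first by rewrite big_ord0 expr0 subrr mul0r.
by rewrite big_ord_recr /= IH exprS; field; rewrite gt_eqF.
Qed.

(** Partial sums of the power series of [p ^- k.+1] in [1 - p], bounded by induction on [k]. *)
Lemma binom_geom_sum k N :
  \sum_(n < N) ('C(n + k, k))%:R * (1 - p) ^+ n <= p^-1 ^+ k.+1.
Proof.
have p0 : 0 < p by case/andP: p01. have p1 : p <= 1 by case/andP: p01.
have q0 : 0 <= 1 - p by lra.
elim: k N => [|k IH] N.
  rewrite (eq_bigr (fun n : 'I_N => (1 - p) ^+ n)) => [|n _]; last by rewrite bin0 mul1r.
  rewrite geom_sum expr1 -[leRHS]mul1r ler_wpM2r ?invr_ge0 ?(ltW p0) //.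
  by rewrite lerBlDr lerDl exprn_ge0.
rewrite exprS ler_pdivlMl //; apply: le_trans (IH N).
(* Pascal's rule in summed form: multiplication by [p] lowers [k] by one, up to a nonpositive
   boundary term, which is [0] for the empty sum. *)
suff : p * (\sum_(n < N) 'C(n + k.+1, k.+1)%:R * (1 - p) ^+ n) =
   \sum_(n < N) 'C(n + k, k)%:R * (1 - p) ^+ n - (1 - p) ^+ N * (if N is N'.+1 then 'C(N' + k.+1, k.+1) else 0%N)%:R.
  by move=> ->; rewrite lerBlDr lerDl mulr_ge0 // exprn_ge0.
elim: N => [|N IHN]; first by rewrite !big_ord0 !mulr0 subr0.
case: N IHN => [_|N IHN].
  by rewrite !big_ord1 /= !add0n !binn expr0 expr1; ring.
rewrite big_ord_recr [in RHS]big_ord_recr /= mulrDr IHN.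
rewrite (addSn N k.+1) binS natrD (addnS N k) (addSn N k) !exprS; ring.
Qed.

Lemma pow_small e : 0 < e -> exists n : nat, (1 - p) ^+ n <= e.
Proof.
have p0 : 0 < p by case/andP: p01. have p1 : p <= 1 by case/andP: p01.
move=> e0; have h n : (1 + n%:R * p) * (1 - p) ^+ n <= 1.
  elim: n => [|n IH]; first by rewrite mul0r addr0 expr0 mulr1.
  apply: le_trans IH; rewrite exprS mulrA ler_wpM2r ?exprn_ge0 //; first lra.
  have : 0 <= (n%:R : R) by []. rewrite -natr1; nra.
exists (Num.bound (e^-1 / p)).
set n := Num.bound _.
have : e^-1 / p < n%:R by apply: archi_boundP; rewrite divr_ge0 ?invr_ge0 // ltW.
rewrite ltr_pdivrMr // => hn.
have q0 : 0 <= (1 - p) ^+ n by rewrite exprn_ge0 //; lra.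
have ee : e * e^-1 = 1 by rewrite mulfV // gt_eqF.
have s1 : e^-1 * (1 - p) ^+ n <= 1.
  apply: le_trans (h n); rewrite ler_wpM2r //; lra.
by have := ler_wpM2l (ltW e0) s1; rewrite mulrA ee mul1r mulr1.
Qed.

Lemma pow_le_binom k M : (M ^ k.+1 <= k.+1`! * 'C(M + k, k.+1))%N.
Proof.
rewrite mulnC bin_ffact ffact_prod -[k.+1 in X in (X <= _)%N]card_ord -prod_nat_const.
apply: leq_prod => i _; have := ltn_ord i; lia.
Qed.

Lemma binom_sum k M : 'C(M + k, k.+1) = (\sum_(n < M) 'C(n + k, k))%N.
Proof.
elim: M => [|M IH]; first by rewrite big_ord0 add0n bin_small.
by rewrite big_ord_recr /= -IH addSn binS.
Qed.

Lemma measurable_first_trial d' (T : measurableType d') (b : nat -> T -> bool) :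
  (forall s, measurable_fun setT (b s)) ->
  measurable_fun setT (fun w => first_success (fun s => b s w)).
Proof.
move=> mb.
have mS n : measurable [set w | first_success (fun s => b s w) == n.+1].
  rewrite (_ : [set w | _] = [set w | b n w && [forall s : 'I_n, true ==> ~~ b s w]]).
    apply: measurable_event; apply: measurable_and => //.
    by apply: measurable_forall => s; exact: measurable_neg.
  by apply/seteqP; split => w /=; rewrite first_successP.
have mn n : measurable [set w | first_success (fun s => b s w) == n].
  case: n => [|n] //.
  rewrite (_ : [set w | _] = ~` \bigcup_n [set w | first_success (fun s => b s w) == n.+1]).
    by apply: measurableC; exact: bigcup_measurable.
  apply/seteqP; split => w /=.
    by move=> /eqP e [n _ /=]; rewrite e.
  case e : (first_success _) => [|k] // h; exfalso; apply: h.
  by exists k => //=; rewrite e.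
move=> _ A mA; rewrite setTI.
rewrite (_ : _ @^-1` A = \bigcup_(n in A) [set w | first_success (fun s => b s w) == n]).
  exact: bigcup_measurable.
apply/seteqP; split => w /=; last by move=> [n An /eqP ->].
by move=> Aw; exists (first_success (fun s => b s w)) => /=.
Qed.

Lemma measurable_natr d' (T : measurableType d') (f : T -> nat) :
  measurable_fun setT f -> measurable_fun setT (fun w => (f w)%:R : R).
Proof. by move=> mf; apply: (@measurableT_comp _ _ _ _ _ _ (fun n : nat => n%:R : R)). Qed.

Lemma measurable_trialX k : measurable_fun setT (fun w => (first_trial w)%:R ^+ k : R).
Proof.
apply: measurable_funX; apply: measurable_natr.
exact: (@measurable_first_trial _ Om E).
Qed.

(* [M ^ k.+1 <= k.+1`! * 'C(M + k, k.+1)], and this binomial coefficient is a sum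
   over the indices [n < M], i.e. over the events that [n] trials failed. *)
Lemma Ex_trialX k : (Ex P (fun w => ((first_trial w)%:R ^+ k.+1)%R) <=
  ((k.+1`!)%:R / p ^+ k.+1)%:E)%E.
Proof.
have p0 : 0 < p by case/andP: p01. have p1 : p <= 1 by case/andP: p01.
apply: (@Ex_le_series _ _ _ _ _
  (fun n w => (k.+1`!)%:R * ('C(n + k, k))%:R * (fails n w)%:R)).
- exact: measurable_trialX.
- move=> n; apply: measurable_funM => //; apply: measurable_natb.
  exact: measurable_fails.
- by move=> w; rewrite exprn_ge0.
- by move=> n w; rewrite !mulr_ge0.
- move=> w; exists (first_trial w).
  rewrite -natrX; apply: le_trans (_ : (k.+1`! * 'C(first_trial w + k, k.+1))%:R <= _).
    by rewrite ler_nat pow_le_binom.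
  rewrite binom_sum natrM natr_sum mulr_sumr; apply: ler_sum => n _.
  by rewrite fails_first // mulr1.
- move=> N.
  have e n : Ex P (fun w => ((k.+1`!)%:R * ('C(n + k, k))%:R * (fails n w)%:R)%R) =
      ((k.+1`!)%:R * (('C(n + k, k))%:R * (1 - p) ^+ n))%:E.
    rewrite ExZ //; last by apply: measurable_natb; exact: measurable_fails.
    by rewrite Ex_natb ?pr_fails; [rewrite -EFinM mulrA|exact: measurable_fails].
  rewrite (eq_bigr (fun n : 'I_N => ((k.+1`!)%:R * (('C(n + k, k))%:R * (1 - p) ^+ n))%:E)); last first.
    by move=> n _; exact: e.
  by rewrite sumEFin lee_fin -mulr_sumr -exprVn ler_wpM2l // binom_geom_sum.
Qed.

Lemma some_success : {ae P, forall w, exists s, E s w}.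
Proof.
have p0 : 0 < p by case/andP: p01. have p1 : p <= 1 by case/andP: p01.
have mN : measurable [set w | forall n, fails n w].
  rewrite (_ : [set w | _] = \bigcap_n [set w | fails n w]).
    by apply: bigcapT_measurable => n; apply: measurable_event; exact: measurable_fails.
  by apply/seteqP; split => w /= h n; [move=> _|]; exact: h.
exists [set w | forall n, fails n w]; split => //.
- apply/eqP; rewrite eq_le measure_ge0 andbT; apply/lee_addgt0Pr => e e0; rewrite add0e.
  have [n hn] := pow_small e0.
  apply: le_trans (_ : (P [set w | fails n w] <= _)%E).
    apply: le_measure; rewrite ?inE //; first by apply: measurable_event; exact: measurable_fails.
    by move=> w /= h.
  by rewrite prE ?lee_fin ?pr_fails //; exact: measurable_fails.
- move=> w /= h n; apply/forallP => s; apply/negP => Es; apply: h; by exists s.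
Qed.

(** The upper bound is [Ex_trialX] for [k = 0]. For the lower bound, the lengths [n] of initial runs
    of failures are counted; almost sure success excludes the default value [0] of [first_success],
    which would not bound this count. *)
Lemma Ex_trial : Ex P (fun w => (first_trial w)%:R) = (p^-1)%:E.
Proof.
have p0 : 0 < p by case/andP: p01. have p1 : p <= 1 by case/andP: p01.
have up : (Ex P (fun w => (first_trial w)%:R) <= (p^-1)%:E)%E.
  by have := Ex_trialX 0; rewrite (_ : 1`! = 1)%N // expr1 mul1r.
apply/eqP; rewrite eq_le; apply/andP; split; first exact: up.
have mM := measurable_trialX 1.
have low N : (((1 - (1 - p) ^+ N) / p)%:E <= Ex P (fun w => (first_trial w)%:R))%E.
  rewrite -geom_sum -sumEFin.
  rewrite (eq_bigr (fun n : 'I_N => Ex P (fun w => (fails n w)%:R))) => [|n _]; last first.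
    by rewrite Ex_natb ?pr_fails //; exact: measurable_fails.
  have mf (n : 'I_N) : measurable_fun setT (fun w => (fails n w)%:R : R).
    by apply: measurable_natb; exact: measurable_fails.
  rewrite -(@Ex_sum R _ Om P 'I_N _ xpredT (fun n w => (fails n w)%:R)) //.
  apply: Ex_ae_le => //.
  - exact: (@measurable_bigsum R _ Om _ _ xpredT).
  - by move=> w; exact: sumr_ge0.
  apply: filterS some_success => w ex.
  apply: le_trans (_ : (\sum_(n < N) (n < first_trial w))%:R <= _).
    rewrite natr_sum; apply: ler_sum => n _; rewrite ler_nat.
    by case: (boolP (fails n w)) => // /(first_fails ex) ->.
  rewrite ler_nat; suff -> : (\sum_(n < N) (n < first_trial w) = minn N (first_trial w))%N.
    exact: geq_minr.
  elim: N {mf} => [|N IH]; first by rewrite big_ord0 min0n.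
  by rewrite big_ord_recr /= IH; case: ltnP; lia.
apply/lee_addgt0Pr => e e0.
have [N hN] := pow_small (mulr_gt0 e0 p0).
apply: le_trans (leeD2r e%:E (low N)).
rewrite -EFinD lee_fin mulrBl mul1r -lerBlDl opprB addrA addrAC subrr add0r.
by rewrite ler_pdivrMr.
Qed.

End Geometric.

Section Reindexing.
Context {R : realType} {disp : measure_display} {Om : measurableType disp}.
Variable P : probability Om R.

Lemma mutually_independent_inj (I I' : choiceType) (F : I -> set_system Om)
    (f : I' -> I) : injective f -> mutually_independent P F ->
  mutually_independent P (fun i => F (f i)).
Proof.
move=> injf ind J A FA.
pose A' i := \bigcap_(j in [set j | j \in J /\ f j = i]) A j.
have A'f j : j \in J -> A' (f j) = A j.
  move=> jJ; apply/seteqP; split => w /=; first by apply.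
  by move=> Aw k /= [_ /injf ->].
have := ind [fset f j | j in J]%fset A'.
rewrite (_ : \bigcap_(i in _) A' i = \bigcap_(i in [set` J]) A i); last first.
  apply/seteqP; split => w /= Aw.
    move=> j jJ; have := Aw (f j); rewrite /= A'f //; apply.
    by apply/imfsetP; exists j.
  by move=> _ /imfsetP[j /= jJ ->]; rewrite A'f //; exact: Aw.
move=> ->; last first.
  by move=> _ /imfsetP[j /= jJ ->]; rewrite A'f //; exact: FA.
rewrite big_imfset /=; last by move=> j k _ _; exact: injf.
by apply: eq_big_seq => j jJ; rewrite A'f.
Qed.

End Reindexing.

Section MeasurableTrial.
Context {R : realType} d' (T : measurableType d') (d m : nat).
Variables (L x : 'I_d -> T -> R) (theta : T -> nat).
Hypotheses (mL : forall j, measurable_fun setT (L j))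
  (mx : forall j, measurable_fun setT (x j)) (mtheta : measurable_fun setT theta).

Lemma measurable_rank_le tie i j :
  measurable_fun setT (fun w => (rank tie (L ^~ w) j <= rank tie (L ^~ w) i)%N).
Proof.
under eq_fun do rewrite rank_leE.
apply: measurable_or; first exact: measurable_fun_ltr.
by apply: measurable_and; [exact: measurable_fun_eqr|exact: measurable_cst].
Qed.

Lemma measurable_rank tie i : measurable_fun setT (fun w => rank tie (L ^~ w) i).
Proof.
have := measurable_table (fun f : {ffun 'I_d -> bool} => #|[set j | f j]%SET|)
  (measurable_rank_le tie i).
congr (measurable_fun _ _); apply/funext => w.
by rewrite -[RHS]card_rank_le; apply: eq_card => j; rewrite !inE ffunE.
Qed.

Lemma measurable_kth_largest tie i i' :
  measurable_fun setT (fun w => kth_largest tie (L ^~ w) (x ^~ w) i (theta w) == i').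
Proof.
pose q k w := (rank tie (L ^~ w) k <= rank tie (L ^~ w) i)%N &&
  (#|[set j | (rank tie (L ^~ w) j <= rank tie (L ^~ w) i)%N && (x k w < x j w)%R]%SET| == theta w).
have mq k : measurable_fun setT (q k).
  apply: measurable_and; first exact: measurable_rank_le.
  apply: measurable_fun_eqn => //.
  pose b j w := (rank tie (L ^~ w) j <= rank tie (L ^~ w) i)%N && (x k w < x j w).
  have mb j : measurable_fun setT (b j).
    by apply: measurable_and; [exact: measurable_rank_le|exact: measurable_fun_ltr].
  have := measurable_table (fun f : {ffun 'I_d -> bool} => #|[set j | f j]%SET|) mb.
  congr (measurable_fun _ _); apply/funext => w.
  by apply: eq_card => j; rewrite !inE ffunE.
have := measurable_table (fun f : {ffun 'I_d -> bool} => odflt i [pick k | f k] == i') mq.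
congr (measurable_fun _ _); apply/funext => w; congr (odflt _ _ == _).
by apply: eq_pick => k; rewrite ffunE.
Qed.

Lemma measurable_trial_event sch (eta : R) i : measurable_fun setT (fun w =>
  among_largest m (fun j => resampled_vector m sch (L ^~ w) i (x ^~ w) (theta w) j - eta * L j w) i).
Proof.
have mlin (s : 'I_d -> 'I_d) : measurable_fun setT (fun w =>
    among_largest m (fun j => x (s j) w - eta * L j w) i).
  apply: (@measurable_among_largest _ _ _ _ _ (fun j w => x (s j) w - eta * L j w)) => j.
  by apply: measurable_funB => //; exact: measurable_funM.
case: sch => [|tie] /=; first exact: (mlin id).
have mr : measurable_fun setT (fun w => (rank tie (L ^~ w) i <= m)%N).
  by apply: measurable_fun_leq => //; exact: measurable_rank.
have mswap : measurable_fun setT (fun w => [exists i', true &&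
    ((kth_largest tie (L ^~ w) (x ^~ w) i (theta w) == i') &&
     among_largest m (fun j => x (tperm i i' j) w - eta * L j w) i)]).
  apply: measurable_exists => i'; apply: measurable_and.
    exact: measurable_kth_largest.
  exact: (mlin (tperm i i')).
have := measurable_fun_ifT mr (mlin id) mswap.
congr (measurable_fun _ _); apply/funext => w; case: ifP => // _.
apply/existsP/idP => [[i' /= /andP[/eqP <-]] //|h].
by exists (kth_largest tie (L ^~ w) (x ^~ w) i (theta w)); rewrite eqxx.
Qed.

End MeasurableTrial.

(** * Success probability of a resampling trial *)

Section ResamplingProbability.
Context {R : realType} {disp : measure_display} {Om : measurableType disp}.
Variable P : probability Om R.
Variables (d : nat) (D : perturbation) (r x : 'I_d -> {RV P >-> R}).
Hypothesis indr : mutually_independent P (fun i => Defs.generated (r i)).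
Hypothesis lawr : forall i y, cdf (r i) y = (perturbation_cdf D 2 y)%:E.
Hypothesis indx : mutually_independent P (fun i => Defs.generated (x i)).
Hypothesis lawx : forall i y, cdf (x i) y = (perturbation_cdf D 2 y)%:E.
Variable m : nat.
Hypothesis md : (0 < m < d)%N.
Implicit Types (i j : 'I_d) (k : nat) (lam : 'I_d -> R).

Let measurable_tuple_among lam i :
  measurable_fun setT (fun t : d.-tuple R => among_largest m (fun j => tnth t j - lam j) i).
Proof.
apply: (@measurable_among_largest R _ (d.-tuple R) d m (fun j t => tnth t j - lam j)) => j.
by apply: measurable_funB => //; exact: measurable_tnth.
Qed.

Let sel_tuple (y : 'I_d -> {RV P >-> R}) lam i w :
  sel y m lam i w = among_largest m (fun j => tnth [tuple y j w | j < d] j - lam j) i.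
Proof. by rewrite /sel; congr among_largest; apply/funext => j; rewrite tnth_mktuple. Qed.

Lemma selp_law lam i : selp x m lam i = selp r m lam i.
Proof.
rewrite /selp !(eq_pr P (sel_tuple _ lam i)).
apply: (eq_joint_law indx indr _ (measurable_tuple_among lam i)).
by move=> j y; rewrite lawx lawr.
Qed.

(** If [r i] exceeds [2] plus all differences of [lam] while the other perturbations stay below [2],
    then [i] comes first. Positivity gives meaning to the inverse weights. *)
Lemma selp_gt0 lam i : 0 < selp r m lam i.
Proof.
pose c : R := 2 + \sum_j `|lam i - lam j|.
pose q j := if j == i then (fun y => c < y) else (fun y : R => y <= 2).
have mq j : measurable_fun setT (q j).
  rewrite /q; case: ifP => _; first exact: measurable_fun_ltr.
  exact: measurable_fun_ler.
apply: lt_le_trans (_ : pr P (fun w => [forall j, q j (r j w)]) <= _); last first.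
  apply: pr_le.
  - rewrite (_ : (fun w => _) = fun w => [forall j, true ==> q j (r j w)]) //.
    by apply: measurable_forall => j; exact: measurableT_comp.
  - exact: measurable_sel.
  move=> w /forallP qw; rewrite /sel /among_largest.
  have qi := qw i; rewrite /q eqxx in qi.
  rewrite (_ : [set _ | _]%SET = finset.set0) ?cards0; first by case/andP: md.
  apply/finset.setP => j; rewrite !inE; apply/negbTE; rewrite -leNgt.
  have [->//|ji] := eqVneq j i.
  have := qw j; rewrite /q (negbTE ji) => qj.
  have : lam i - lam j <= \sum_j `|lam i - lam j|.
    apply: le_trans (ler_norm _) _; rewrite (bigD1 j) //= lerDl; exact: sumr_ge0.
  by move: qi; rewrite /c; lra.
rewrite (indep_forall indr mq); apply: prodr_gt0 => j _.
have F2 : 3 / 4 <= 1 - tail D (2 : R).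
  by have := @tail_le R D 2; rewrite invmaxE1 ?ler1n // exprVn; lra.
rewrite /q; case: ifP => _; last by rewrite (pr_pert_le lawr); lra.
rewrite (pr_pert_gt lawr); apply: lt_le_trans (tail_ge _ _).
by rewrite divr_gt0 // exprn_gt0 // invmax_gt0.
Qed.

Variables (tie : {perm 'I_d}) (L : 'I_d -> R) (eta : R) (i : 'I_d).
Hypothesis eta0 : 0 <= eta.

Let lam j := eta * L j.
Let S := [set j | (rank tie L j <= rank tie L i)%N]%SET.

Let mx j : measurable_fun setT (x j). Proof. by []. Qed.

Let iS : i \in S. Proof. by rewrite inE. Qed.

(** Splits the selection of [i] according to its position [k] among the arms of rank at most its
    own. *)
Let hit (y : 'I_d -> {RV P >-> R}) k w :=
  (above S (fun j => y j w) (y i w) == k) && sel y m lam i w.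

Let mhit y k : measurable_fun setT (hit y k).
Proof.
apply: measurable_and; last exact: measurable_sel.
exact: (@measurable_above _ _ _ _ (fun j w => y j w) S (y i) (fun n => n == k)).
Qed.

(** Transposing [i] and [i'], both in [S], preserves [S] and the joint law. *)
Let pr_hit_swap k i' : i' \in S ->
  pr P (fun w => (above S (fun j => x j w) (x i' w) == k) &&
    among_largest m (fun j => x (tperm i i' j) w - lam j) i) = pr P (hit x k).
Proof.
move=> i'S; pose y j := x (tperm i i' j).
have indy : mutually_independent P (fun j => Defs.generated (y j)).
  exact: (mutually_independent_inj (@perm_inj _ (tperm i i')) indx).
pose b (t : d.-tuple R) := (above S (fun j => tnth t j) (tnth t i) == k) &&
  among_largest m (fun j => tnth t j - lam j) i.
have mb : measurable_fun setT b.
  apply: measurable_and; last exact: measurable_tuple_among.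
  by apply: (@measurable_above _ _ _ _ (fun j (t : d.-tuple R) => tnth t j) S
    (fun t => tnth t i) (fun n => n == k)) => [j _|]; exact: measurable_tnth.
have hb (z : 'I_d -> {RV P >-> R}) w : hit z k w = b [tuple z j w | j < d].
  rewrite /hit /b sel_tuple tnth_mktuple; congr (_ && _); congr (_ == _).
  by apply: eq_card => j; rewrite !inE tnth_mktuple.
transitivity (pr P (hit y k)).
  apply: eq_pr => w; rewrite /hit; congr (_ && _); congr (_ == _).
  rewrite /y tpermL /above -(card_imset _ (@perm_inj _ (tperm i i'))).
  have tS l : l \in S -> tperm i i' l \in S by case: tpermP => // _.
  apply: eq_card => j; apply/imsetP/idP.
    by move=> [l]; rewrite inE => /andP[lS lt] ->; rewrite inE tpermK lt tS.
  by rewrite inE => /andP[jS lt]; exists (tperm i i' j); rewrite ?tpermK // inE lt tS.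
rewrite (eq_pr P (hb y)) (eq_pr P (hb x)).
apply: (eq_joint_law indy indx _ mb).
by move=> j z; rewrite !lawx.
Qed.

Let swapped k w := among_largest m
  (fun j => x (tperm i (kth_largest tie L (x ^~ w) i k) j) w - lam j) i.

Let mswap i' : measurable_fun setT (fun w => among_largest m (fun j => x (tperm i i' j) w - lam j) i).
Proof.
apply: (@measurable_among_largest _ _ _ _ _ (fun j w => x (tperm i i' j) w - lam j)) => j.
exact: measurable_funB.
Qed.

Let mswapped k : measurable_fun setT (swapped k).
Proof.
rewrite (_ : swapped k = fun w => [exists i', true &&
    ((kth_largest tie L (x ^~ w) i k == i') &&
     among_largest m (fun j => x (tperm i i' j) w - lam j) i)]).
  apply: measurable_exists => i'; apply: measurable_and => //.
  exact: (@measurable_kth_largest _ _ _ d (fun j => cst (L j)) (fun j w => x j w) (cst k)).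
apply/funext => w; apply/idP/existsP => [h|[i' /= /andP[/eqP <-]] //].
by exists (kth_largest tie L (x ^~ w) i k); rewrite eqxx.
Qed.

(* If [i'] is the [k]-th largest, swapping it with [i] gives, by exchangeability,
   an ordinary trial in which [i] is the [k]-th largest; there are [rank tie L i]
   candidates for [i']. *)
Lemma pr_swapped k : (k < rank tie L i)%N ->
  pr P (swapped k) = (rank tie L i)%:R * pr P (hit x k).
Proof.
move=> kr; have cS : #|S| = rank tie L i by exact: card_rank_le.
pose f i' w := (above S (fun j => x j w) (x i' w) == k) &&
    among_largest m (fun j => x (tperm i i' j) w - lam j) i.
have mf i' : measurable_fun setT (f i').
  apply: measurable_and => //.
  exact: (@measurable_above _ _ _ _ (fun j w => x j w) S (x i') (fun n => n == k)).
have mfn i' : measurable_fun setT (fun w => (f i' w)%:R : R) by exact: measurable_natb.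
suff : Ex P (fun w => (swapped k w)%:R) = Ex P (fun w => \sum_(i' in S) (f i' w)%:R).
  rewrite Ex_natb // Ex_sum // => h; apply: EFin_inj; rewrite {}h.
  rewrite (eq_bigr (fun=> (pr P (hit x k))%:E)) => [|i' i'S]; last first.
    by rewrite Ex_natb // -(pr_hit_swap k i'S).
  by rewrite sumEFin sumr_const cS mulr_natl.
have hae : {ae P, forall w, \sum_(i' in S) (f i' w)%:R = (swapped k w)%:R :> R}.
  apply: filterS (pert_injective indx lawx (fun=> 0)) => w inj.
  have injx : {in S &, injective (fun j => x j w)}.
    by move=> j j' _ _ e; apply: inj; rewrite /= !subr0.
  have kS : (k < #|S|)%N by rewrite cS.
  have [i0 i0S i0k] := above_ex injx kS.
  have aboveE j : #|[set l | (rank tie L l <= rank tie L i)%N && (x j w < x l w)%R]%SET| =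
      above S (fun l => x l w) (x j w).
    by apply: eq_card => l; rewrite !inE.
  have kE : kth_largest tie L (x ^~ w) i k = i0.
    rewrite /kth_largest; case: pickP => [j /andP[jr /eqP jk]|/(_ i0)] /=.
      by apply: (above_inj injx) => //; [rewrite inE|rewrite i0k -jk aboveE].
    by move: (i0S); rewrite inE aboveE i0k eqxx => ->.
  rewrite (bigD1 i0) //= big1 => [|j /andP[jS ji0]].
    by rewrite addr0 /f /swapped kE i0k eqxx.
  rewrite /f; case: eqP => //= jk; exfalso; move/eqP: ji0; apply.
  by apply: (above_inj injx) => //=; rewrite jk i0k.
apply/eqP; rewrite eq_le; apply/andP; split; apply: Ex_ae_le => //.
- exact: measurable_natb.
- exact: (@measurable_bigsum R _ Om _ _ (mem S)).
- by move=> w; exact: sumr_ge0.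
- by apply: filterS hae => w ->.
- exact: (@measurable_bigsum R _ Om _ _ (mem S)).
- exact: measurable_natb.
- by move=> w; exact: sumr_ge0.
- by apply: filterS hae => w ->.
Qed.

(** Arms of [S] satisfy [L j <= L i], so those with a larger perturbation than [i] also have a
    larger score. If [i] is selected, there are fewer than [m] of them: this is why CGR draws the
    position among [m] values only. *)
Lemma sum_pr_hit : \sum_(k < m) pr P (hit x k) = selp r m lam i.
Proof.
rewrite -selp_law; apply: EFin_inj; rewrite -sumEFin /selp -Ex_natb; last exact: measurable_sel.
rewrite (eq_bigr (fun k : 'I_m => Ex P (fun w => (hit x k w)%:R))) => [|k _]; last by rewrite Ex_natb.
rewrite -(@Ex_sum R _ Om P 'I_m _ xpredT (fun (k : 'I_m) w => (hit x k w)%:R)) //; last first.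
  by move=> k; exact: measurable_natb.
apply: eq_Ex => w; rewrite /hit; case: (boolP (sel x m lam i w)) => si /=; last first.
  by rewrite big1 // => k _; rewrite andbF.
have am : (above S (fun j => x j w) (x i w) < m)%N.
  apply: leq_ltn_trans si; apply: subset_leq_card; apply/fintype.subsetP => j.
  rewrite !inE => /andP[/rank_leW jL xj]; rewrite /lam.
  by have := ler_wpM2l eta0 jL; lra.
rewrite (bigD1 (Ordinal am)) //= eqxx big1 ?addr0 // => k kne.
by rewrite andbT; case: eqP => // e; exfalso; move/eqP: kne; apply; apply: val_inj.
Qed.

Lemma pr_swapped_mean : (m < rank tie L i)%N ->
  \sum_(k < m) m%:R^-1 * pr P (swapped k) = (rank tie L i)%:R / m%:R * selp r m lam i.
Proof.
move=> mr; rewrite -sum_pr_hit -mulr_sumr.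
rewrite (eq_bigr (fun k : 'I_m => (rank tie L i)%:R * pr P (hit x k))) => [|k _].
  by rewrite -mulr_sumr; ring.
by rewrite pr_swapped // (ltn_trans (ltn_ord k)).
Qed.

End ResamplingProbability.

(** * Numerical estimates *)

Section Sums.
Context {R : realType}.

Lemma sqrt_step (n : nat) :
  (Num.sqrt n.+1%:R)^-1 <= 2 * (Num.sqrt n.+1%:R - Num.sqrt n%:R) :> R.
Proof.
have s1 : 0 < Num.sqrt (n.+1%:R : R) by rewrite sqrtr_gt0.
have s0 := sqrtr_ge0 (n%:R : R).
have e1 : Num.sqrt (n.+1%:R : R) ^+ 2 = n%:R + 1 by rewrite sqr_sqrtr // natr1.
have e0 : Num.sqrt (n%:R : R) ^+ 2 = n%:R by rewrite sqr_sqrtr.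
have le : Num.sqrt (n%:R : R) <= Num.sqrt n.+1%:R by rewrite ler_wsqrtr // ler_nat.
rewrite -div1r ler_pdivrMr //; nra.
Qed.

Lemma sqrt_diff_le (n : nat) :
  Num.sqrt n.+1%:R - Num.sqrt n%:R <= (Num.sqrt n.+1%:R)^-1 :> R.
Proof.
have s1 : 0 < Num.sqrt (n.+1%:R : R) by rewrite sqrtr_gt0.
have s0 := sqrtr_ge0 (n%:R : R).
have e1 : Num.sqrt (n.+1%:R : R) ^+ 2 = n%:R + 1 by rewrite sqr_sqrtr // natr1.
have e0 : Num.sqrt (n%:R : R) ^+ 2 = n%:R by rewrite sqr_sqrtr.
have le : Num.sqrt (n%:R : R) <= Num.sqrt n.+1%:R by rewrite ler_wsqrtr // ler_nat.
rewrite -[leRHS]div1r ler_pdivlMr //; nra.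
Qed.

(** Induction by removing a maximal element of [S]: all the others count for it, so its term is the
    inverse root of [#|S|], and the remaining terms can only grow as their counts drop. *)
Lemma sum_inv_sqrt_card (d : nat) (lam : 'I_d -> R) (S : {set 'I_d}) :
  \sum_(i in S) (Num.sqrt #|[set j in S | (j != i) && (lam j <= lam i)%R]%SET|.+1%:R)^-1
    <= 2 * Num.sqrt #|S|%:R :> R.
Proof.
elim/(@ltn_ind) : {S}#|S| {-2}S (erefl #|S|) => n IH S cS.
have [S0|[i iS]] := finset.set_0Vmem S.
  by rewrite S0 big_set0 mulr_ge0 // sqrtr_ge0.
case: (@arg_maxP _ R _ i (fun j => j \in S) lam iS) => i0 i0S imax.
rewrite (bigD1 i0) //=.
have c0 : #|[set j in S | (j != i0) && (lam j <= lam i0)%R]%SET|.+1 = #|S|.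
  rewrite (cardsD1 i0 S) i0S add1n; congr (_.+1); apply: eq_card => j; rewrite !inE.
  case: (boolP (j \in S)) => jS; rewrite ?andbF //= ?andbT.
  by have := imax j jS; rewrite /= => ->; rewrite andbT.
rewrite c0.
have c1 : #|S| = (#|S :\ i0|).+1 by rewrite (cardsD1 i0 S) i0S.
have IH1 := IH #|S :\ i0| _ _ (erefl _).
have h : \sum_(j in S | j != i0) (Num.sqrt #|[set k in S | (k != j) && (lam k <= lam j)%R]%SET|.+1%:R)^-1
    <= 2 * Num.sqrt #|S :\ i0|%:R :> R.
  apply: le_trans (IH1 _ ); last by rewrite -cS c1.
  rewrite (eq_bigl (mem (S :\ i0))) => [|j]; last by rewrite !inE andbC.
  apply: ler_sum => j _; rewrite lef_pV2 ?posrE ?sqrtr_gt0 //.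
  rewrite ler_wsqrtr // ler_nat ltnS; apply: subset_leq_card.
  by apply/fintype.subsetP => k; rewrite !inE => /andP[/andP[_ ->] ->].
have := sqrt_step #|S :\ i0|; rewrite -c1; lra.
Qed.

Lemma sum_inv_sqrt_rank (d : nat) (lam : 'I_d -> R) :
  \sum_i (Num.sqrt #|[set j | (j != i) && (lam j <= lam i)%R]%SET|.+1%:R)^-1
    <= 2 * Num.sqrt d%:R :> R.
Proof.
have := sum_inv_sqrt_card lam finset.setT; rewrite cardsT card_ord.
congr (_ <= _); apply: eq_big => [i|i _]; first by rewrite inE.
by congr ((Num.sqrt _.+1%:R)^-1); apply: eq_card => j; rewrite !inE.
Qed.

(** The minimum on the right carries the induction past the index at which the condition starts to
    fail. *)
Lemma sum_inv_sqrt_below (V : R) (T : nat) : 0 <= V ->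
  \sum_(t < T) (if Num.sqrt t.+1%:R < V then (Num.sqrt t.+1%:R)^-1 else 0) <=
    2 * Num.min (Num.sqrt T%:R) V.
Proof.
move=> V0; elim: T => [|T IH]; first by rewrite big_ord0 mulr_ge0 // le_min sqrtr_ge0.
rewrite big_ord_recr /=.
have le : Num.sqrt (T%:R : R) <= Num.sqrt T.+1%:R by rewrite ler_wsqrtr // ler_nat.
case: ifP => sV.
  rewrite [X in _ <= 2 * X]min_l; last exact: ltW.
  rewrite min_l in IH; last by apply: le_trans le _; exact: ltW.
  have := sqrt_step T; lra.
rewrite addr0; apply: le_trans IH _; rewrite ler_wpM2l // le_min !ge_min le /=.
by rewrite lexx orbT.
Qed.

(* The term [t = 0] is dropped in order to get [ln T] instead of [1 + ln T]. *)
Lemma sum_inv_ln (T : nat) : (0 < T)%N ->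
  \sum_(t < T) (if (0 < t)%N then t.+1%:R^-1 else 0) <= ln (T%:R : R).
Proof.
case: T => // T _; elim: T => [|T IH].
  by rewrite big_ord_recr big_ord0 /= addr0 ln1.
rewrite big_ord_recr /=; apply: le_trans (lerD IH (lexx _)) _.
rewrite -lerBrDl -ln_div ?posrE ?ltr0n //.
have : T.+2%:R^-1 <= ln (T.+2%:R / T.+1%:R : R).
  have h : ln (T.+1%:R / T.+2%:R : R) <= T.+1%:R / T.+2%:R - 1.
    have a0 : 0 < T.+1%:R / T.+2%:R :> R by rewrite divr_gt0 ?ltr0n.
    move: a0; set a := _ / _ => a0; have := @le_ln1Dx R (a - 1).
    by rewrite (_ : 1 + (a - 1) = a); [apply; lra|ring].
  have -> : ln (T.+2%:R / T.+1%:R : R) = - ln (T.+1%:R / T.+2%:R).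
    by rewrite -lnV ?posrE ?divr_gt0 ?ltr0n // invf_div.
  have e : T.+1%:R / T.+2%:R - 1 = - T.+2%:R^-1 :> R.
    have -> : T.+1%:R = T.+2%:R - 1 :> R by rewrite -[T.+2%:R]natr1 addrK.
    have b0 : T.+2%:R != 0 :> R by rewrite pnatr_eq0.
    by move: b0; set b := _%:R => b0; field.
  by move: h; rewrite e lerNr.
by [].
Qed.

End Sums.

(** * Constants, and the trade-off between stability and regret *)

Section GapAlgebra.
Context {R : realType} {d : nat}.
Variables (c : R) (m : nat) (astar : {ffun 'I_d -> bool}) (Delta : 'I_d -> R) (Dmin : R).
Hypothesis c0 : 0 < c.
Hypothesis Dmin0 : 0 < Dmin.
Hypothesis DeltaD : forall k, ~~ astar k -> Dmin <= Delta k.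
Implicit Types (g p : 'I_d -> R) (eta : R).

(** Stability gives [24 * 2 ^+ 21], the penalty [6 / c ^+ 2]; the factor [2] accounts for the two
    uses of the round inequality. *)
Definition crude_cst : R := 2 * (24 * 2 ^+ 21 + 6 / c ^+ 2).
(** [48 + 10 / c ^+ 2] is twice the total coefficient [24 + 5 / c ^+ 2] of [eta * g k]; AM-GM
    against the weight [1 / 96] squares it and produces the [24]. *)
Definition gap_cst : R := 24 * (48 + 10 / c ^+ 2) ^+ 2.
(** The crude cost of a round is of order [eta] times this quantity, whose square is [m ^ 3 * d]. *)
Definition size_cst : R := m%:R * Num.sqrt m%:R * Num.sqrt d%:R.
(* Once [switch_cst * size_cst / Dmin <= sqrt t], the quadratic part of the
   stability is at most half of the regret, and the crude bound is at most the
   regret if the squares of the [g k] sum up to more than [1 / 2]. *)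
Definition switch_cst : R := c * (50 * crude_cst + 1152 * (8 + 384 * c ^+ 2)) + 2.

Lemma crude_cst_ge0 : 0 <= crude_cst.
Proof. by rewrite mulr_ge0 // addr_ge0 // divr_ge0 // exprn_ge0 // ltW. Qed.

(** With [size_cst >= 1] and [Dmin <= 1], this puts [t = 0] among the early rounds, which yields
    [ln T] instead of [1 + ln T]. *)
Lemma switch_cst_ge2 : 2 <= switch_cst.
Proof.
have h := crude_cst_ge0; have cc : 0 <= c ^+ 2 by rewrite exprn_ge0 // ltW.
rewrite /switch_cst; move: h cc; set x := crude_cst; set y := c ^+ 2 => h cc.
rewrite -[leLHS]add0r lerD2r; apply: mulr_ge0; [exact: ltW|lra].
Qed.

(** For each [k] the regret is at least [Delta k * g k ^+ 2 / 48]. One half of it absorbs the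
    quadratic term, [eta] being small; the other half absorbs the linear term up to the remainder of
    AM-GM. *)
Lemma gap_tradeoff eta g p : 0 <= eta -> (forall k, 0 <= g k) ->
  12 * (8 + 384 * c ^+ 2) * m%:R * eta <= Dmin / 96 ->
  (forall k, ~~ astar k -> g k ^+ 2 / 48 <= p k) ->
  2 * (24 * eta * \sum_(k | ~~ astar k) g k +
       6 * (8 + 384 * c ^+ 2) * m%:R * eta * \sum_(k | ~~ astar k) g k ^+ 2 +
       eta / c ^+ 2 * (5 * \sum_(k | ~~ astar k) g k)) -
    \sum_(k | ~~ astar k) Delta k * p k <=
  gap_cst * eta ^+ 2 * \sum_(k | ~~ astar k) (Delta k)^-1.
Proof.
move=> eta0 g0 small gp.
rewrite !mulr_sumr -!big_split /= mulr_sumr -sumrB; apply: ler_sum => k ka.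
have Dk := DeltaD ka. have Dk0 : 0 < Delta k by exact: lt_le_trans Dmin0 Dk.
have gk := g0 k. have pk := gp k ka.
set a := 48 + 10 / c ^+ 2.
(* AM-GM: [a eta g <= Delta g^2 / 96 + 24 a^2 eta^2 / Delta] *)
have main : a * eta * g k - Delta k * (g k ^+ 2 / 96) <= 24 * a ^+ 2 * eta ^+ 2 * (Delta k)^-1.
  have u1 : Delta k * (Delta k)^-1 = 1 by rewrite mulfV // gt_eqF.
  have ui : 0 < (Delta k)^-1 by rewrite invr_gt0.
  move: (Delta k) (g k) (Delta k)^-1 u1 ui => D x u u1 ui.
  rewrite -subr_ge0.
  (* The term with [1 - D * u], which vanishes, turns the completed square into a polynomial
     identity. *)
  have -> : 24 * a ^+ 2 * eta ^+ 2 * u - (a * eta * x - D * (x ^+ 2 / 96)) =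
     u * (D * x - 48 * a * eta) ^+ 2 / 96 +
     (1 - D * u) * (D * x ^+ 2 / 96 - a * eta * x).
    by move: (u) (a) => u' a'; field.
  by rewrite u1 subrr mul0r addr0 divr_ge0 // mulr_ge0 ?sqr_ge0 // ltW.
have h1 : Delta k * (g k ^+ 2 / 48) <= Delta k * p k by rewrite ler_wpM2l // ltW.
have h2 : 12 * (8 + 384 * c ^+ 2) * m%:R * eta * g k ^+ 2 <= Delta k / 96 * g k ^+ 2.
  by rewrite ler_wpM2r ?sqr_ge0 //; lra.
have -> : gap_cst * eta ^+ 2 * (Delta k)^-1 = 24 * a ^+ 2 * eta ^+ 2 * (Delta k)^-1 by [].
apply: le_trans main.
apply: le_trans (_ : a * eta * g k + 12 * (8 + 384 * c ^+ 2) * m%:R * eta * g k ^+ 2 - Delta k * p k <= _).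
  rewrite le_eqVlt; apply/orP; left; apply/eqP; rewrite /a.
  set ic := (c ^+ 2)^-1; set q := 8 + 384 * c ^+ 2; ring.
move: h1 h2; set x1 := 12 * _ * _ * _ * _; set x2 := a * _ * _.
set x3 := Delta k * p k; move: (Delta k) (g k ^+ 2) => D y h1 h2; lra.
Qed.

End GapAlgebra.

(** * One round of the algorithm *)

Section Sources.
Context {R : realType} {disp : measure_display} {Om : measurableType disp}.
Variable P : probability Om R.
Variables (d : nat) (X : randomness P d).
Implicit Types (k : source d) (A : set (source d)) (i : 'I_d) (t s : nat).

Lemma source_measurable k : source_sigma X k `<=` measurable.
Proof. by case: k => [[[t|[t i]]|[[t s] i]]|[t s]]; exact: generated_measurable. Qed.

Lemma sourceT k : source_sigma X k setT.
Proof. by case: k => [[[t|[t i]]|[[t s] i]]|[t s]]; exact: generatedT. Qed.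

Lemma sourceI k : setI_closed (source_sigma X k).
Proof. by case: k => [[[t|[t i]]|[[t s] i]]|[t s]]; exact: generatedI. Qed.

Definition past t : set (source d) := [set k |
  match k with
  | inl (inl (inl u)) => (u < t)%N
  | inl (inl (inr (u, _))) => (u < t)%N
  | inl (inr (u, _, _)) => (u < t)%N
  | inr (u, _) => (u < t)%N
  end].

Definition now t : set (source d) := [set k |
  match k with
  | inl (inl (inl u)) => u == t
  | inl (inl (inr (u, _))) => u == t
  | inl (inr (u, _, _)) => u == t
  | inr (u, _) => u == t
  end].

Definition loss_src t : set (source d) :=
  [set k | if k is inl (inl (inl u)) then u == t else false].

Definition pert_src t : set (source d) :=
  [set k | if k is inl (inl (inr (u, _))) then u == t else false].

Definition trial_src t s : set (source d) := [set k |
  match k with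
  | inl (inr (u, v, _)) => (u == t) && (v == s)
  | inr (u, v) => (u == t) && (v == s)
  | _ => false
  end].

Definition trials_src t n : set (source d) :=
  [set k |
  match k with
  | inl (inr (u, v, _)) => (u == t) && (v < n)%N
  | inr (u, v) => (u == t) && (v < n)%N
  | _ => false
  end].

Local Notation src A := (srcT (source_sigma X) A).

Lemma measurable_loss A t i : A (inl (inl (inl t))) ->
  measurable_fun setT ((fun w => tnth (loss X t w) i) : src A -> R).
Proof.
move=> At; apply: measurableT_comp (measurable_tnth i) _.
by apply: (srcT_gen At) => C mC; exact: generated_preimage.
Qed.

Lemma measurable_pert A t i : A (inl (inl (inr (t, i)))) ->
  measurable_fun setT (pert X t i : src A -> R).
Proof. by move=> At; apply: (srcT_gen At) => C mC; exact: generated_preimage. Qed.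

Lemma measurable_repert A t s i : A (inl (inr (t, s, i))) ->
  measurable_fun setT (repert X t s i : src A -> R).
Proof. by move=> At; apply: (srcT_gen At) => C mC; exact: generated_preimage. Qed.

Lemma measurable_theta A t s : A (inr (t, s)) ->
  measurable_fun setT (theta X t s : src A -> nat).
Proof. by move=> At; apply: (srcT_gen At) => C mC; exact: generated_preimage. Qed.

Hypothesis ind : mutually_independent P (source_sigma X).

Lemma pert_independent t : mutually_independent P (fun i => Defs.generated (pert X t i)).
Proof.
apply: (@mutually_independent_inj _ _ _ P _ _ (source_sigma X)
  (fun i : 'I_d => inl (inl (inr (t, i))) : source d)) ind.
by move=> i j [].
Qed.

Lemma repert_independent t s :
  mutually_independent P (fun i => Defs.generated (repert X t s i)).
Proof.
apply: (@mutually_independent_inj _ _ _ P _ _ (source_sigma X)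
  (fun i : 'I_d => inl (inr (t, s, i)) : source d)) ind.
by move=> i j [].
Qed.

Lemma source_pr_indep A B (b b' : Om -> bool) : A `&` B = set0 ->
  measurable_fun setT (b : src A -> bool) ->
  measurable_fun setT (b' : src B -> bool) ->
  pr P (fun w => b w && b' w) = pr P b * pr P b'.
Proof. exact: (pr_indep source_measurable sourceT sourceI ind). Qed.

Lemma source_Ex_indep A B (f g : Om -> R) : A `&` B = set0 ->
  measurable_fun setT (f : src A -> R) ->
  measurable_fun setT (g : src B -> R) ->
  (forall w, 0 <= f w) -> (forall w, 0 <= g w) ->
  Ex P (fun w => f w * g w) = (Ex P f * Ex P g)%E.
Proof. exact: (Ex_indep source_measurable sourceT sourceI ind). Qed.

Lemma source_measurable_fun d' (T : measurableType d') A (f : Om -> T) :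
  measurable_fun setT (f : src A -> T) -> measurable_fun setT f.
Proof. exact: (srcT_measurable source_measurable). Qed.

End Sources.

Arguments pert_independent {R disp Om P d X} ind t.
Arguments repert_independent {R disp Om P d X} ind t s.

(** * Mean and moments of the inverse-weight estimators *)

Section Trials.
Context {R : realType} {disp : measure_display} {Om : measurableType disp}.
Variable P : probability Om R.
Variables (d m : nat) (D : perturbation) (sch : resampling d).
Variables (nu : probability (d.-tuple R) R) (X : randomness P d).
Hypothesis md : (0 < m < d)%N.
Hypothesis model : stochastic_model m D sch nu X.
Variables (t : nat) (L : 'I_d -> R) (eta : R) (i : 'I_d).
Hypothesis eta0 : 0 <= eta.

Local Notation src A := (srcT (source_sigma X) A).
Let ind := model_indep model.
Let lam j := eta * L j.
Let w1 := selp (pert X 0) m lam i.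

Let hit s w := among_largest m (fun j =>
  resampled_vector m sch L i (fun j => repert X t s j w) (theta X t s w) j - lam j) i.

Let measurable_hit A s : (forall j, A (inl (inr (t, s, j)))) -> A (inr (t, s)) ->
  measurable_fun setT (hit s : src A -> bool).
Proof.
move=> Ar At.
apply: (@measurable_trial_event R _ (src A) d m (fun j _ => L j)
  (fun j w => repert X t s j w) (theta X t s)).
- by move=> j; exact: measurable_cst.
- by move=> j; exact: measurable_repert.
- exact: measurable_theta.
Qed.

(* The estimator is [kappa] times the number of trials, each of which succeeds with
   probability [kappa] times the selection probability. *)
Definition kappa : R := match sch with
  | GR => 1
  | CGR tie => if (rank tie L i <= m)%N then 1 else (rank tie L i)%:R / m%:R
  end.

Lemma kappa_gt0 : 0 < kappa.
Proof.
rewrite /kappa; case: sch => [|tie] //; case: ifP => // _.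
by rewrite divr_gt0 // ltr0n ?rank_gt0 //; case/andP: md.
Qed.

Let mhit s : measurable_fun setT (hit s).
Proof.
apply: (@source_measurable_fun _ _ _ P _ X _ _ (trial_src t s)).
by apply: measurable_hit => [j|]; rewrite /trial_src /= !eqxx.
Qed.

Let selp_repert s : selp (repert X t s) m lam i = w1.
Proof.
exact: (selp_law (pert_independent ind 0%N) (model_pert model 0%N)
  (repert_independent ind t s) (model_repert model t s) m lam i).
Qed.

Let m0 : (0 < m)%N. Proof. by case/andP: md. Qed.

(** The model prescribes the masses of [0, ..., m - 1] only; they already add up to [1]. *)
Let theta_lt s : is_cgr sch -> {ae P, forall w, (theta X t s w < m)%N}.
Proof.
move=> cgr.
have mb : measurable_fun setT (fun w => (theta X t s w < m)%N).
  by apply: (@measurableT_comp _ _ _ _ _ _ (fun k : nat => (k < m)%N) _ (theta X t s)).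
suff : pr P (fun w => ~~ (theta X t s w < m)%N) = 0.
  move=> h; exists [set w | ~~ (theta X t s w < m)%N]; split.
  - by apply: measurable_event; exact: measurable_neg.
  - by rewrite prE ?h //; exact: measurable_neg.
  - by move=> w /= /negP.
have mk (k : 'I_m) : measurable_fun setT (fun w => theta X t s w == k).
  by apply: (@measurableT_comp _ _ _ _ _ _ (fun n : nat => n == k) _ (theta X t s)).
rewrite prN // (_ : pr P _ = 1) ?subrr //.
apply: EFin_inj; rewrite -Ex_natb //.
rewrite (@eq_Ex _ _ _ _ _ (fun w => \sum_(k < m) (theta X t s w == k)%:R)); last first.
  move=> w; case: ltnP => h; last first.
    rewrite big1 // => k _; rewrite gtn_eqF //; exact: leq_trans (ltn_ord k) h.
  rewrite (bigD1 (Ordinal h)) //= eqxx big1 ?addr0 // => k /eqP kh.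
  by case: eqP => // e; case: kh; apply: val_inj.
rewrite Ex_sum // => [|k]; last exact: measurable_natb.
rewrite (eq_bigr (fun=> (m%:R^-1)%:E)) => [|k _]; last first.
  rewrite Ex_natb // -prE // -(model_theta model cgr t s (ltn_ord k)).
  by congr (P _); apply/seteqP; split => w /= /eqP.
by rewrite sumEFin sumr_const card_ord -[_ *+ m]mulr_natr mulVf // pnatr_eq0 -lt0n.
Qed.

(** For CGR beyond rank [m], the drawn position is independent of the resampled vector, so the
    success probability is the mean of [pr P (swapped k)] over the positions. *)
Let pr_hit s : pr P (hit s) = kappa * w1.
Proof.
rewrite /kappa; move: (mhit s) (@theta_lt s) (model_theta model); rewrite /hit /resampled_vector.
case: sch => [|tie] mh tl mt; first by rewrite mul1r -(selp_repert s).
move: mh; case: ifP => [rk|/negbT rk] mh; first by rewrite mul1r -(selp_repert s).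
rewrite -ltnNge in rk.
rewrite -(pr_swapped_mean (pert_independent ind 0%N) (model_pert model 0%N)
  (repert_independent ind t s) (model_repert model t s) eta0 rk).
set swapped := fun (k : nat) w => among_largest m (fun j => repert X t s
  (tperm i (kth_largest tie L (fun j0 => repert X t s j0 w) i k) j) w - lam j) i.
have mk (k : 'I_m) A : A (inr (t, s)) ->
    measurable_fun setT ((fun w => theta X t s w == k) : src A -> bool).
  move=> At; apply: (@measurableT_comp _ _ _ _ _ _ (fun n : nat => n == k) _ (theta X t s : src A -> nat)) => //.
  exact: measurable_theta.
have msw k A : (forall j, A (inl (inr (t, s, j)))) ->
    measurable_fun setT (swapped k : src A -> bool).
  move=> At.
  rewrite (_ : swapped k = fun w => [exists i', (kth_largest tie L (fun j0 => repert X t s j0 w) i k == i') && among_largest m (fun j => repert X t s (tperm i i' j) w - lam j) i]); last first.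
    apply/funext => w; apply/idP/existsP => [h|[i' /andP[/eqP <- //]]].
    by eexists; apply/andP; split; [exact: eqxx|].
  apply: (@measurable_exists _ (src A) _ xpredT) => i'; apply: measurable_and.
    by apply: (@measurable_kth_largest R _ (src A) d (fun j _ => L j) (fun j w => repert X t s j w) (fun=> k)) => [j|j|];
      [exact: measurable_cst|exact: measurable_repert|exact: measurable_cst].
  apply: (@measurable_among_largest R _ (src A) d m (fun j w => repert X t s (tperm i i' j) w - lam j)) => j.
  by apply: measurable_funB; [exact: measurable_repert|exact: measurable_cst].
have mk' (k : 'I_m) : measurable_fun setT (fun w => theta X t s w == k).
  by apply: (@source_measurable_fun _ _ _ P _ X _ _ setT); exact: mk.
have msw' k : measurable_fun setT (swapped k).
  by apply: (@source_measurable_fun _ _ _ P _ X _ _ setT); exact: msw.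
have mb : measurable_fun setT (fun w => [exists k : 'I_m, (theta X t s w == k) && swapped k w]).
  by apply: (@measurable_exists _ _ _ xpredT) => k; exact: measurable_and.
rewrite (@ae_eq_pr _ _ _ _ _ (fun w => [exists k : 'I_m, (theta X t s w == k) && swapped k w])) //; last first.
  have := tl isT; apply: filterS => w lt.
  apply/idP/existsP => [h|[k /andP[/eqP h]]]; last by rewrite /swapped -h.
  by exists (Ordinal lt); rewrite eqxx.
apply: EFin_inj; rewrite -Ex_natb // -sumEFin.
rewrite (@eq_Ex _ _ _ _ _ (fun w => \sum_(k < m) ((theta X t s w == k) && swapped k w)%:R)); last first.
  move=> w; case: existsP => [[k h]|h].
    rewrite (bigD1 k) //= h big1 ?addr0 // => k' /eqP kk.
    case: eqP => // e; case: kk; apply: val_inj; rewrite /= -e.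
    by case/andP: h => /eqP.
  by rewrite big1 // => k _; case: (boolP (_ && _)) => // hk; case: h; exists k.
rewrite Ex_sum // => [|k]; last by apply: measurable_natb; exact: measurable_and.
apply: eq_bigr => k _; rewrite Ex_natb; last exact: measurable_and.
rewrite (source_pr_indep ind (A := [set inr (t, s)]) (B := [set k0 | if k0 is inl (inr _) then true else false])) //.
- congr (_ * _)%:E; apply: EFin_inj; rewrite -prE // -(mt isT t s k (ltn_ord k)).
  by congr (P _); apply/seteqP; split => w /= /eqP.
- by apply/seteqP; split => // k0 /= [->].
- exact: mk.
- exact: msw.
Qed.

Let p := kappa * w1.

Let w1_gt0 : 0 < w1.
Proof. exact (selp_gt0 (pert_independent ind 0%N) (model_pert model 0%N) md lam i). Qed.

Let p01 : 0 < p <= 1.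
Proof. by rewrite /p mulr_gt0 ?kappa_gt0 //= -(pr_hit 0) pr_le1. Qed.

(** Distinct trials read disjoint sources, so each further failure multiplies the probability by
    [1 - p]. *)
Let pr_fails n : pr P (fails hit n) = (1 - p) ^+ n.
Proof.
elim: n => [|n IH].
  rewrite expr0 (@eq_pr _ _ _ _ _ (fun=> true)) ?pr_true // => w.
  by rewrite /fails; apply/forallP => -[].
rewrite (@eq_pr _ _ _ _ _ (fun w => fails hit n w && ~~ hit n w)); last first.
  move=> w; rewrite /fails; apply/forallP/andP => [h|[/forallP h hn] s].
    split; last exact: (h ord_max).
    by apply/forallP => s; exact: (h (widen_ord (leqnSn n) s)).
  have [sn|] := ltnP s n; first exact: (h (Ordinal sn)).
  by move: (ltn_ord s); rewrite ltnS => s1 s2; rewrite (_ : nat_of_ord s = n) //; apply/eqP; rewrite eqn_leq s1.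
rewrite (source_pr_indep ind (A := trials_src t n) (B := trial_src t n)).
- by rewrite IH prN // pr_hit exprSr.
- apply/seteqP; split => // -[[[u|[u j]]|[[u s] j]]|[u s]] //= [] // /andP[_ h] /andP[_ /eqP e];
    by rewrite e ltnn in h.
- apply: (@measurable_forall _ (src _) 'I_n xpredT (fun s w => ~~ hit s w)) => s.
  by apply: measurable_neg; apply: measurable_hit => [j|]; rewrite /trials_src /= eqxx ltn_ord.
- by apply: measurable_neg; apply: measurable_hit => [j|]; rewrite /trial_src /= !eqxx.
Qed.

Definition resampled_weight w : R :=
  inv_weight m sch eta L (fun s j => repert X t s j w) (fun s => theta X t s w) i.

Lemma resampled_weightE w : resampled_weight w = kappa * (first_trial hit w)%:R.
Proof.
rewrite /resampled_weight /inv_weight /kappa /trials /first_trial /hit /lam.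
by case: sch => [|tie]; rewrite ?mul1r //; case: ifP; rewrite ?mul1r.
Qed.

Lemma resampled_weight_ge0 w : 0 <= resampled_weight w.
Proof. by rewrite resampled_weightE mulr_ge0 // ltW // kappa_gt0. Qed.

Lemma measurable_resampled_weight A : (forall s j, A (inl (inr (t, s, j)))) ->
  (forall s, A (inr (t, s))) ->
  measurable_fun setT (resampled_weight : src A -> R).
Proof.
move=> Ar At.
rewrite (_ : resampled_weight = fun w => kappa * (first_trial hit w)%:R); last first.
  by apply/funext => w; exact: resampled_weightE.
apply: measurable_funM; first exact: measurable_cst.
apply: (@measurable_natr R _ (src A)).
by apply: (@measurable_first_trial _ (src A)) => s; exact: measurable_hit.
Qed.

Let k0 := kappa_gt0.

(** [kappa] cancels between the scaling of the estimator and the success probability, so GR and CGR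
    obey the same bound. *)
Lemma Ex_resampled_weightX k :
  (Ex P (fun w => resampled_weight w ^+ k.+1)%R <= (k.+1`!%:R / w1 ^+ k.+1)%:E)%E.
Proof.
rewrite (@eq_Ex _ _ _ _ _ (fun w => kappa ^+ k.+1 * (first_trial hit w)%:R ^+ k.+1)); last first.
  by move=> w; rewrite resampled_weightE exprMn.
rewrite ExZ; [|exact: (measurable_trialX mhit)|by move=> w; rewrite exprn_ge0|by rewrite exprn_ge0 // ltW].
apply: le_trans (lee_wpmul2l _ (Ex_trialX mhit p01 pr_fails k)) _.
  by rewrite lee_fin exprn_ge0 // ltW.
rewrite -EFinM lee_fin /p exprMn.
have : kappa ^+ k.+1 != 0 by rewrite expf_neq0 // gt_eqF.
have : w1 ^+ k.+1 != 0 by rewrite expf_neq0 // gt_eqF.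
set a := _ ^+ _; set b := _ ^+ _ => an bn; rewrite le_eqVlt; apply/orP; left; apply/eqP.
by field; rewrite an bn.
Qed.

Lemma Ex_resampled_weight : Ex P resampled_weight = (w1^-1)%:E.
Proof.
rewrite (@eq_Ex _ _ _ _ _ (fun w => kappa * (first_trial hit w)%:R)); last first.
  by move=> w; rewrite resampled_weightE.
rewrite ExZ; [|exact: (measurable_trialX mhit 1)|by []|exact: ltW].
rewrite (Ex_trial mhit p01 pr_fails) -EFinM /p; congr _%:E.
by have := lt0r_neq0 k0; have := lt0r_neq0 w1_gt0; move=> ? ?; field; apply/andP.
Qed.

End Trials.

Section MeasurableRound.
Context {R : realType} d' (T : measurableType d') (d m : nat).
Variable L : 'I_d -> T -> R.
Hypothesis mL : forall j, measurable_fun setT (L j).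

Lemma measurable_inv_weight (x : nat -> 'I_d -> T -> R) (th : nat -> T -> nat) sch eta i :
  (forall s j, measurable_fun setT (x s j)) -> (forall s, measurable_fun setT (th s)) ->
  measurable_fun setT (fun w => inv_weight m sch eta (L ^~ w)
    (fun s j => x s j w) (fun s => th s w) i).
Proof.
move=> mx mth.
have mM : measurable_fun setT (fun w => (trials m sch eta (L ^~ w)
    (fun s j => x s j w) (fun s => th s w) i)%:R : R).
  apply: measurable_natr; apply: (@measurable_first_trial _ _ (fun s w => among_largest m
    (fun j => resampled_vector m sch (L ^~ w) i (fun j0 => x s j0 w) (th s w) j - eta * L j w) i)) => s.
  by apply: measurable_trial_event.
rewrite /inv_weight; case: sch mM => [|tie] mM //.
apply: measurable_fun_ifT => //.
  apply: (@measurableT_comp _ _ _ _ _ _ (fun n : nat => (n <= m)%N) _ (fun w => rank tie (L ^~ w) i)) => //.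
  exact: measurable_rank.
apply: measurable_funM => //; apply: measurable_funM => //.
by apply: measurable_natr; exact: measurable_rank.
Qed.

End MeasurableRound.

Section MeasurablePotential.
Context {R : realType} {disp : measure_display} {Om : measurableType disp}.
Variable P : probability Om R.
Variables (d m : nat) (r : 'I_d -> {RV P >-> R}) (astar : {ffun 'I_d -> bool}).

Hypothesis md : (0 < m < d)%N.
Hypothesis astarA : is_action m astar.

Lemma measurable_pot d' (T : measurableType d') (x : 'I_d -> T -> R) (b : R) :
  (forall j, measurable_fun setT (x j)) ->
  measurable_fun setT (fun w => pot r m astar b (x ^~ w)).
Proof.
move=> mx.
pose f (z : T * Om) := (gain astar (m := m) (fun i => b * r i z.2 - x i z.1))%:E.
have f0 z : (0 <= f z)%E by rewrite lee_fin gain_ge0 //; case/andP: md => _ /ltnW.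
have mf : measurable_fun setT f.
  apply/measurable_EFinP.
  apply: (@measurable_gain R d m astar _ _ (fun i z => b * r i z.2 - x i z.1)) => j.
  apply: measurable_funB; last by apply: (measurableT_comp (mx j)).
  by apply: measurable_funM => //; apply: measurableT_comp.
have := @measurable_fun_fubini_tonelli_F _ _ T Om R P f mf f0.
by rewrite /fubini_F.

Qed.

End MeasurablePotential.

Section MeanLoss.
Context {R : realType} {disp : measure_display} {Om : measurableType disp}.
Variable P : probability Om R.
Variables (d m : nat) (D : perturbation) (sch : resampling d).
Variables (nu : probability (d.-tuple R) R) (X : randomness P d).
Hypothesis model : stochastic_model m D sch nu X.

Lemma Ex_loss t i : Ex P (fun w => tnth (loss X t w) i) = (mean_loss nu i)%:E.
Proof.
have l01 w : 0 <= tnth (loss X t w) i <= 1 by exact: model_loss01 model _ _ _.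
have ml : measurable_fun setT (fun w => tnth (loss X t w) i).
  by apply: (@measurableT_comp _ _ _ _ _ _ (fun x : d.-tuple R => tnth x i) _ (loss X t)) => //; exact: measurable_tnth.
rewrite (@Ex_fin01 _ _ _ P _ ml l01); congr _%:E; rewrite /mean_loss /Rintegral; congr fine.
have <- : (\int[distribution P (loss X t)]_x (tnth x i)%:E = \int[nu]_x (tnth x i)%:E)%E.
  by apply: eq_measure_integral => A mA _; exact: model_loss model t A mA.
rewrite integral_distribution //; first by apply/measurable_EFinP; exact: measurable_tnth.
apply: (@le_integrable _ _ _ P setT measurableT (fun w => (tnth (loss X t w) i)%:E) (fun=> 1%E)) => //.
- exact/measurable_EFinP.
- by move=> w _ /=; case/andP: (l01 w) => h0 h1; rewrite lee_fin normr1 ger0_norm.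
- exact: finite_measure_integrable_cst.
Qed.

Lemma mean_loss01 i : 0 <= mean_loss nu i <= 1.
Proof.
have l01 w : 0 <= tnth (loss X 0%N w) i <= 1 by exact: model_loss01 model _ _ _.
have ml : measurable_fun setT (fun w => tnth (loss X 0%N w) i).
  by apply: (@measurableT_comp _ _ _ _ _ _ (fun x : d.-tuple R => tnth x i) _ (loss X 0%N)) => //; exact: measurable_tnth.
rewrite -!lee_fin -(Ex_loss 0); apply/andP; split.
  by apply: Ex_ge0 => w; case/andP: (l01 w).
rewrite -(Ex_cst P 1); apply: Ex_le => // w; by case/andP: (l01 w).
Qed.

End MeanLoss.

(** * Loss estimates, and the round inequality from a fixed starting point *)

Section Round.
Context {R : realType} {disp : measure_display} {Om : measurableType disp}.
Variable P : probability Om R.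
Variables (d m : nat) (D : perturbation) (sch : resampling d).
Variables (nu : probability (d.-tuple R) R) (X : randomness P d).
Hypothesis md : (0 < m < d)%N.
Hypothesis model : stochastic_model m D sch nu X.
Variables (c : R) (t : nat) (L : 'I_d -> R).
Hypothesis c0 : 0 < c.
Implicit Types (i j k : 'I_d).

Local Notation src A := (srcT (source_sigma X) A).
Local Notation eta := (learning_rate c t).
Local Notation lam := (fun j => eta * L j).
Local Notation p := (selp (pert X 0%N) m lam).
Local Notation mu := (mean_loss nu).
Let ind := model_indep model.
Let ind0 := pert_independent ind 0%N.
Let law0 := model_pert model 0%N.
Let md' : (m <= d)%N. Proof. by case/andP: md => _ /ltnW. Qed.

Lemma learning_rate_gt0 : 0 < eta.
Proof. by rewrite /learning_rate divr_gt0 // sqrtr_gt0 ltr0n. Qed.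

Lemma play_sel i :
  {ae P, forall w, play m c (realize X w) t L i = sel (pert X t) m lam i w}.
Proof.
have := pert_injective (pert_independent ind t) (model_pert model t) lam.
apply: filterS => w inj; rewrite /play /= argmin_action_top //.
  rewrite /sel; congr among_largest; apply/funext => j; ring.
by move=> j k /= h; apply: inj; apply: oppr_inj; rewrite !opprB.
Qed.

Lemma measurable_play A i : (forall j, A (inl (inl (inr (t, j))))) ->
  measurable_fun setT ((fun w => play m c (realize X w) t L i) : src A -> bool).
Proof.
move=> At; apply: (@measurable_argmin_action R _ (src A) d m (fun j w => eta * L j - pert X t j w)) => j.
by apply: measurable_funB; [exact: measurable_cst|exact: measurable_pert].
Qed.

Let mplay i : measurable_fun setT (fun w => play m c (realize X w) t L i).
Proof. by apply: (@source_measurable_fun _ _ _ P _ X _ _ setT); exact: measurable_play. Qed.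

Lemma pr_play i : pr P (fun w => play m c (realize X w) t L i) = p i.
Proof.
rewrite (ae_eq_pr (mplay i) _ (play_sel i)); last exact: measurable_sel.
exact: (selp_law ind0 law0 (pert_independent ind t) (model_pert model t) m lam i).
Qed.

Lemma sum_selp : \sum_i p i = m%:R.
Proof.
apply: EFin_inj; rewrite -sumEFin.
rewrite (eq_bigr (fun i => Ex P (fun w => (sel (pert X 0%N) m lam i w)%:R)));
  last by move=> i _; rewrite /selp -Ex_natb //; exact: measurable_sel.
rewrite -Ex_sum => [|i|i w]; [|by apply: measurable_natb; exact: measurable_sel|exact: ler0n].
rewrite -(Ex_cst P m%:R).
have inj := pert_injective ind0 law0 lam.
have e : {ae P, forall w, \sum_i (sel (pert X 0%N) m lam i w)%:R = m%:R :> R}.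
  apply: filterS inj => w inj; rewrite -natr_sum; congr _%:R.
  rewrite -[RHS](card_among_largest md' inj) -sum1_card [RHS]big_mkcond /=.
  by apply: eq_bigr => i _; rewrite inE /sel; case: among_largest.
have ms : measurable_fun setT (fun w => \sum_i (sel (pert X 0%N) m lam i w)%:R : R).
  by apply: (@measurable_bigsum R _ _ _ _ xpredT) => i; apply: measurable_natb; exact: measurable_sel.
by apply/eqP; rewrite eq_le; apply/andP; split; apply: Ex_ae_le => //=;
  try (by move=> w; apply: sumr_ge0); apply: filterS e => w ->.
Qed.

Let p_gt0 i : 0 < p i.
Proof. exact (selp_gt0 ind0 law0 md lam i). Qed.

Definition play_src : set (source d) := [set k |
  match k with
  | inl (inl (inl u)) => u == t
  | inl (inl (inr (u, _))) => u == t
  | _ => false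
  end].

Definition resample_src : set (source d) := [set k |
  match k with
  | inl (inr (u, _, _)) => u == t
  | inr (u, _) => u == t
  | _ => false
  end].

Lemma Ex_played_loss i :
  Ex P (fun w => (play m c (realize X w) t L i)%:R * tnth (loss X t w) i) = (p i * mu i)%:E.
Proof.
rewrite (source_Ex_indep ind (A := pert_src t) (B := loss_src t)).
- by rewrite Ex_natb // pr_play (Ex_loss model).
- by apply/seteqP; split => // -[[[u|[u j]]|[[u s] j]]|[u s]] /= [].
- by apply: (@measurable_natb R _ (src _)); apply: measurable_play => j; rewrite /pert_src /=.
- by apply: measurable_loss; rewrite /loss_src /=.
- by move=> w; exact: ler0n.
- by move=> w; case/andP: (model_loss01 model t w i).
Qed.

Definition loss_estimate i w : R :=
  (play m c (realize X w) t L i)%:R * tnth (loss X t w) i *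
  resampled_weight m sch X t L eta i w.

Let eta0 : 0 <= eta. Proof. exact: ltW learning_rate_gt0. Qed.

Let W i := resampled_weight m sch X t L eta i.

Let W0 i w : 0 <= W i w. Proof. exact: resampled_weight_ge0. Qed.

Let l0 i w : 0 <= tnth (loss X t w) i. Proof. by case/andP: (model_loss01 model t w i). Qed.

Let l1 i w : tnth (loss X t w) i <= 1. Proof. by case/andP: (model_loss01 model t w i). Qed.

Lemma loss_estimate_ge0 i w : 0 <= loss_estimate i w.
Proof. by rewrite mulr_ge0 // mulr_ge0. Qed.

Lemma measurable_loss_estimate i : measurable_fun setT (loss_estimate i).
Proof.
apply: (@source_measurable_fun _ _ _ P _ X _ _ setT).
apply: (@measurable_funM _ (src setT)); last exact: measurable_resampled_weight.
apply: (@measurable_funM _ (src setT)); last exact: measurable_loss.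
by apply: (@measurable_natb R _ (src setT)); exact: measurable_play.
Qed.

Let disjoint_srcs : play_src `&` resample_src = set0.
Proof. by apply/seteqP; split => // -[[[u|[u j]]|[[u s] j]]|[u s]] /= []. Qed.

(** Play and loss are independent of the resampling, and the factor [p i] of the play cancels the
    mean [(p i)^-1] of the weight. *)
Lemma Ex_loss_estimate i : Ex P (loss_estimate i) = (mu i)%:E.
Proof.
rewrite /loss_estimate (source_Ex_indep ind disjoint_srcs).
- rewrite Ex_played_loss (Ex_resampled_weight md model t L i eta0) -EFinM; congr _%:E.
  by rewrite mulrAC mulfV ?mul1r // gt_eqF // p_gt0.
- apply: (@measurable_funM _ (src _)).
    by apply: (@measurable_natb R _ (src _)); apply: measurable_play => j; rewrite /play_src /=.
  by apply: measurable_loss; rewrite /play_src /=.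
- by apply: measurable_resampled_weight => [s j|s]; rewrite /resample_src /=.
- by move=> w; rewrite mulr_ge0.
- exact: W0.
Qed.

(** Losses are at most [1], and the indicator of the play contributes a factor [p i], which lowers
    the exponent by one. *)
Lemma Ex_loss_estimateX i n :
  (Ex P (fun w => loss_estimate i w ^+ n.+1)%R <= (n.+1`!%:R / p i ^+ n)%:E)%E.
Proof.
have mW : measurable_fun setT (W i).
  apply: (@source_measurable_fun _ _ _ P _ X _ _ setT).
  exact: measurable_resampled_weight.
apply: (@le_trans _ _ (Ex P (fun w => (play m c (realize X w) t L i)%:R * W i w ^+ n.+1)%R)).
  apply: Ex_le => [||w|w].
  - by apply: measurable_funX; exact: measurable_loss_estimate.
  - by apply: measurable_funM; [exact: measurable_natb|exact: measurable_funX].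
  - by rewrite exprn_ge0 // loss_estimate_ge0.
  - rewrite /loss_estimate; case: (play m c (realize X w) t L i) => /=; last by rewrite !mul0r expr0n.
    by rewrite !mul1r lerXn2r ?nnegrE ?mulr_ge0 // -[leRHS]mul1r ler_wpM2r.
rewrite (source_Ex_indep ind disjoint_srcs).
- rewrite Ex_natb // pr_play.
  apply: le_trans (lee_wpmul2l _ (Ex_resampled_weightX md model t L i eta0 n)) _.
    by rewrite lee_fin ltW // p_gt0.
  rewrite -EFinM lee_fin exprS le_eqVlt; apply/orP; left; apply/eqP.
  have pi := p_gt0 i; have pn : p i ^+ n != 0 by rewrite expf_neq0 // gt_eqF.
  by move: (p i) pi pn (_ `!%:R) => q q0; set b := q ^+ n => bn f; field; rewrite bn gt_eqF.
- by apply: (@measurable_natb R _ (src _)); apply: measurable_play => j; rewrite /play_src /=.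
- apply: (@measurable_funX _ (src _)).
  by apply: measurable_resampled_weight => [s j|s]; rewrite /resample_src /=.
- by move=> w; exact: ler0n.
- by move=> w; rewrite exprn_ge0.
Qed.

Variable astar : {ffun 'I_d -> bool}.
Hypothesis astarA : is_action m astar.

Local Notation pot := (pot (pert X 0%N) m astar).

(** [pot_loss] is integrated over the estimates. A stability bound with linear and cubic terms,
    multiplied by the estimate, involves its second and fourth moments, whence the factors [2 = 2!]
    and [24 = 4!]. *)
Lemma round_loss (al be : 'I_d -> R) : (forall i, 0 <= al i) -> (forall i, 0 <= be i) ->
  (forall i x, 0 <= x ->
     p i - selp (pert X 0%N) m (fun j => lam j + (if j == i then eta * x else 0)) i
       <= al i * x + be i * x ^+ 3) ->
  ((\sum_i mu i * p i)%:E + \int[P]_w pot eta^-1 (fun i => (L i + loss_estimate i w)%R) <=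
   pot eta^-1 L + (\sum_(i | astar i) mu i + \sum_i (2 * al i / p i + 24 * be i / p i ^+ 3))%:E)%E.
Proof.
move=> al0 be0 H.
have eta1 := learning_rate_gt0.
have mle := measurable_loss_estimate.
have le0 := loss_estimate_ge0.
have mpot : measurable_fun setT (fun w => pot eta^-1 (fun i => (L i + loss_estimate i w)%R)).
  apply: (@measurable_pot R _ _ P d m _ astar md astarA _ _ (fun i w => L i + loss_estimate i w)) => j.
  exact: measurable_funD.
have pointwise w :
    (pot eta^-1 (fun i => (L i + loss_estimate i w)%R) +
       (\sum_i p i * loss_estimate i w)%:E <=
     pot eta^-1 L + (\sum_(i | astar i) loss_estimate i w +
       \sum_i (al i * loss_estimate i w ^+ 2 + be i * loss_estimate i w ^+ 4))%:E)%E.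
  have := pot_loss ind0 law0 md astarA L (x := loss_estimate ^~ w) (b := eta^-1) _ (fun i => le0 i w).
  rewrite invr_gt0 => /(_ eta1) h.
  have h2 : \sum_i p i * loss_estimate i w <=
     \sum_i loss_estimate i w * selp (pert X 0%N) m (fun j => L j / eta^-1 + (if j == i then loss_estimate i w / eta^-1 else 0)) i +
     \sum_i (al i * loss_estimate i w ^+ 2 + be i * loss_estimate i w ^+ 4).
    rewrite -big_split /=; apply: ler_sum => i _.
    have := H i _ (le0 i w).
    rewrite (_ : (fun j => L j / eta^-1 + _) = fun j => lam j + (if j == i then eta * loss_estimate i w else 0)); last first.
      by apply/funext => j; rewrite invrK mulrC; congr (_ + _); case: ifP => // _; rewrite mulrC.
    set q := selp _ _ (fun j => _ + _) _ => h3; have := ler_wpM2l (le0 i w) h3.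
    move: (p i) q (loss_estimate i w) {h3} => pi q x; rewrite !exprS expr0; lra.
  move: h h2; set S1 := \sum_i p i * _; set S2 := \sum_i _ * _; set S3 := \sum_i _; set S4 := \sum_(i | _) _.
  move: (pot _ _) (pot _ L) => a b h h2.
  apply: (@le_trans _ _ ((a + S2%:E) + S3%:E)%E).
    by rewrite -addeA leeD2l // -EFinD lee_fin.
  by rewrite [(S4 + S3)%:E]EFinD addeA leeD2r.
pose B w := \sum_(i | astar i) loss_estimate i w +
   \sum_i (al i * loss_estimate i w ^+ 2 + be i * loss_estimate i w ^+ 4).
have mX n i : measurable_fun setT (fun w => loss_estimate i w ^+ n).
  exact: measurable_funX.
have mZ (a : R) n i : measurable_fun setT (fun w => a * loss_estimate i w ^+ n).
  exact: measurable_funM.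
have mS : measurable_fun setT (fun w => \sum_(i | astar i) loss_estimate i w).
  by apply: (@measurable_bigsum R _ _ _ _ astar).
have mQi i : measurable_fun setT (fun w => al i * loss_estimate i w ^+ 2 + be i * loss_estimate i w ^+ 4).
  exact: measurable_funD.
have mQ : measurable_fun setT (fun w => \sum_i (al i * loss_estimate i w ^+ 2 + be i * loss_estimate i w ^+ 4)).
  by apply: (@measurable_bigsum R _ _ _ _ xpredT).
have mB : measurable_fun setT B by exact: measurable_funD.
have X0 n i w : 0 <= loss_estimate i w ^+ n by rewrite exprn_ge0.
have S0 w : 0 <= \sum_(i | astar i) loss_estimate i w by rewrite sumr_ge0.
have Qi0 i w : 0 <= al i * loss_estimate i w ^+ 2 + be i * loss_estimate i w ^+ 4.
  by rewrite addr_ge0 // mulr_ge0.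
have Q0 w : 0 <= \sum_i (al i * loss_estimate i w ^+ 2 + be i * loss_estimate i w ^+ 4).
  by rewrite sumr_ge0.
have B0 w : 0 <= B w by rewrite addr_ge0.
have mP : measurable_fun setT (fun w => \sum_i p i * loss_estimate i w).
  apply: (@measurable_bigsum R _ _ _ _ xpredT (fun i w => p i * loss_estimate i w)) => i.
  exact: measurable_funM.
have P0 w : 0 <= \sum_i p i * loss_estimate i w.
  by rewrite sumr_ge0 // => i _; rewrite mulr_ge0 // ltW.
have pot0' b K : (0 <= pot b K)%E by exact: pot_ge0.
have le_int : (\int[P]_w (pot eta^-1 (fun i => (L i + loss_estimate i w)%R) +
       (\sum_i p i * loss_estimate i w)%:E) <= \int[P]_w (pot eta^-1 L + (B w)%:E))%E.
  apply: ge0_le_integral => //.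
  - by move=> w _; rewrite adde_ge0 // lee_fin.
  - by apply: emeasurable_funD => //; exact/measurable_EFinP.
  - by apply: emeasurable_funD => //; exact/measurable_EFinP.
have int_add (f : Om -> \bar R) (g : Om -> R) : measurable_fun setT f ->
    (forall w, (0 <= f w)%E) -> measurable_fun setT g -> (forall w, 0 <= g w) ->
    (\int[P]_w (f w + (g w)%:E) = \int[P]_w f w + Ex P g)%E.
  move=> mf f0 mg g0; rewrite ge0_integralD //; first by move=> w _; rewrite lee_fin.
  exact/measurable_EFinP.
have int_cst (x : \bar R) : (\int[P]__ x = x)%E.
  by rewrite integral_cst // [X in (_ * X)%E]probability_setT mule1.
move: le_int; rewrite !int_add // int_cst => le_int.
have eP : Ex P (fun w => \sum_i p i * loss_estimate i w) = (\sum_i mu i * p i)%:E.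
  rewrite Ex_sum => [|i|i w]; [|exact: measurable_funM|by rewrite mulr_ge0 // ltW].
  rewrite -sumEFin; apply: eq_bigr => i _.
  by rewrite ExZ //; [rewrite Ex_loss_estimate -EFinM mulrC|exact: ltW].
have eB : (Ex P B <= (\sum_(i | astar i) mu i + \sum_i (2 * al i / p i + 24 * be i / p i ^+ 3))%:E)%E.
  rewrite ExD // EFinD; apply: leeD.
    by rewrite Ex_sum // -sumEFin; apply: lee_sum => i _; rewrite Ex_loss_estimate.
  rewrite Ex_sum // -sumEFin; apply: lee_sum => i _.
  rewrite ExD // ?EFinD; [|by move=> w; rewrite mulr_ge0..].
  apply: leeD; rewrite ExZ //.
    apply: le_trans (lee_wpmul2l _ (Ex_loss_estimateX i 1)) _; first by rewrite lee_fin.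
    by rewrite -EFinM lee_fin expr1 mulrCA mulrA.
  apply: le_trans (lee_wpmul2l _ (Ex_loss_estimateX i 3)) _; first by rewrite lee_fin.
  by rewrite -EFinM lee_fin mulrCA mulrA.
move: le_int eB; rewrite eP => h1 h2.
by rewrite addeC; apply: le_trans h1 _; rewrite leeD2l.
Qed.

End Round.

(** * Cost of a round: crude bound and gap bound *)

Section RoundStep.
Context {R : realType} {disp : measure_display} {Om : measurableType disp}.
Variable P : probability Om R.
Variables (d m : nat) (D : perturbation) (sch : resampling d).
Variables (nu : probability (d.-tuple R) R) (X : randomness P d).
Hypothesis md : (0 < m < d)%N.
Hypothesis model : stochastic_model m D sch nu X.
Variables (c : R) (t : nat) (L : 'I_d -> R).
Hypothesis c0 : 0 < c.
Variable astar : {ffun 'I_d -> bool}.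
Hypothesis astarA : is_action m astar.
Variables Mst Dmin : R.
Local Notation mu := (mean_loss nu).
Local Notation Delta := (fun k => mu k - Mst).
Hypothesis muM : forall j, astar j -> mu j <= Mst.
Hypothesis Dmin0 : 0 < Dmin.
Hypothesis Dmin1 : Dmin <= 1.
Hypothesis DeltaD : forall k, ~~ astar k -> Dmin <= Delta k.
Implicit Types (i j k : 'I_d).

Local Notation eta := (learning_rate c t).
Local Notation lam := (fun j => eta * L j).
Local Notation p := (selp (pert X 0%N) m lam).
Local Notation pot := (pot (pert X 0%N) m astar).
Local Notation next_pot := (\int[P]_w pot eta^-1
  (fun i => (L i + loss_estimate m sch X c t L i w)%R))%E.
Let ind := model_indep model.
Let ind0 := pert_independent ind 0%N.
Let law0 := model_pert model 0%N.
Let m0 : (0 < m)%N. Proof. by case/andP: md. Qed.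
Let eta0 : 0 < eta := learning_rate_gt0 t c0.
Let M := size_cst (R := R) (d := d) m.
Let p_gt0 i : 0 < p i.
Proof. exact (selp_gt0 ind0 law0 md lam i). Qed.

Definition round_cost : R :=
  if Num.sqrt t.+1%:R < switch_cst c * M / Dmin then crude_cst c * eta * M
  else gap_cst c * eta ^+ 2 * \sum_(k | ~~ astar k) (Delta k)^-1.

Let A := [set i | astar i]%SET.
Let cA : #|A| = m.
Proof. by apply/eqP; rewrite -is_actionE. Qed.

(** As the probabilities add up to [m], means can be measured from [Mst]; each arm of [astar] then
    adds [(Mst - mu i) * (1 - p i) >= 0] to the regret. *)
Lemma regret_selp_ge :
  \sum_(k | ~~ astar k) Delta k * p k <= \sum_i mu i * p i - \sum_(i | astar i) mu i.
Proof.
have s1 : \sum_(i | astar i) p i = m%:R - \sum_(k | ~~ astar k) p k.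
  by have := sum_selp md model c t L; rewrite (bigID astar) /= => <-; rewrite addrK.
have s2 : \sum_(i | astar i) (mu i - Mst) * (1 - p i) <= 0.
  apply: sumr_le0 => i ai; rewrite mulr_le0_ge0 ?subr_le0 ?muM // subr_ge0.
  by rewrite pr_le1 //; exact: measurable_sel.
have s3 : \sum_(i | astar i) 1 = m%:R :> R.
  by rewrite sumr_const -cA; congr _%:R; apply: eq_card => i; rewrite !inE.
rewrite [X in _ <= X - _](bigID astar) /=.
have e1 : \sum_(i | astar i) (mu i - Mst) * (1 - p i) =
    \sum_(i | astar i) mu i - \sum_(i | astar i) mu i * p i
      - Mst * (\sum_(i | astar i) 1 - \sum_(i | astar i) p i).
  rewrite mulrBr !mulr_sumr -!sumrB; apply: eq_bigr => i _; ring.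
have e2 : \sum_(k | ~~ astar k) (mu k - Mst) * p k =
    \sum_(k | ~~ astar k) mu k * p k - Mst * \sum_(k | ~~ astar k) p k.
  rewrite mulr_sumr -!sumrB; apply: eq_bigr => i _; ring.
rewrite e2; move: s2; rewrite e1 s3 s1; lra.
Qed.

(* The round inequality is used twice, giving up one copy of the regret [u - v]. *)
Lemma double_step (x y : \bar R) (u v K e : R) : (0 <= x)%E -> (0 <= y)%E ->
  (u%:E + x <= y + (e + v)%:E)%E -> 2 * e - (u - v) <= K ->
  (u%:E + 2%:E * x <= 2%:E * y + (K + v)%:E)%E.
Proof.
case: y => [y| |] x0 y0 //; last by rewrite gt0_muley ?lte_fin // addye // => _ _; rewrite leey.
case: x x0 => [x| |] x0 //.
by rewrite -EFinM -!EFinD !lee_fin => h1 h2; lra.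
Qed.

Let rate_step : 0 <= Num.sqrt t%:R / c <= eta^-1 /\
  eta^-1 - Num.sqrt t%:R / c <= eta / c ^+ 2.
Proof.
have e : eta^-1 = Num.sqrt t.+1%:R / c by rewrite /learning_rate invf_div.
have s0 := sqrtr_ge0 (t%:R : R).
rewrite e divr_ge0 ?(ltW c0) //= ler_pM2r ?invr_gt0 // ler_wsqrtr ?ler_nat //; split=> //.
rewrite -mulrBl (_ : eta / c ^+ 2 = (Num.sqrt t.+1%:R)^-1 / c).
  by rewrite ler_pM2r ?invr_gt0 //; exact: sqrt_diff_le.
have : Num.sqrt t.+1%:R != 0 :> R by rewrite gt_eqF // sqrtr_gt0.
rewrite /learning_rate; move: (Num.sqrt _) => s sn; field.
by rewrite sn gt_eqF.
Qed.

Let step_bound (al be : 'I_d -> R) (e S : R) : 0 <= e -> (forall i, 0 <= al i) -> (forall i, 0 <= be i) ->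
  (forall i x, 0 <= x ->
     p i - selp (pert X 0%N) m (fun j => lam j + (if j == i then eta * x else 0)) i
       <= al i * x + be i * x ^+ 3) ->
  \sum_i (2 * al i / p i + 24 * be i / p i ^+ 3) <= S ->
  (pot eta^-1 L <= pot (Num.sqrt t%:R / c) L + ((eta^-1 - Num.sqrt t%:R / c) * e)%:E)%E ->
  ((\sum_i mu i * p i)%:E + next_pot <=
   pot (Num.sqrt t%:R / c) L + (eta / c ^+ 2 * e + S + \sum_(i | astar i) mu i)%:E)%E.
Proof.
move=> e0 al0 be0 H HS Hpot.
apply: le_trans (round_loss md model c0 astarA al0 be0 H) _.
apply: le_trans (leeD Hpot (lexx _)) _.
rewrite -addeA leeD2l // -EFinD lee_fin.
have := ler_wpM2r e0 (proj2 rate_step); move: HS; move: (\sum_(i < d) _) => s1; lra.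
Qed.

Let diff_bound i x f : 0 <= x ->
  (Ex P (fun w => invmax (level (pert X 0%N) m lam i w) ^+ 3)%R <= f%:E)%E ->
  p i - selp (pert X 0%N) m (fun j => lam j + (if j == i then eta * x else 0)) i
    <= 6 * eta * f * x + 0 * x ^+ 3.
Proof.
move=> x0 hf.
have ex0 : 0 <= eta * x by rewrite mulr_ge0 // ltW.
have e1 : lam i + (if i == i then eta * x else 0) = lam i + eta * x by rewrite eqxx.
have e2 j : j != i -> lam j + (if j == i then eta * x else 0) = lam j.
  by move=> /negbTE ->; rewrite addr0.
have h := selp_diff_le ind0 law0 md
  (lam' := fun j => lam j + (if j == i then eta * x else 0)) ex0 e1 e2.
have : ((p i)%:E <= (selp (pert X 0%N) m (fun j => lam j + (if j == i then eta * x else 0)) i +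
    6 * (eta * x) * f)%R%:E)%E.
  apply: le_trans h _; rewrite EFinD leeD2l // [in leRHS]EFinM lee_wpmul2l // lee_fin.
  by rewrite mulr_ge0.
rewrite lee_fin; lra.
Qed.

(** [Ex_invmax3_le] bounds the stability of each arm by a multiple of an inverse root, and
    [sum_inv_sqrt_rank] sums these to [sqrt d]; the penalty is that of [pot_step_crude] with
    [s = sqrt d]. *)
Lemma crude_step : ((\sum_i mu i * p i)%:E + next_pot <=
   pot (Num.sqrt t%:R / c) L + (crude_cst c * eta * M / 2 + \sum_(i | astar i) mu i)%:E)%E.
Proof.
pose e i : R := 2 ^+ 21 * (m%:R * Num.sqrt m%:R) /
  Num.sqrt #|[set j | (j != i) && (lam j <= lam i)]%SET|.+1%:R.
have e0 i : 0 <= e i by rewrite divr_ge0 ?sqrtr_ge0 // mulr_ge0 ?exprn_ge0 // mulr_ge0 ?sqrtr_ge0.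
have d0 : (0 < d)%N by case/andP: md => _; exact: leq_trans.
have sd1 : 1 <= Num.sqrt (d%:R : R) by rewrite -[leLHS]sqrtr1 ler_wsqrtr // ler1n.
have sm1 : 1 <= Num.sqrt (m%:R : R) by rewrite -[leLHS]sqrtr1 ler_wsqrtr // ler1n.
have m1 : 1 <= m%:R :> R by rewrite ler1n.
have ME : M = m%:R * Num.sqrt m%:R * Num.sqrt d%:R by [].
have dE : Num.sqrt d%:R * Num.sqrt d%:R = d%:R :> R by rewrite -expr2 sqr_sqrtr.
pose C : R := 2 ^+ 21.
have C0 : 0 <= C by rewrite exprn_ge0.
have pen : m%:R * Num.sqrt d%:R + 5 * d%:R / Num.sqrt d%:R <= 6 * M.
  have q : d%:R / Num.sqrt d%:R = Num.sqrt d%:R :> R.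
    by rewrite -[X in X / _]dE mulfK // gt_eqF // (lt_le_trans ltr01).
  rewrite -mulrA q ME; move: sd1 sm1; move: (Num.sqrt d%:R) (Num.sqrt m%:R) => x y x1 y1.
  have h1 : m%:R * x <= m%:R * y * x by rewrite ler_pM2r ?(lt_le_trans ltr01) // ler_peMr.
  have h2 : x <= m%:R * x by rewrite ler_peMl // (le_trans ler01).
  lra.
have [b01 bstep] := rate_step.
have cc0 : 0 < c ^+ 2 by rewrite exprn_gt0.
pose pen0 := m%:R * Num.sqrt d%:R + 5 * d%:R / Num.sqrt d%:R : R.
have pen00 : 0 <= pen0 by rewrite addr_ge0 // ?divr_ge0 ?mulr_ge0 ?sqrtr_ge0.
have S : \sum_i (2 * (6 * eta * (e i * p i)) / p i + 24 * 0 / p i ^+ 3) <= 24 * C * eta * M.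
  rewrite (eq_bigr (fun i => (12 * eta * (C * (m%:R * Num.sqrt m%:R))) *
    (Num.sqrt #|[set j | (j != i) && (lam j <= lam i)]%SET|.+1%:R)^-1)) => [|i _]; last first.
    have := lt0r_neq0 (p_gt0 i); rewrite /e -/C; move: (p i) (_^-1) => q s q0.
    rewrite mulr0 mul0r addr0; field.
    by [].
  rewrite -mulr_sumr; apply: le_trans (ler_wpM2l _ (sum_inv_sqrt_rank _)) _.
    by rewrite !mulr_ge0 ?sqrtr_ge0 // ltW.
  by rewrite ME le_eqVlt; apply/orP; left; apply/eqP; ring.
have H i x : 0 <= x ->
     p i - selp (pert X 0%N) m (fun j => lam j + (if j == i then eta * x else 0)) i
       <= 6 * eta * (e i * p i) * x + 0 * x ^+ 3.
  by move=> x0; apply: diff_bound => //; exact: (Ex_invmax3_le ind0 law0 md lam i).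
have al0 i : 0 <= 6 * eta * (e i * p i).
  by rewrite mulr_ge0 ?mulr_ge0 // ltW.
have pc : (pot eta^-1 L <= pot (Num.sqrt t%:R / c) L + ((eta^-1 - Num.sqrt t%:R / c) * pen0)%:E)%E.
  by apply: (pot_step_crude law0 md astarA L b01 _ sd1); rewrite invr_gt0.
apply: le_trans (step_bound pen00 al0 (fun=> lexx 0) H S pc) _.
rewrite leeD2l // lee_fin lerD2r.
have : eta / c ^+ 2 * pen0 <= eta / c ^+ 2 * (6 * M) by rewrite ler_wpM2l // divr_ge0 // ltW.
have -> : crude_cst c * eta * M / 2 = eta / c ^+ 2 * (6 * M) + 24 * C * eta * M.
  by rewrite /crude_cst -/C; move: (c ^+ 2) cc0 (C) => cc cc1 C'; field; rewrite gt_eqF.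
by rewrite lerD2r.
Qed.

Lemma gap_step (j0 : 'I_d) (g := fun k => invmax (lam k - lam j0)) : astar j0 ->
  (forall j, astar j -> lam j <= lam j0) ->
  \sum_(k | ~~ astar k) g k ^+ 2 <= 1 / 2 ->
  ((\sum_i mu i * p i)%:E + next_pot <=
   pot (Num.sqrt t%:R / c) L + (24 * eta * \sum_(k | ~~ astar k) g k +
     6 * (8 + 384 * c ^+ 2) * m%:R * eta * \sum_(k | ~~ astar k) g k ^+ 2 +
     eta / c ^+ 2 * (5 * \sum_(k | ~~ astar k) g k) + \sum_(i | astar i) mu i)%:E)%E.
Proof.
move=> aj0 jmax; set G := \sum_(k | ~~ astar k) g k ^+ 2 => G2.
have notA k : (k \notin A) = ~~ astar k by rewrite inE.
have lamA j : j \in A -> lam j <= lam j0 by rewrite inE; exact: jmax.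
have GE : \sum_(k | k \notin A) invmax (lam k - lam j0) ^+ 2 = G.
  by apply: eq_bigl => k; rewrite notA.
have g0 k : 0 <= g k by exact: invmax_ge0.
have G0 : 0 <= G by rewrite sumr_ge0 // => k _; rewrite exprn_ge0.
have [b01 bstep] := rate_step.
have etac : eta <= c.
  rewrite /learning_rate ler_pdivrMr ?sqrtr_gt0 ?ltr0n // ler_peMr ?(ltW c0) //.
  by rewrite -[leLHS]sqrtr1 ler_wsqrtr // ler1n.
have eta2 : eta ^+ 2 <= c ^+ 2 by rewrite lerXn2r ?nnegrE // ltW.
pose al i : R := if astar i then 12 * eta * G else 6 * eta * (2 * g i * p i).
pose be i : R := if astar i then 12 * eta ^+ 3 * G else 0.
have al0 i : 0 <= al i.
  by rewrite /al; case: ifP => _; rewrite !mulr_ge0 // ltW.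
have be0 i : 0 <= be i by rewrite /be; case: ifP => _ //; rewrite !mulr_ge0 ?exprn_ge0 // ltW.
have H i x : 0 <= x ->
     p i - selp (pert X 0%N) m (fun j => lam j + (if j == i then eta * x else 0)) i
       <= al i * x + be i * x ^+ 3.
  move=> x0; rewrite /al /be; case: ifPn => ai; last first.
    by apply: diff_bound => //; apply: (Ex_invmax3_out ind0 law0 md cA _ lamA); rewrite notA.
  have ex0 : 0 <= eta * x by rewrite mulr_ge0 // ltW.
  have iA : i \in A by rewrite inE.
  have e1 : lam i + (if i == i then eta * x else 0) = lam i + eta * x by rewrite eqxx.
  have e2 j : j != i -> lam j + (if j == i then eta * x else 0) = lam j.
    by move=> /negbTE ->; rewrite addr0.
  have := selp_in_diff ind0 law0 md (lam' := fun j => lam j + (if j == i then eta * x else 0)) ex0 e1 e2 cA iA lamA.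
  rewrite GE => h; apply: le_trans h _.
  move: x0 ex0; move: (eta) (G) G0 (ltW eta0) => h G' G0' h0 x0 ex0.
  rewrite -subr_ge0.
  (* [(1 + h x)^2 = 2 (1 + (h x)^2) - (1 - h x)^2], so a linear and a cubic term suffice. *)
  have -> : 12 * h * G' * x + 12 * h ^+ 3 * G' * x ^+ 3 - 6 * (h * x) * ((1 + h * x) ^+ 2 * G') =
     6 * (h * x) * G' * (1 - h * x) ^+ 2 by ring.
  apply: mulr_ge0; last exact: sqr_ge0.
  by apply: mulr_ge0 => //; apply: mulr_ge0.
(* Here [G <= 1 / 2] is used: it bounds the inverse probabilities on [astar]. *)
have p_half i : astar i -> 1 / 2 <= p i.
  move=> ai; have iA : i \in A by rewrite inE.
  have := selp_in_ge law0 cA iA lamA; rewrite GE; lra.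
have S : \sum_i (2 * al i / p i + 24 * be i / p i ^+ 3) <=
   24 * eta * \sum_(k | ~~ astar k) g k + 6 * (8 + 384 * c ^+ 2) * m%:R * eta * G.
  rewrite (bigID astar) /= addrC; apply: lerD.
    rewrite mulr_sumr; apply: ler_sum => k /negbTE ka; rewrite /al /be ka.
    have := lt0r_neq0 (p_gt0 k); move: (p k) (g k) => q s q0.
    rewrite mulr0 mul0r addr0 le_eqVlt; apply/orP; left; apply/eqP; field.
    by [].
  rewrite (_ : 6 * _ * _ * _ * G = \sum_(i | astar i) 6 * (8 + 384 * c ^+ 2) * eta * G); last first.
    rewrite sumr_const (_ : #|_| = m); last by rewrite -cA; apply: eq_card => i; rewrite !inE.
    by rewrite -[RHS]mulr_natr; ring.
  (* With [p i >= 1 / 2] and [eta <= c], the constants are [2 * 12 * 2 = 6 * 8] and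
     [24 * 12 * 8 = 6 * 384]. *)
  apply: ler_sum => i ai; rewrite /al /be ai.
  have ph := p_half i ai; have pi := p_gt0 i.
  have v2 : (p i)^-1 <= 2 by rewrite -[leRHS]invrK lef_pV2 ?posrE ?invr_gt0 //; lra.
  have v0 : 0 < (p i)^-1 by rewrite invr_gt0.
  rewrite -exprVn; move: ((p i)^-1) v2 v0 => v v2 v0.
  have v3 : v ^+ 3 <= 8.
    rewrite (_ : 8 = 2 ^+ 3 :> R); last ring.
    by rewrite lerXn2r ?nnegrE // ltW.
  have h1 : 2 * (12 * eta * G) * v <= 2 * (12 * eta * G) * 2.
    by rewrite ler_wpM2l // !mulr_ge0 // ltW.
  have h2 : 24 * (12 * eta ^+ 3 * G) * v ^+ 3 <= 24 * (12 * eta ^+ 3 * G) * 8.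
    by rewrite ler_wpM2l // !mulr_ge0 ?exprn_ge0 // ltW.
  have h3 : eta * G * eta ^+ 2 <= eta * G * c ^+ 2.
    by rewrite ler_wpM2l // mulr_ge0 // ltW.
  move: h1 h2 h3; move: (eta) (G) (c) (v ^+ 3) => h G' c' w.
  rewrite !exprS !expr0; lra.
have Sg0 : 0 <= 5 * \sum_(k | ~~ astar k) g k by rewrite mulr_ge0 // sumr_ge0.
have pc : (pot eta^-1 L <= pot (Num.sqrt t%:R / c) L +
    ((eta^-1 - Num.sqrt t%:R / c) * (5 * \sum_(k | ~~ astar k) g k))%:E)%E.
  have lamB j : astar j -> L j / eta^-1 <= lam j0 by move=> aj; rewrite invrK mulrC; exact: jmax.
  have eta1 : 0 < eta^-1 by rewrite invr_gt0.
  have := pot_step_gap ind0 law0 md astarA b01 eta1 lamB.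
  rewrite [\sum_(k | _) _](_ : _ = 5 * \sum_(k | ~~ astar k) g k) //.
  by rewrite mulr_sumr; apply: eq_bigr => k _; rewrite invrK [L k * _]mulrC.
apply: le_trans (step_bound Sg0 al0 be0 H S pc) _.
rewrite leeD2l // lee_fin lerD2r; lra.
Qed.

Lemma round_step :
  ((\sum_i mu i * p i)%:E + 2%:E * next_pot <=
   2%:E * pot (Num.sqrt t%:R / c) L + (round_cost + \sum_(i | astar i) mu i)%:E)%E.
Proof.
have next0 : (0 <= next_pot)%E by apply: integral_ge0 => w _; exact: pot_ge0.
have pot0' : (0 <= pot (Num.sqrt t%:R / c) L)%E by exact: pot_ge0.
have Delta_gt0 k : ~~ astar k -> 0 < Delta k by move=> /DeltaD; exact: lt_le_trans.
have sD : 0 <= \sum_(k | ~~ astar k) Delta k * p k.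
  by apply: sumr_ge0 => k ka; rewrite mulr_ge0 // ltW // Delta_gt0.
have rho := regret_selp_ge.
rewrite /round_cost; case: ltP => [_|large].
  have step := double_step next0 pot0' crude_step; apply: step.
  move: rho sD; set x := crude_cst c * eta * M; lra.
have s0 : 0 < Num.sqrt t.+1%:R :> R by rewrite sqrtr_gt0.
have m1 : 1 <= m%:R :> R by rewrite ler1n.
have d1 : 1 <= d%:R :> R by rewrite ler1n; case/andP: md => _; exact: leq_trans.
have mM : m%:R <= M.
  have sm1 : 1 <= Num.sqrt (m%:R : R) by rewrite -[leLHS]sqrtr1 ler_wsqrtr.
  have sd1 : 1 <= Num.sqrt (d%:R : R) by rewrite -[leLHS]sqrtr1 ler_wsqrtr.
  by rewrite /M /size_cst -mulrA ler_peMr // ?(le_trans ler01) // mulr_ege1.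
have M0 : 0 <= M by apply: le_trans mM; rewrite ler0n.
have cc0 : 0 <= c ^+ 2 by rewrite exprn_ge0 // ltW.
have cr0 := crude_cst_ge0 c0.
pose q := 8 + 384 * c ^+ 2.
have q0 : 0 <= q by rewrite /q; lra.
have eM0 : 0 <= eta * M by rewrite mulr_ge0 // ltW.
(* [large] amounts to [eta * switch_cst c * M <= c * Dmin]; the summand [2] of [switch_cst] is given
   up and [c] divided out. *)
have small : eta * M * (50 * crude_cst c + 1152 * q) <= Dmin.
  rewrite -(ler_pM2l c0).
  have h : eta * (switch_cst c * M) <= c * Dmin.
    move: large; rewrite ler_pdivrMr // => h; have := ler_wpM2l (ltW eta0) h.
    rewrite /learning_rate mulrA [in X in _ <= X -> _](_ : c / Num.sqrt t.+1%:R * (Num.sqrt t.+1%:R * Dmin) = c * Dmin).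
      by rewrite -mulrA.
    by rewrite mulrA mulfVK // gt_eqF.
  apply: le_trans h; rewrite /switch_cst -/q.
  move: eM0; move: (crude_cst c) (eta) M => x y z; lra.
have smallc : crude_cst c * eta * M <= Dmin / 50.
  have h : 0 <= eta * M * (1152 * q) by exact (mulr_ge0 eM0 (mulr_ge0 (ler0n _ _) q0)).
  move: small h; move: (crude_cst c) (eta) M => x y z; lra.
have smallm : 12 * q * m%:R * eta <= Dmin / 96.
  have h : 0 <= eta * M * (50 * crude_cst c) by exact (mulr_ge0 eM0 (mulr_ge0 (ler0n _ _) cr0)).
  have h2 : eta * q * m%:R <= eta * q * M by rewrite ler_wpM2l // mulr_ge0 // ltW.
  move: small h h2; move: (crude_cst c) (eta) M (m%:R : R) => x y z u; lra.
have [i1 i1A] : exists i, i \in A by apply/card_gt0P; rewrite cA.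
case: (@arg_maxP _ R _ i1 (fun j => j \in A) lam i1A) => j0 j0A jmax.
have aj0 : astar j0 by rewrite inE in j0A.
have jmaxA j : astar j -> lam j <= lam j0 by move=> aj; apply: jmax; rewrite inE.
have sumA (f : 'I_d -> R) : \sum_(k | k \notin A) f k = \sum_(k | ~~ astar k) f k.
  by apply: eq_bigl => k; rewrite inE.
have [G2|/ltW G2] := lerP (\sum_(k | ~~ astar k) invmax (lam k - lam j0) ^+ 2) (1 / 2).
  have step := double_step next0 pot0' (gap_step aj0 jmaxA G2); apply: step.
  apply: le_trans (lerB (lexx _) rho) _.
  apply: (gap_tradeoff Dmin0 DeltaD (g := fun k => invmax (lam k - lam j0))) => //.
  - exact: ltW.
  - by move=> k; exact: invmax_ge0.
  - by move=> k ka; apply: (selp_out_ge ind0 law0 cA j0A); rewrite ?sumA ?inE.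
(* In this case the regret of the round is at least [Dmin / 50], which pays for the whole crude
   cost. *)
have step := double_step next0 pot0' crude_step; apply: step.
have big : 1 / 50 <= \sum_(k | ~~ astar k) p k.
  by rewrite -sumA; apply: (sum_selp_out_ge ind0 law0 cA j0A); rewrite sumA.
have rhoD : Dmin * \sum_(k | ~~ astar k) p k <= \sum_(k | ~~ astar k) Delta k * p k.
  by rewrite mulr_sumr; apply: ler_sum => k ka; rewrite ler_pM2r // DeltaD.
have K0 : 0 <= gap_cst c * eta ^+ 2 * \sum_(k | ~~ astar k) (Delta k)^-1.
  rewrite mulr_ge0 //; last by apply: sumr_ge0 => k ka; rewrite invr_ge0 ltW // Delta_gt0.
  by rewrite mulr_ge0 ?sqr_ge0 // /gap_cst mulr_ge0 ?sqr_ge0.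
apply: le_trans K0; have := ler_wpM2l (ltW Dmin0) big.
move: smallc rho rhoD; set x := crude_cst c * eta * M; lra.
Qed.

End RoundStep.

(** * Summing over the rounds *)

Section JointMeasurability.
Context {R : realType} {disp : measure_display} {Om : measurableType disp}.
Variable P : probability Om R.
Variables (d m : nat) (sch : resampling d) (X : randomness P d) (c : R) (t : nat).
Context d' (T : measurableType d').
Variables (L : 'I_d -> T -> R) (ev : T -> Om).
Hypothesis mL : forall j, measurable_fun setT (L j).
Hypothesis mpert : forall j, measurable_fun setT (fun z => pert X t j (ev z)).
Hypothesis mloss : forall j, measurable_fun setT (fun z => tnth (loss X t (ev z)) j).
Hypothesis mrepert : forall s j, measurable_fun setT (fun z => repert X t s j (ev z)).
Hypothesis mtheta : forall s, measurable_fun setT (fun z => theta X t s (ev z)).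

(** [ev] is the identity when [T] is [Om], and the second projection when the estimate is a
    separate, frozen component. *)
Lemma measurable_play_joint i :
  measurable_fun setT (fun z => play m c (realize X (ev z)) t (L ^~ z) i).
Proof.
apply: (@measurable_argmin_action R _ T d m
  (fun j z => learning_rate c t * L j z - pert X t j (ev z))) => j.
by apply: measurable_funB => //; exact: measurable_funM.
Qed.

Lemma measurable_estimate_joint i :
  measurable_fun setT (fun z => loss_estimate m sch X c t (L ^~ z) i (ev z)).
Proof.
apply: measurable_funM; last exact: (measurable_inv_weight m mL sch (learning_rate c t) i mrepert mtheta).
by apply: measurable_funM => //; apply: measurable_natb; exact: measurable_play_joint.
Qed.

End JointMeasurability.

(** * Freezing the past and telescoping the potential *)

Section Telescoping.
Context {R : realType} {disp : measure_display} {Om : measurableType disp}.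
Variable P : probability Om R.
Variables (d m : nat) (D : perturbation) (sch : resampling d).
Variables (nu : probability (d.-tuple R) R) (X : randomness P d).
Hypothesis md : (0 < m < d)%N.
Hypothesis model : stochastic_model m D sch nu X.
Variable c : R.
Hypothesis c0 : 0 < c.
Variable astar : {ffun 'I_d -> bool}.
Hypothesis astarA : is_action m astar.
Variables Mst Dmin : R.
Local Notation mu := (mean_loss nu).
Hypothesis muM : forall j, astar j -> mu j <= Mst.
Hypothesis Dmin0 : 0 < Dmin.
Hypothesis DeltaD : forall k, ~~ astar k -> Dmin <= mu k - Mst.
Implicit Types (i j k : 'I_d) (t : nat).

Local Notation src A := (srcT (source_sigma X) A).
Local Notation pot := (pot (pert X 0%N) m astar).
Let ind := model_indep model.

Definition estimate t w := cum_loss_estimate m sch c (realize X w) t.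

Lemma estimateS t w : estimate t.+1 w =
  fun i => estimate t w i + loss_estimate m sch X c t (estimate t w) i w.
Proof. by []. Qed.

Lemma measurable_estimate t i :
  measurable_fun setT ((fun w => estimate t w i) : src (past t) -> R).
Proof.
elim: t i => [|t IH] i; first exact: measurable_cst.
have IH' j : measurable_fun setT ((fun w => estimate t w j) : src (past t.+1) -> R).
  apply: srcTS (IH j); rewrite /past => -[[[u|[u k]]|[[u s] k]]|[u s]] /=; exact: ltnW.
apply: (@measurable_funD _ (src (past t.+1))); first exact: IH'.
apply: (@measurable_estimate_joint R _ Om P d m sch X c t _ (src (past t.+1))
  (fun j w => estimate t w j) (fun w => w)) => //.
- by move=> j; apply: measurable_pert; rewrite /past /=.
- by move=> j; apply: measurable_loss; rewrite /past /=.
- by move=> s j; apply: measurable_repert; rewrite /past /=.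
- by move=> s; apply: measurable_theta; rewrite /past /=.
Qed.

Let mest t i : measurable_fun setT (fun w => estimate t w i).
Proof. exact: source_measurable_fun (measurable_estimate (t:=t) i). Qed.

Definition incurred t (L : 'I_d -> R) w : R :=
  \sum_i (play m c (realize X w) t L i)%:R * tnth (loss X t w) i.

Lemma incurred_ge0 t L w : 0 <= incurred t L w.
Proof.
by apply: sumr_ge0 => i _; rewrite mulr_ge0 //; case/andP: (model_loss01 model t w i).
Qed.

(** [beta t.+1] is the inverse learning rate of round [t], and [beta 0 = 0] makes the initial
    potential vanish. *)
Let beta t : R := Num.sqrt t%:R / c.
Let vst := \sum_(i | astar i) mu i.

Local Notation cost t := (round_cost m nu c t astar Mst Dmin).

Let cost_vst_ge0 t : 0 <= cost t + vst.
Proof.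
rewrite addr_ge0 //; last first.
  by apply: sumr_ge0 => i _; case/andP: (mean_loss01 model i).
have eta0 := learning_rate_gt0 t c0.
rewrite /round_cost; case: ifP => _.
  apply: mulr_ge0; last by rewrite /size_cst !mulr_ge0 ?sqrtr_ge0.
  by apply: mulr_ge0; [exact: crude_cst_ge0|exact: ltW].
apply: mulr_ge0; first by rewrite mulr_ge0 ?sqr_ge0 // mulr_ge0 ?sqr_ge0.
apply: sumr_ge0 => k /DeltaD h; rewrite invr_ge0; exact: le_trans (ltW Dmin0) h.
Qed.

Lemma integral_add2 (f : Om -> R) (g : Om -> \bar R) :
  measurable_fun setT f -> (forall w, 0 <= f w) ->
  measurable_fun setT g -> (forall w, (0 <= g w)%E) ->
  (\int[P]_w ((f w)%:E + 2%:E * g w) = Ex P f + 2%:E * \int[P]_w g w)%E.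
Proof.
move=> mf f0 mg g0; rewrite ge0_integralD //; first by rewrite ge0_integralZl.
- by move=> w _; rewrite lee_fin.
- exact/measurable_EFinP.
- by move=> w _; rewrite mule_ge0.
- exact: measurable_funeM.
Qed.

Lemma frozen_step t L :
  (\int[P]_w ((incurred t L w)%:E + 2%:E *
     pot (learning_rate c t)^-1 (fun i => (L i + loss_estimate m sch X c t L i w)%R)) <=
   2%:E * pot (beta t) L + (cost t + vst)%:E)%E.
Proof.
have mpot : measurable_fun setT (fun w => pot (learning_rate c t)^-1
    (fun i => (L i + loss_estimate m sch X c t L i w)%R)).
  apply: (@measurable_pot R _ _ P d m _ astar md astarA _ _
    (fun i w => L i + loss_estimate m sch X c t L i w)) => j.
  by apply: measurable_funD => //; exact: measurable_loss_estimate.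
have pot0' b K : (0 <= pot b K)%E by exact: pot_ge0.
have mterm i : measurable_fun setT (fun w => (play m c (realize X w) t L i)%:R * tnth (loss X t w) i).
  apply: (@source_measurable_fun _ _ _ P _ X _ _ setT).
  apply: (@measurable_funM _ (src setT)); last exact: measurable_loss.
  by apply: (@measurable_natb R _ (src setT)); exact: measurable_play.
have term0 i w : 0 <= (play m c (realize X w) t L i)%:R * tnth (loss X t w) i.
  by rewrite mulr_ge0 //; case/andP: (model_loss01 model t w i).
have minc : measurable_fun setT (incurred t L).
  exact: (@measurable_bigsum R _ _ _ _ xpredT).
rewrite (integral_add2 minc (incurred_ge0 t L) mpot (fun=> pot0' _ _)).
have -> : (Ex P (incurred t L) = (\sum_i mu i *
    selp (pert X 0%N) m (fun j => learning_rate c t * L j) i)%:E)%E.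
  rewrite Ex_sum // -sumEFin; apply: eq_bigr => i _.
  by rewrite (Ex_played_loss md model) mulrC.
exact: (round_step md model t L c0 astarA muM Dmin0 DeltaD).
Qed.

(* The current estimate depends on past rounds only, hence it can be frozen while
   integrating over the sources of the present round. *)
Lemma one_round t :
  (Ex P (fun w => incurred t (estimate t w) w) +
     2%:E * \int[P]_w pot (beta t.+1) (estimate t.+1 w) <=
   2%:E * \int[P]_w pot (beta t) (estimate t w) + (cost t + vst)%:E)%E.
Proof.
pose tup w : d.-tuple R := [tuple estimate t w i | i < d].
have tupE w : tnth (tup w) = estimate t w by apply/funext => i; rewrite tnth_mktuple.
have betaS : beta t.+1 = (learning_rate c t)^-1 by rewrite /learning_rate invf_div.
(* The outcome is typed in [src (now t)]: measurability of [h] then certifies that, given the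
   estimate, the round reads present sources only. *)
pose h (z : d.-tuple R * src (now t)) : \bar R := ((incurred t (tnth z.1) z.2)%:E + 2%:E *
   pot (learning_rate c t)^-1 (fun i => (tnth z.1 i + loss_estimate m sch X c t (tnth z.1) i z.2)%R))%E.
have pot0' b K : (0 <= pot b K)%E by exact: pot_ge0.
have h0 z : (0 <= h z)%E.
  by rewrite adde_ge0 ?mule_ge0 // lee_fin incurred_ge0.
have msnd d'' (U : measurableType d'') (f : Om -> U) :
    measurable_fun setT (f : src (now t) -> U) ->
    measurable_fun setT (fun z : d.-tuple R * src (now t) => f z.2).
  by move=> mf; apply: (measurableT_comp mf).
have mfst j : measurable_fun setT (fun z : d.-tuple R * src (now t) => tnth z.1 j).
  by apply: (measurableT_comp (measurable_tnth j)).
have mpert j : measurable_fun setT (fun z : d.-tuple R * src (now t) => pert X t j z.2).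
  by apply: (msnd _ _ (pert X t j)); apply: measurable_pert; rewrite /now /=.
have mloss j : measurable_fun setT (fun z : d.-tuple R * src (now t) => tnth (loss X t z.2) j).
  by apply: (msnd _ _ (fun w => tnth (loss X t w) j)); apply: measurable_loss; rewrite /now /=.
have mrepert s j : measurable_fun setT (fun z : d.-tuple R * src (now t) => repert X t s j z.2).
  by apply: (msnd _ _ (repert X t s j)); apply: measurable_repert; rewrite /now /=.
have mtheta s : measurable_fun setT (fun z : d.-tuple R * src (now t) => theta X t s z.2).
  by apply: (msnd _ _ (theta X t s)); apply: measurable_theta; rewrite /now /=.
have mh : measurable_fun setT h.
  apply: emeasurable_funD.
    apply/measurable_EFinP.
    apply: (@measurable_bigsum R _ _ _ _ xpredT (fun i (z : d.-tuple R * src (now t)) =>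
      (play m c (realize X z.2) t (tnth z.1) i)%:R * tnth (loss X t z.2) i)) => i.
    apply: measurable_funM => //; apply: measurable_natb.
    exact: (measurable_play_joint m c mfst mpert i).
  apply: measurable_funeM.
  apply: (@measurable_pot R _ _ P d m _ astar md astarA _ _
    (fun i (z : d.-tuple R * src (now t)) => tnth z.1 i + loss_estimate m sch X c t (tnth z.1) i z.2)) => j.
  apply: measurable_funD => //.
  exact: (measurable_estimate_joint m sch c mfst mpert mloss mrepert mtheta j).
have freeze := integral_src (@source_measurable _ _ _ P d X) (@sourceT _ _ _ P d X) (@sourceI _ _ _ P d X) ind
  (A := past t) (B := now t) (X := tup) (Y := fun w => w : src (now t)) (h := h) _ _ _ mh h0.
have {freeze}freeze : (\int[P]_w h (tup w, w) = \int[P]_w \int[P]_w' h (tup w, w'))%E.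
  apply: freeze.
  - apply/seteqP; split => // -[[[u|[u j]]|[[u s] j]]|[u s]] /= [] + /eqP e; by rewrite e ltnn.
  - apply/measurable_fun_tnthP => i; rewrite (_ : _ \o _ = fun w => estimate t w i).
      exact: measurable_estimate.
    by apply/funext => w /=; rewrite tnth_mktuple.
  - exact: measurable_id.
have inc_est_measurable : measurable_fun setT (fun w => incurred t (estimate t w) w).
  have mO d'' (U : measurableType d'') (f : Om -> U) :
      measurable_fun setT (f : src setT -> U) -> measurable_fun setT f.
    exact: source_measurable_fun.
  apply: (@measurable_bigsum R _ _ _ _ xpredT (fun i w =>
      (play m c (realize X w) t (estimate t w) i)%:R * tnth (loss X t w) i)) => i.
  apply: measurable_funM; last by apply: (mO _ _ (fun w => tnth (loss X t w) i)); exact: measurable_loss.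
  apply: measurable_natb.
  by apply: (@measurable_play_joint R _ Om P d m X c t _ Om (fun j w => estimate t w j) (fun w => w)).
have pot_est_measurable s : measurable_fun setT (fun w => pot (beta s) (estimate s w)).
  exact: (@measurable_pot R _ _ P d m _ astar md astarA _ _ (fun i w => estimate s w i)).
have -> : (Ex P (fun w => incurred t (estimate t w) w) +
     2%:E * \int[P]_w pot (beta t.+1) (estimate t.+1 w) = \int[P]_w h (tup w, w))%E.
  rewrite -(integral_add2 inc_est_measurable _ (pot_est_measurable t.+1)) => [|w|w].
  - by apply: eq_integral => w _; rewrite /h tupE betaS estimateS.
  - exact: incurred_ge0.
  - exact: pot_ge0.
rewrite freeze.
have -> : (2%:E * \int[P]_w pot (beta t) (estimate t w) + (cost t + vst)%:E =
    \int[P]_w ((cost t + vst)%:E + 2%:E * pot (beta t) (estimate t w)))%E.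
  rewrite (integral_add2 (measurable_cst _) (fun=> cost_vst_ge0 t) (pot_est_measurable t)).
    by rewrite Ex_cst addeC.
  by move=> w; exact: pot_ge0.
(* Back to the full sigma-algebra of [Om], on which [P] lives, for Tonelli's theorem. *)
have mid : measurable_fun setT (fun w : Om => w : src (now t)).
  move=> _ Y mY; rewrite setTI; exact: (sub_sources_measurable (@source_measurable _ _ _ P d X) mY).
have mh' : measurable_fun setT (fun z : d.-tuple R * Om => h (z.1, z.2 : src (now t))).
  apply: (measurableT_comp mh); apply: measurable_fun_pair; first exact: measurable_fst.
  exact (measurableT_comp mid (@measurable_snd _ _ (d.-tuple R) Om)).
have mF := @measurable_fun_fubini_tonelli_F _ _ (d.-tuple R) Om R P _ mh' (fun z => h0 _).
have mtup : measurable_fun setT tup.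
  apply/measurable_fun_tnthP => i; rewrite (_ : _ \o _ = fun w => estimate t w i) //.
  by apply/funext => w /=; rewrite tnth_mktuple.
have mR : measurable_fun setT (fun w => ((cost t + vst)%:E + 2%:E * pot (beta t) (estimate t w))%E).
  apply: emeasurable_funD; first exact: measurable_cst.
  by apply: measurable_funeM; exact: pot_est_measurable.
have step w : (\int[P]_w' h (tup w, w') <=
    (cost t + vst)%:E + 2%:E * pot (beta t) (estimate t w))%E.
  have hs := frozen_step t (tnth (tup w)).
  by apply: (le_trans hs); rewrite tupE addeC.
have mL : measurable_fun setT (fun w => \int[P]_w' h (tup w, w'))%E.
  exact: (measurableT_comp mF mtup).
apply: ge0_le_integral.
- exact: measurableT.
- by move=> w _; apply: integral_ge0 => w' _; exact: h0.
- exact: mL.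
- exact: mR.
- by move=> w _; exact: step.
Qed.

Lemma total_incurred_le T :
  (\sum_(t < T) Ex P (fun w => incurred t (estimate t w) w) <=
   (\sum_(t < T) (cost t + vst))%:E)%E.
Proof.
suff : (\sum_(t < T) Ex P (fun w => incurred t (estimate t w) w) +
    2%:E * \int[P]_w pot (beta T) (estimate T w) <= (\sum_(t < T) (cost t + vst))%:E)%E.
  apply: le_trans; rewrite leeDl // mule_ge0 // integral_ge0 // => w _; exact: pot_ge0.
elim: T => [|T IH].
  rewrite !big_ord0 add0e (_ : \int[P]_w _ = 0)%E ?mule0 //.
  rewrite -[RHS](integral0 P setT); apply: eq_integral => w _.
  by rewrite /beta sqrtr0 mul0r pot0.
rewrite !big_ord_recr /= -addeA.
apply: le_trans (leeD (lexx _) (one_round T)) _.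
by rewrite addeA [in leRHS]EFinD; apply: leeD.
Qed.

End Telescoping.

Section RegretBound.
Context {R : realType} {disp : measure_display} {Om : measurableType disp}.
Variable P : probability Om R.
Variables (d m : nat) (D : perturbation) (sch : resampling d).
Variables (nu : probability (d.-tuple R) R) (X : randomness P d).
Hypothesis md : (0 < m < d)%N.
Hypothesis model : stochastic_model m D sch nu X.
Variable c : R.
Hypothesis c0 : 0 < c.
Variable astar : {ffun 'I_d -> bool}.
Hypothesis astarA : is_action m astar.
Variables Mst Dmin : R.
Local Notation mu := (mean_loss nu).
Hypothesis muM : forall j, astar j -> mu j <= Mst.
Hypothesis Dmin0 : 0 < Dmin.
Hypothesis Dmin1 : Dmin <= 1.
Hypothesis DeltaD : forall k, ~~ astar k -> Dmin <= mu k - Mst.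
Implicit Types (i j k : 'I_d) (t : nat).

Local Notation cost t := (round_cost m nu c t astar Mst Dmin).

(** Learner's and optimal losses are bounded by [d] in each round, so the expectation of the
    difference splits; the optimal part has mean exactly [\sum_(i | astar i) mu i] per round, which
    cancels in [total_incurred_le]. *)
Lemma regret_le_costs T :
  (regret m sch c X astar T <= (\sum_(t < T) cost t)%:E)%E.
Proof.
pose inc t w := incurred m X c t (estimate m sch X c t w) w.
pose best t w := \sum_(i | astar i) tnth (loss X t w) i.
have l01 t w i := model_loss01 model t w i.
have ml t i : measurable_fun setT (fun w => tnth (loss X t w) i).
  by apply: (@source_measurable_fun _ _ _ P _ X _ _ setT); exact: measurable_loss.
have minc t : measurable_fun setT (inc t).
  apply: (@measurable_bigsum R _ _ _ _ xpredT (fun i w =>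
      (play m c (realize X w) t (estimate m sch X c t w) i)%:R * tnth (loss X t w) i)) => i.
  apply: measurable_funM => //; apply: measurable_natb.
  apply: (@measurable_play_joint R _ Om P d m X c t _ Om (fun j w => estimate m sch X c t w j) (fun w => w)) => // j.
  by apply: (@source_measurable_fun _ _ _ P _ X _ _ (past t)); exact: measurable_estimate.
have mbest t : measurable_fun setT (best t).
  exact: (@measurable_bigsum R _ _ _ _ astar).
have inc0 t w : 0 <= inc t w by exact: (incurred_ge0 model).
have best0 t w : 0 <= best t w by apply: sumr_ge0 => i _; case/andP: (l01 t w i).
have sum_le (Q : pred 'I_d) (f : 'I_d -> R) : (forall i, f i <= 1) -> \sum_(i | Q i) f i <= d%:R.
  move=> f1; apply: (@le_trans _ _ (\sum_(i | Q i) 1)); first exact: ler_sum.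
  by rewrite sumr_const ler_nat -[leqRHS]card_ord max_card.
have inc1 t w : inc t w <= d%:R.
  apply: sum_le => i; case/andP: (l01 t w i) => h0 h1.
  by case: (play _ _ _ _ _ i); rewrite ?mul1r ?mul0r.
have best1 t w : best t w <= d%:R by apply: sum_le => i; case/andP: (l01 t w i).
have path w : path_regret m sch c (realize X w) astar T =
    \sum_(t < T) inc t w - \sum_(t < T) best t w.
  rewrite -sumrB; apply: eq_bigr => t _; congr (_ - _).
    by apply: eq_bigr => i _; rewrite mulrC.
  rewrite /inner /best [RHS]big_mkcond /=; apply: eq_bigr => i _.
  by case: (astar i); rewrite ?mulr1 ?mulr0.
have int_sum (f : nat -> Om -> R) : (forall t, measurable_fun setT (f t)) ->
    (forall t w, 0 <= f t w) -> (forall t w, f t w <= d%:R) ->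
    P.-integrable setT (EFin \o (fun w => \sum_(t < T) f t w)).
  move=> mf f0 f1.
  apply: (@le_integrable _ _ _ P setT measurableT _ (EFin \o cst (\sum_(t < T) d%:R))) => //.
  - by apply/measurable_EFinP; exact: (@measurable_bigsum R _ _ _ _ xpredT).
  - move=> w _ /=; rewrite lee_fin !ger0_norm ?sumr_ge0 //.
    by apply: ler_sum => t _.
  - exact: finite_measure_integrable_cst.
rewrite /regret unlock.
under eq_integral do rewrite path EFinB.
rewrite integralB_EFin //; [|exact: int_sum|exact: int_sum].
rewrite -/(Ex P (fun w => \sum_(t < T) inc t w)) -/(Ex P (fun w => \sum_(t < T) best t w)).
rewrite !Ex_sum //.
have -> : (\sum_(t < T) Ex P (best t) = (\sum_(t < T) \sum_(i | astar i) mu i)%:E)%E.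
  rewrite -sumEFin; apply: eq_bigr => t _; rewrite Ex_sum // => [|i w].
    by rewrite -sumEFin; apply: eq_bigr => i _; exact: Ex_loss model t i.
  by case/andP: (l01 t w i).
rewrite leeBlDr // -EFinD -big_split /=.
exact: (total_incurred_le md model c0 astarA muM Dmin0 DeltaD).
Qed.

Lemma sum_cost_le T : (0 < T)%N ->
  \sum_(t < T) cost t <=
    gap_cst c * c ^+ 2 * \sum_(k | ~~ astar k) (ln T%:R / (mu k - Mst)) +
    2 * crude_cst c * c * switch_cst c * (m%:R ^+ 3 * d%:R) / Dmin.
Proof.
move=> T0.
pose M := size_cst (R := R) (d := d) m.
pose V := switch_cst c * M / Dmin.
pose S := \sum_(k | ~~ astar k) (mu k - Mst)^-1.
have cr0 := crude_cst_ge0 c0.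
have sw2 := switch_cst_ge2 c0.
have M1 : 1 <= M.
  have [m1 d1] : (0 < m)%N /\ (0 < d)%N by case/andP: md => h1 h2; split => //; exact: ltn_trans h1 h2.
  rewrite /M /size_cst; apply: mulr_ege1; first apply: mulr_ege1; rewrite ?ler1n //.
    by rewrite -[leLHS]sqrtr1 ler_wsqrtr // ler1n.
  by rewrite -[leLHS]sqrtr1 ler_wsqrtr // ler1n.
have M0 : 0 <= M by exact: le_trans ler01 M1.
have S0 : 0 <= S.
  by apply: sumr_ge0 => k /DeltaD h; rewrite invr_ge0; exact: le_trans (ltW Dmin0) h.
have V2 : 2 <= V.
  rewrite /V ler_pdivlMr //; move: sw2 M1; move: (switch_cst c) (M) => x y; move: Dmin1; nra.
have g0 : 0 <= gap_cst c * c ^+ 2 * S.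
  by rewrite mulr_ge0 // mulr_ge0 ?sqr_ge0 // mulr_ge0 ?sqr_ge0.
have a0 : 0 <= crude_cst c * c * M by rewrite mulr_ge0 // mulr_ge0 // ltW.
have cost_le t : cost t <=
    crude_cst c * c * M * (if Num.sqrt t.+1%:R < V then (Num.sqrt t.+1%:R)^-1 else 0) +
    gap_cst c * c ^+ 2 * S * (if (0 < t)%N then t.+1%:R^-1 else 0).
  rewrite /round_cost -/M -/V -/S /learning_rate; case: ltP => h.
    have -> : crude_cst c * (c / Num.sqrt t.+1%:R) * M = crude_cst c * c * M * (Num.sqrt t.+1%:R)^-1.
      by move: (crude_cst c) (_^-1) => x y; ring.
    by rewrite lerDl mulr_ge0 //; case: ifP => // _; rewrite invr_ge0.
  (* [V >= 2] rules out [t = 0] in a late round. *)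
  have -> : (0 < t)%N.
    case: t h => // /(le_trans V2); rewrite sqrtr1 => h; exfalso; move: h; lra.
  rewrite mulr0 add0r expr_div_n sqr_sqrtr // le_eqVlt; apply/orP; left; apply/eqP.
  by move: (gap_cst c) (S) (_^-1) => x y z; ring.
apply: le_trans; first by apply: ler_sum => t _; exact: cost_le.
rewrite big_split /= -!mulr_sumr addrC; apply: lerD.
  apply: le_trans (ler_wpM2l g0 (sum_inv_ln T0)) _.
  by rewrite -/S le_eqVlt; apply/orP; left; apply/eqP; ring.
(* The inverse roots of the early rounds sum to at most [2 * V], for a total of order [M * V], that
   is [M ^+ 2 / Dmin]. *)
apply: le_trans (ler_wpM2l a0 (sum_inv_sqrt_below T _)) _; first exact: le_trans V2.
apply: le_trans (ler_wpM2l a0 (_ : _ <= 2 * V)) _.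
  by rewrite ler_wpM2l // ge_min lexx orbT.
have M2 : M ^+ 2 = m%:R ^+ 3 * d%:R.
  by rewrite /M /size_cst !exprMn !sqr_sqrtr // -exprSr.
rewrite -M2 /V le_eqVlt; apply/orP; left; apply/eqP.
by move: (crude_cst c) (switch_cst c) (M) (Dmin^-1) => x y z u; ring.
Qed.

End RegretBound.

(** * Separation of the optimal arms from the others *)

Section Gaps.
Context {R : realType} {d m : nat}.
Variables (mu : 'I_d -> R) (astar : {ffun 'I_d -> bool}).
Hypothesis opt : unique_argmin m mu astar.

(** Exchanging [j] for [k] in [astar] gives another action, strictly worse by uniqueness. *)
Lemma unique_argmin_lt j k : astar j -> ~~ astar k -> mu j < mu k.
Proof.
case: opt => act best aj ak.
have kj : k != j by apply: contraNneq ak => ->.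
pose a : {ffun 'I_d -> bool} := [ffun i => (i == k) || (i != j) && astar i].
have aA : is_action m a.
  move: act; rewrite !is_actionE => /eqP <-.
  rewrite (_ : [set i | a i]%SET = k |: ([set i | astar i] :\ j))%SET; last first.
    by apply/setP => i; rewrite !inE ffunE.
  by apply/eqP; rewrite cardsU1 !inE (negbTE ak) andbF /= [RHS](cardsD1 j) !inE aj.
have ne : a <> astar.
  by move=> /ffunP/(_ k); rewrite ffunE eqxx => e; rewrite -e in ak.
have := best a aA ne; rewrite /inner.
rewrite (bigD1 j) //= [X in _ < X](bigD1 j) //= (bigD1 k) //= [X in _ < _ + X](bigD1 k) //=.
rewrite !ffunE eqxx (negbTE ak) aj [j == k]eq_sym (negbTE kj) eqxx /= !mulr1 !mulr0 !add0r.
rewrite (eq_bigr (fun i => mu i * (a i)%:R)) => [|i /andP[ij ik]]; last first.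
  by rewrite ffunE ij (negbTE ik).
by rewrite ltrD2r.
Qed.

Lemma sup_best j0 : astar j0 -> (forall j, astar j -> mu j <= mu j0) ->
  sup [set mu j | j in [set j | astar j]] = mu j0.
Proof.
move=> aj0 jmax; apply/eqP; rewrite eq_le; apply/andP; split.
  by apply: ge_sup => [|_ [j aj <-]]; [exists (mu j0), j0|exact: jmax].
apply: ub_le_sup; last by exists j0.
by exists (mu j0) => _ [j aj <-]; exact: jmax.
Qed.

Lemma min_gap_attained k0 : ~~ astar k0 ->
  (forall k, ~~ astar k -> gap mu astar k0 <= gap mu astar k) ->
  min_gap mu astar = (gap mu astar k0)%:E.
Proof.
move=> ak0 kmin; apply/eqP; rewrite eq_le; apply/andP; split.
  by apply: ereal_inf_lbound; exists k0.
by apply: le_ereal_inf_tmp => _ [k ak <-]; rewrite lee_fin; exact: kmin.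
Qed.

End Gaps.

Lemma full_action (d : nat) (a : {ffun 'I_d -> bool}) i : is_action d a -> a i.
Proof.
rewrite is_actionE => /eqP h.
have /eqP : [set i | a i]%SET == [set: 'I_d]%SET.
  by rewrite eqEcard finset.subsetT cardsT card_ord h leqnn.
by move=> /setP/(_ i); rewrite !inE.
Qed.

Theorem theorem4 (R : realType) (c : R) (hc : 0 < c) :
  exists C1 C2 : R, 0 <= C1 /\ 0 <= C2 /\
  forall (D : perturbation) (d m : nat) (sch : resampling d)
    (disp : measure_display) (Omega : measurableType disp)
    (P : probability Omega R) (nu : probability (d.-tuple R) R)
    (X : randomness P d) (astar : {ffun 'I_d -> bool}) (T : nat),
    (0 < m <= d)%N -> (0 < T)%N ->
    stochastic_model m D sch nu X ->
    unique_argmin m (mean_loss nu) astar ->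
    (regret m sch c X astar T <=
      (C1 * \sum_(i | ~~ astar i) (ln T%:R / gap (mean_loss nu) astar i))%:E
      + (C2 * (m%:R ^+ 3 * d%:R))%:E / min_gap (mean_loss nu) astar)%E.
Proof.
exists (gap_cst c * c ^+ 2), (2 * crude_cst c * c * switch_cst c).
have cr0 := crude_cst_ge0 hc; have sw2 := switch_cst_ge2 hc.
have sw0 : 0 <= switch_cst c by exact: le_trans sw2.
split; first by rewrite mulr_ge0 ?sqr_ge0 // mulr_ge0 ?sqr_ge0.
split; first exact: mulr_ge0 (mulr_ge0 (mulr_ge0 (ler0n _ 2) cr0) (ltW hc)) sw0.
move=> D d m sch disp Omega P nu X astar T /andP[m0 md] T0 model opt.
have [astarA _] := opt.
(* For [m = d] the only action is [astar]: the regret vanishes, and so does the right-hand side, the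
   minimal gap being [+oo]. *)
case: (ltngtP m d) md => // [md _|e _]; last first.
  subst m; have full i : astar i by exact: full_action.
  rewrite big_pred0 => [|i]; last by rewrite full.
  rewrite mulr0 add0e.
  rewrite (_ : min_gap _ _ = +oo%E) ?invey ?mule0; last first.
    rewrite /min_gap (_ : [set _ | _ in _] = set0) ?ereal_inf0 //.
    by apply/seteqP; split => // x [i /=]; rewrite full.
  rewrite /regret unlock (_ : (fun w => _) = cst 0%E) ?integral0 //.
  apply/funext => w; rewrite /path_regret big1 // => t _; apply/eqP; rewrite subr_eq0; apply/eqP.
  apply: eq_bigr => i _; rewrite full /ftpl_action /play.
  by rewrite full_action //; case: (argmin_actionP (fun i => learning_rate c t * cum_loss_estimate d sch c (realize X w) t i - pert_of (realize X w) t i) (leqnn d)).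
have md' : (0 < m < d)%N by rewrite m0.
have cA : #|[set i | astar i]%SET| = m by apply/eqP; rewrite -is_actionE.
have [j1 j1A] : exists j, j \in [set i | astar i]%SET by apply/card_gt0P; rewrite cA.
have [k1 k1A] : exists k, k \in [set i | ~~ astar i]%SET.
  apply/card_gt0P; have := cardsC [set i | astar i]%SET; rewrite cA card_ord.
  rewrite (_ : ~: [set i | astar i] = [set i | ~~ astar i])%SET; last by apply/setP => i; rewrite !inE.
  by move: md; case: #|_| => // + h; rewrite -h addn0 ltnn.
rewrite !inE in j1A k1A.
(* The mean of the worst arm [j0] of [astar] serves as [Mst], the gap of the best arm [k0] outside
   as [Dmin]. *)
case: (@arg_maxP _ R _ j1 (fun j => astar j) (mean_loss nu) j1A) => j0 aj0 jmax.
case: (@arg_minP _ R _ k1 (fun k => ~~ astar k) (mean_loss nu) k1A) => k0 ak0 kmin.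
have gapE k : gap (mean_loss nu) astar k = mean_loss nu k - mean_loss nu j0.
  by rewrite /gap (sup_best aj0 jmax).
have gap0 : 0 < mean_loss nu k0 - mean_loss nu j0.
  by rewrite subr_gt0; exact: (unique_argmin_lt opt).
have gap1 : mean_loss nu k0 - mean_loss nu j0 <= 1.
  have /andP[_ h1] := mean_loss01 model k0; have /andP[h2 _] := mean_loss01 model j0.
  lra.
have gapD k : ~~ astar k -> mean_loss nu k0 - mean_loss nu j0 <= mean_loss nu k - mean_loss nu j0.
  by move=> ak; rewrite lerD2r; exact: kmin.
rewrite (min_gap_attained ak0) ?gapE; last by move=> k ak; rewrite !gapE gapD.
rewrite inver gt_eqF // -EFinM -EFinD.
apply: le_trans (regret_le_costs md' model hc astarA jmax gap0 gapD T) _.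
rewrite lee_fin; apply: le_trans (sum_cost_le md' hc gap0 gap1 gapD T0) _.
rewrite lerD2r ler_wpM2l //; first by rewrite mulr_ge0 ?sqr_ge0 // mulr_ge0 ?sqr_ge0.
by rewrite le_eqVlt; apply/orP; left; apply/eqP/eq_bigr => k _; rewrite gapE.
Qed.
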